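(* Let $d=1$, $f\in\mathcal{S}(\mathbb{R})$, and let $(\xi_x)_{x\in\mathbb{Z}}$ be i.i.d. real random variables whose characteristic function $\varphi(t)=\mathbb{E}[e^{2\pi\mathbf{i}t\xi_0}]$ satisfies $1-\varphi(x)\sim c|x|$ as $|x|\to0$, for some $c>0$. Let $T_r^0=\sum_{x\in\mathbb{Z}} f((x+\xi_x)/r)$. Then: \begin{enumerate} \item $T_r^0 - r\int_{\mathbb{R}} f(x)\,dx$ converges in distribution as $r\to\infty$ toward a random variable whose distribution is characterized by its moments. \item If $f(x)=e^{-x^2}$, then this limit distribution is not Gaussian. \end{enumerate}
   Context: $\mathcal{S}(\mathbb{R})$ denotes the Schwartz space of infinitely differentiable functions all of whose derivatives decay faster than any polynomial. *)

(* Defs.v *)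
From HB Require Import structures.
From mathcomp Require Import all_boot all_order all_algebra.
From mathcomp Require Import all_classical all_reals all_analysis.
Set Implicit Arguments. Unset Strict Implicit. Unset Printing Implicit Defensive.
Import Order.TTheory GRing.Theory Num.Theory.
Import numFieldNormedType.Exports.
Local Open Scope classical_set_scope.
Local Open Scope ring_scope.

Definition schwartz (R : realType) (f : R -> R) : Prop :=
  (forall (n : nat) (x : R), derivable (derive1n n f) x 1) /\
  (forall k n : nat, exists M : R, forall x : R,
      `|x| ^+ k * `|derive1n n f x| <= M).

Definition mutually_independent (d : measure_display) (T : measurableType d)
  (R : realType) (P : probability T R) (xi : int -> T -> R) : Prop :=
  forall (s : seq int) (B : int -> set R),
    uniq s -> (forall i, measurable (B i)) ->
    P (\big[setI/setT]_(i <- s) (xi i @^-1` B i))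
    = (\prod_(i <- s) P (xi i @^-1` B i))%E.

Definition identically_distributed (d : measure_display) (T : measurableType d)
  (R : realType) (P : probability T R) (xi : int -> T -> R) : Prop :=
  forall (x : int) (B : set R), measurable B ->
    P (xi x @^-1` B) = P (xi 0 @^-1` B).

Definition charfun_re (d : measure_display) (T : measurableType d)
  (R : realType) (P : probability T R) (X : T -> R) (t : R) : R :=
  Rintegral P setT (fun w => cos (2 * pi * t * X w)).
Definition charfun_im (d : measure_display) (T : measurableType d)
  (R : realType) (P : probability T R) (X : T -> R) (t : R) : R :=
  Rintegral P setT (fun w => sin (2 * pi * t * X w)).

Definition Tstat (d : measure_display) (T : measurableType d) (R : realType)
  (f : R -> R) (xi : int -> T -> R) (r : R) (w : T) : R :=
  limn (fun N : nat => \sum_(i < (2 * N).+1)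
          f ((((Posz i - Posz N)%R)%:~R + xi (Posz i - Posz N)%R w) / r)).

Definition finite_moments (R : realType) (mu : probability R R) : Prop :=
  forall k : nat, mu.-integrable setT (fun x : R => (x ^+ k)%:E).

Definition moment_determinate (R : realType) (mu : probability R R) : Prop :=
  finite_moments mu /\
  forall nu : probability R R, finite_moments nu ->
    (forall k : nat, (\int[nu]_x (x ^+ k)%:E = \int[mu]_x (x ^+ k)%:E)%E) ->
    forall A : set R, measurable A -> nu A = mu A.

Definition gaussian (R : realType) (mu : probability R R) : Prop :=
  exists m s : R,
    forall A : set R, measurable A ->
      mu A = (if s == 0 then \d_m A else normal_prob m s A).

Definition cvg_in_distribution (d : measure_display) (T : measurableType d)
  (R : realType) (P : probability T R) (Y : R -> T -> R)
  (mu : probability R R) : Prop :=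
  forall g : R -> R, continuous g -> (exists M : R, forall x, `|g x| <= M) ->
    (fun r : R => (\int[P]_w (g (Y r w))%:E)%E) @ +oo%R
      --> (\int[mu]_y (g y)%:E)%E.

(* Main.v *)
(* By independence, E exp(th (T_r - r int f)) is a product over the sites x of
   exp(th f(x/r)) (1 + b_r(x)) with b_r(x) = E[exp(th (f((x + X)/r) - f(x/r))) - 1].
   The hypothesis on the characteristic function gives P(|X| > s) = O(1/s) and
   |E sin(X/r)| = O(1/r), so |b_r(x)| = O(1/r) uniformly, and the midpoint rule
   turns the sum of the b_r(x) into r E[Gam(X/r)] + O(1/r), where
   Gam(u) = int (exp(th (f(y + u) - f(y))) - 1) dy satisfies
   |Gam(u)| <= K min(1, u^2). For such functions r E[Gam(X/r)] converges, because
   it does for trigonometric polynomials vanishing at 0. Hence the moment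
   generating functions converge to some exp(psi(th)) for every real th; the
   limit law then exists, has these exponential moments, and is therefore
   determined by its moments. For f(y) = exp(-y^2), psi(th) + psi(-th) is at
   least k th^4 with k > 0, whereas it is quadratic in th for a Gaussian law. *)

Require Import Defs.
From HB Require Import structures.
From mathcomp Require Import all_boot all_order all_algebra.
From mathcomp Require Import all_classical all_reals all_analysis.
From mathcomp Require Import measurable_realfun ring lra zify.
Import Order.TTheory GRing.Theory Num.Theory.
Import numFieldNormedType.Exports.
Set Implicit Arguments.
Unset Strict Implicit.
Unset Printing Implicit Defensive.
Local Open Scope classical_set_scope.
Local Open Scope ring_scope.

(** * Integrals of real-valued functions *)

(** The hypothesis controls only the sine and cosine means of [X / r]: [E |X|] is infinite, so [X]
    cannot be expanded in its moments, and no tail asymptotics is assumed. Linear terms in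
    [u = X / r] are therefore replaced by [sin u], whose mean is governed by the imaginary part of
    the characteristic function, and quadratic ones by [min(1, u^2)], which a dyadic sum of terms
    [1 - cos] dominates. Real exponents [th] keep every factor a positive real, so that its ordinary
    logarithm exists. The quadratic bound on [Gam] near 0 comes from translation invariance: the
    integral of [f(y + u) - f(y)] vanishes. The number [psi(th)] is never computed; its existence
    follows from completeness, with trigonometric polynomials as approximants of [Gam]. The
    non-Gaussian bound rests on [2 cosh v - 2 >= v^4 / 12] and on [(1 - cos u)^2], a trigonometric
    polynomial whose scaled mean has the explicit positive limit [c / (2 pi)]. Bounded continuous
    test functions are reached from exponentials through powers, then sines and cosines, then
    polynomials in [sin (x / L)]. *)

Section RealIntegral.
Context {d : measure_display} {T : measurableType d} {R : realType}.
Variable mu : {measure set T -> \bar R}.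
Implicit Types f g : T -> R.

Lemma measurable_ler_set f g : measurable_fun setT f ->
  measurable_fun setT g -> measurable [set x | f x <= g x].
Proof.
move=> mf mg; have := measurable_fun_ler mf mg measurableT (_ : measurable [set true]).
by rewrite setTI; apply.
Qed.

Definition rintegrable f : Prop := mu.-integrable setT (EFin \o f).

Lemma rintegrable_measurable f : rintegrable f -> measurable_fun setT f.
Proof. by move=> /measurable_int/measurable_EFinP. Qed.

Lemma rintegrable_le f g : measurable_fun setT f ->
  (forall x, `|f x| <= g x) -> rintegrable g -> rintegrable f.
Proof.
move=> mf fg ig; apply: (le_integrable measurableT _ _ ig).
  exact/measurable_EFinP.
by move=> x _ /=; rewrite lee_fin (le_trans (fg x))// ler_norm.
Qed.

Lemma rintegrableD f g :
  rintegrable f -> rintegrable g -> rintegrable (fun x => f x + g x).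
Proof.
by move=> fi gi; have := integrableD measurableT fi gi.
Qed.

Lemma rintegrableB f g :
  rintegrable f -> rintegrable g -> rintegrable (fun x => f x - g x).
Proof.
by move=> fi gi; have := integrableB measurableT fi gi.
Qed.

Lemma rintegrableZ (k : R) f :
  rintegrable f -> rintegrable (fun x => k * f x).
Proof. by move=> fi; have := integrableZl measurableT k fi. Qed.

Lemma rintegrable_sum (I : Type) (s : seq I) (h : I -> T -> R) :
  (forall i, rintegrable (h i)) -> rintegrable (fun x => \sum_(i <- s) h i x).
Proof.
move=> hi; rewrite /rintegrable.
have -> : EFin \o (fun x => \sum_(i <- s) h i x) =
   (fun x => (\sum_(i <- s) (h i x)%:E)%E).
  by apply/funext => x /=; rewrite sumEFin.
by apply: (integrable_sum measurableT) => i _; exact: hi.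
Qed.

Lemma rintegral_sum (I : Type) (s : seq I) (h : I -> T -> R) :
  (forall i, rintegrable (h i)) ->
  Rintegral mu setT (fun x => \sum_(i <- s) h i x) =
  \sum_(i <- s) Rintegral mu setT (h i).
Proof.
move=> hi; elim: s => [|a s ih].
  rewrite big_nil (_ : (fun _ => _) = cst 0); last first.
    by apply/funext => x; rewrite big_nil.
  by rewrite /Rintegral integral0.
rewrite big_cons -ih -RintegralD//; last 2 first.
- exact: hi.
- exact: rintegrable_sum.
by apply: eq_Rintegral => x _; rewrite big_cons.
Qed.

Lemma rintegral_norm_le f g : measurable_fun setT f ->
  (forall x, `|f x| <= g x) -> rintegrable g ->
  `|Rintegral mu setT f| <= Rintegral mu setT g.
Proof.
move=> mf fg ig; have fi := rintegrable_le mf fg ig.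
apply: (le_trans (le_normr_Rintegral measurableT fi)).
by apply: le_Rintegral => //; exact: (integrable_norm fi).
Qed.

Lemma rintegral_le f g : rintegrable f -> rintegrable g ->
  (forall x, f x <= g x) -> Rintegral mu setT f <= Rintegral mu setT g.
Proof. by move=> fi gi fg; exact: le_Rintegral. Qed.

Lemma rintegral_cvg (f_ : nat -> T -> R) f g :
  (forall n, measurable_fun setT (f_ n)) ->
  (forall n x, `|f_ n x| <= g x) -> rintegrable g ->
  (forall x, f_ n x @[n --> \oo] --> f x) ->
  rintegrable f /\
  Rintegral mu setT (f_ n) @[n --> \oo] --> Rintegral mu setT f.
Proof.
move=> mf fg ig ff.
have mlim : measurable_fun setT f.
  by apply: (measurable_fun_cvg mf) => x _; exact: ff.
have cf x : setT x -> EFin \o f_ ^~ x @ \oo --> (EFin \o f) x.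
  by move=> _; apply: cvg_EFin; [exact: nearW|exact: ff].
have lefg x : `|f x| <= g x.
  apply: (@cvgr_to_le _ \oo _ R (fun n => `|f_ n x|)).
    by apply: cvg_norm; exact: ff.
  by apply: nearW => n; exact: fg.
have fi := rintegrable_le mlim lefg ig.
split=> //; apply: fine_cvg => /=.
rewrite fineK; last exact: (integrable_fin_num measurableT fi).
apply: (@dominated_cvg _ _ _ mu setT measurableT (fun n x => (f_ n x)%:E) (EFin \o f) (EFin \o g)) => //.
- by move=> n; exact/measurable_EFinP.
- by move=> n x _ /=; rewrite lee_fin.
Qed.

End RealIntegral.

Section ProbabilityIntegral.
Context {d : measure_display} {T : measurableType d} {R : realType}.
Variable P : probability T R.
Implicit Types f g : T -> R.

Lemma rintegrable_bounded f (M : R) : measurable_fun setT f ->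
  (forall x, `|f x| <= M) -> rintegrable P f.
Proof.
move=> mf fM; apply: (@rintegrable_le _ _ _ _ f (cst M)) => //.
exact: finite_measure_integrable_cst.
Qed.

Lemma rintegrable_cst (c : R) : rintegrable P (fun=> c).
Proof. exact: finite_measure_integrable_cst. Qed.

Lemma rintegral_cst (c : R) : Rintegral P setT (fun=> c) = c.
Proof.
have := @Rintegral_cst _ _ _ P setT measurableT c.
by rewrite [X in fine X](_ : _ = 1%E) ?mulr1 //; exact: probability_setT.
Qed.

Lemma rintegral_bounded f (M : R) : measurable_fun setT f ->
  (forall x, `|f x| <= M) -> `|Rintegral P setT f| <= M.
Proof.
move=> mf fM; rewrite -(rintegral_cst M); apply: rintegral_norm_le => //.
exact: (@rintegrable_bounded _ `|M|).
Qed.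

End ProbabilityIntegral.

(** * Lattice sums and the weight 1 / (1 + y^2) *)

Section SymmetricSums.
Variable R : realType.
Implicit Types a b : int -> R.

(** Same shape as the partial sums in [Tstat], so that [Tstat f xi r w] is the [limn] of a [symsum]
    by conversion. *)
Definition symsum a (N : nat) : R :=
  \sum_(i < (2 * N).+1) a (Posz i - Posz N)%R.

Lemma symsum0 a : symsum a 0 = a 0.
Proof. by rewrite /symsum muln0 big_ord_recl big_ord0 addr0. Qed.

Lemma symsumS a N :
  symsum a N.+1 = symsum a N + (a (Posz N.+1) + a (- Posz N.+1)).
Proof.
have E : (2 * N.+1 = (2 * N).+2)%N by rewrite mulnS.
rewrite /symsum E big_ord_recl big_ord_recr /=.
rewrite addrCA; congr (_ + _).
  by apply: eq_bigr => i _; congr a; rewrite /bump /=; lia.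
by rewrite addrC; congr (a _ + a _); rewrite /bump /=; lia.
Qed.

Lemma symsum_le a b N : (forall x, a x <= b x) -> symsum a N <= symsum b N.
Proof. by move=> ab; apply: ler_sum. Qed.

Lemma symsumD a b N : symsum (fun x => a x + b x) N = symsum a N + symsum b N.
Proof. exact: big_split. Qed.

Lemma symsumZ (k : R) a N : symsum (fun x => k * a x) N = k * symsum a N.
Proof. by rewrite /symsum mulr_sumr. Qed.

Lemma symsumB a b N : symsum (fun x => a x - b x) N = symsum a N - symsum b N.
Proof. exact: sumrB. Qed.

Lemma norm_symsum_le a N : `|symsum a N| <= symsum (fun x => `|a x|) N.
Proof. exact: ler_norm_sum. Qed.

(** Pairing the terms at [n] and [- n] turns symmetric sums into the partial sums, shifted by one,
    of an ordinary series that converges absolutely. *)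
Lemma symsum_cvg a (M : R) :
  (forall N, symsum (fun x => `|a x|) N <= M) -> cvgn (symsum a).
Proof.
move=> aM.
pose b n : R := if n is m.+1 then a (Posz n) + a (- Posz n) else a 0.
have symE N : symsum a N = series b N.+1.
  elim: N => [|N IH]; first by rewrite symsum0 seriesEnat /= big_nat1.
  by rewrite symsumS IH [in RHS]seriesSr.
have nsymE N : series (fun n => `|b n|) N.+1 <= symsum (fun x => `|a x|) N.
  elim: N => [|N IH]; first by rewrite symsum0 seriesEnat /= big_nat1.
  by rewrite symsumS seriesSr lerD//= ler_normD.
have nb n : series (fun n => `|b n|) n <= M.
  case: n => [|n]; last exact: le_trans (nsymE n) (aM n).
  rewrite seriesEnat /= big_geq//; apply: le_trans (aM 0%N).
  by rewrite symsum0.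
have cb : cvgn (series b).
  apply: normed_cvg; apply: nondecreasing_is_cvgn.
    by apply: nondecreasing_series => n _ _ /=.
  by exists M => _ [n _ <-]; exact: nb.
have -> : symsum a = [sequence series b n.+1]_n by apply/funext => N; rewrite symE.
by apply/cvg_ex; exists (limn (series b)); rewrite (cvg_shiftS (series b)).
Qed.

(** The cells of half-width [h] centred at the points [2 * h * x] abut. *)
Lemma symsum_telescope (F : R -> R) (h : R) N :
  symsum (fun x => F (x%:~R *+ 2 * h + h) - F (x%:~R *+ 2 * h - h)) N =
  F (N%:R *+ 2 * h + h) - F (- (N%:R *+ 2 * h + h)).
Proof.
elim: N => [|N IH].
  by rewrite symsum0 !mulr0n !mul0rn !mul0r !add0r.
rewrite symsumS IH mulrNz.
set t := (N%:R : R).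
have -> : ((Posz N.+1)%:~R : R) = 1 + t by rewrite -[LHS]/(N.+1%:R) -natr1 addrC.
have -> : N.+1%:R = 1 + t by rewrite -natr1 addrC.
have -> : (1 + t) *+ 2 * h - h = t *+ 2 * h + h by ring.
have -> : - (1 + t) *+ 2 * h + h = - (t *+ 2 * h + h) by ring.
have -> : - (1 + t) *+ 2 * h - h = - ((1 + t) *+ 2 * h + h) by ring.
by ring.
Qed.

End SymmetricSums.

Section Weight.
Variable R : realType.
Local Notation mu := (@lebesgue_measure R).

(** The derivative of [atan]: its lattice sums compare with telescoping differences of [atan]. *)
Definition wt (y : R) : R := (1 + y ^+ 2)^-1.

Lemma wt_gt0 y : 0 < wt y.
Proof. by rewrite invr_gt0 ltr_pwDl// sqr_ge0. Qed.

Lemma wt_ge0 y : 0 <= wt y.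
Proof. exact/ltW/wt_gt0. Qed.

Lemma wt_le1 y : wt y <= 1.
Proof. by rewrite invf_le1 ?lerDl ?sqr_ge0// ltr_pwDl// sqr_ge0. Qed.

(** From [y ^ 2 <= 2 * (y + s) ^ 2 + 2 * s ^ 2] and [s ^ 2 <= 1]. *)
Lemma wt_shift y s : `|s| <= 1 -> wt (y + s) <= 3 * wt y.
Proof.
move=> s1; rewrite /wt ler_pdivlMr ?ltr_pwDl ?sqr_ge0//.
rewrite mulrC ler_pdivrMr ?ltr_pwDl ?sqr_ge0//.
have s2 : s ^+ 2 <= 1 by rewrite -real_normK ?num_real// expr_le1.
have := sqr_ge0 (y + s + s); have := sqr_ge0 (y + s); nra.
Qed.

Lemma wtN y : wt (- y) = wt y.
Proof. by rewrite /wt sqrrN. Qed.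

Lemma continuous_wt : continuous wt.
Proof. exact: continuous_oneDsqrV. Qed.

Lemma measurable_wt : measurable_fun setT wt.
Proof. exact: (continuous_measurable_fun continuous_wt). Qed.

Lemma atan_wt (a b : R) : a < b -> b - a <= 1 ->
  (b - a) * wt ((a + b) / 2) <= 3 * (atan b - atan a).
Proof.
move=> ab ba1.
have dat x : x \in `]a, b[ -> is_derive x 1 (@atan R) (wt x).
  by move=> _; exact: is_derive1_atan.
have cat : {within `[a, b], continuous (@atan R)}.
  by apply: continuous_subspaceT => x; exact: continuous_atan.
have [c cab ->] := MVT ab dat cat.
rewrite [leRHS]mulrA [leLHS]mulrC ler_pM2r ?subr_gt0//.
have := @wt_shift c ((a + b) / 2 - c); rewrite (addrC c) subrK; apply.
by move: cab; rewrite in_itv/= ler_norml => /andP[? ?]; lra.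
Qed.

(** After telescoping only the total variation [pi] of [atan] remains, whatever the shift [s]. The
    uniformity in [s] matters: [s] will be the random displacement. *)
Lemma symsum_wt (r s : R) N : 1 <= r ->
  symsum (fun x => wt ((x%:~R + s) / r)) N <= 3 * pi * r.
Proof.
move=> r1; have r0 : 0 < r by rewrite (lt_le_trans _ r1).
pose h := 1 / (2 * r).
have h0 : 0 < h by rewrite divr_gt0// mulr_gt0.
apply: (@le_trans _ _ (symsum (fun x => 3 * r * (atan (x%:~R *+ 2 * h + h + s / r)
   - atan (x%:~R *+ 2 * h - h + s / r))) N)).
  apply: symsum_le => x; set y : R := x%:~R.
  have := @atan_wt (y *+ 2 * h - h + s / r) (y *+ 2 * h + h + s / r).
  have -> : (y *+ 2 * h - h + s / r + (y *+ 2 * h + h + s / r)) / 2 = (y + s) / r.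
    by rewrite /h; field; rewrite gt_eqF.
  have -> : y *+ 2 * h + h + s / r - (y *+ 2 * h - h + s / r) = r^-1.
    by rewrite /h; field; rewrite gt_eqF.
  move=> H; rewrite (mulrC 3) -(mulrA r) -ler_pdivrMl//; apply: H.
    by rewrite ltrD2r ltrD2l gtrN.
  by rewrite invf_le1.
rewrite symsumZ (symsum_telescope (fun y => atan (y + s / r))).
rewrite mulrAC ler_pM2r// ler_pM2l//.
set A := atan _; set B := atan _.
have : A <= pi / 2 by apply/ltW; exact: atan_ltpi2.
have : - (pi / 2) <= B by apply/ltW; exact: atan_gtNpi2.
by lra.
Qed.

Lemma rintegrable_wt : rintegrable mu wt.
Proof.
apply/integrableP; split; first by apply/measurable_EFinP; exact: measurable_wt.
under eq_integral do rewrite /= ger0_norm ?wt_ge0//.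
rewrite ge0_symfun_integralT.
- rewrite (_ : [set x : R | _] = `[0, +oo[%classic); last first.
    by apply/seteqP; split => x/=; rewrite in_itv/= andbT.
  by rewrite (integral0y_oneDsqr R) -EFinM ltry.
- exact: wt_ge0.
- exact: continuous_wt.
- by move=> x /=; rewrite wtN.
Qed.

End Weight.

(** * Translation invariance, the mean value inequality and the midpoint rule *)

Section TranslationInvariance.
Variable R : realType.
Local Notation mu := (@lebesgue_measure R).

Lemma ge0_integral_shift (g : R -> R) (u : R) : continuous g ->
  (forall x, 0 <= g x) ->
  (\int[mu]_x (g (x + u))%:E = \int[mu]_x (g x)%:E)%E.
Proof.
move=> cg g0.
have dF (x : R) : is_derive x 1 (fun x : R => x + u) (1 : R).
  by rewrite -[X in is_derive _ _ _ X]addr0; apply: is_deriveD.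
have dE : (fun x : R => x + u)^`()%classic = cst 1.
  by apply/funext => x; rewrite derive1E derive_val.
rewrite [RHS](@increasing_ge0_integration_by_substitutionT _ (fun x => x + u))//.
- by apply: eq_integral => x _; rewrite dE /= fctE /= mulr1.
- by move=> x y; rewrite ltrD2r.
- by rewrite dE => x; exact: cvg_cst.
- by rewrite dE; exact: is_cvg_cst.
- by rewrite dE; exact: is_cvg_cst.
- exact: cvg_addrr_Ny.
- exact: cvg_addrr.
Qed.

(** The nonnegative case is applied to [|g|] and [|g| + g], whose difference gives [g]. *)
Lemma rintegral_shift (g : R -> R) (u : R) : continuous g -> rintegrable mu g ->
  rintegrable mu (fun x => g (x + u)) /\
  Rintegral mu setT (fun x => g (x + u)) = Rintegral mu setT g.
Proof.
move=> cg ig.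
have cn : continuous (fun x => `|g x|).
  by move=> x; apply: cvg_norm; exact: cg.
have cp : continuous (fun x => `|g x| + g x).
  by move=> x; apply: cvgD; [exact: cn|exact: cg].
have ign : rintegrable mu (fun x => `|g x|) by exact: integrable_norm.
have cs (k : R -> R) : continuous k -> continuous (fun x => k (x + u)).
  by move=> ck x; apply: continuous_comp; [apply: cvgD; [exact: cvg_id|exact: cvg_cst]|exact: ck].
have tr (k : R -> R) : continuous k -> (forall x, 0 <= k x) -> rintegrable mu k ->
    rintegrable mu (fun x => k (x + u)) /\
    Rintegral mu setT (fun x => k (x + u)) = Rintegral mu setT k.
  move=> ck k0 /integrableP[mk kfin]; split; last first.
    by rewrite /Rintegral ge0_integral_shift.
  apply/integrableP; split.
    by apply/measurable_EFinP; apply: continuous_measurable_fun; exact: cs.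
  move: kfin; under eq_integral do rewrite /= ger0_norm//.
  by under [in X in _ -> X]eq_integral do rewrite /= ger0_norm//; rewrite ge0_integral_shift.
have p0 x : 0 <= `|g x| + g x by rewrite -lerBlDr sub0r -normrN ler_norm.
have [i1 e1] := tr _ cn (fun x => normr_ge0 (g x)) ign.
have [i2 e2] := tr _ cp p0 (rintegrableD ign ig).
have gE x : g x = (`|g x| + g x) - `|g x| by rewrite addrC addKr.
split.
  rewrite (_ : (fun x => g (x + u)) = fun x => (`|g (x + u)| + g (x + u)) - `|g (x + u)|).
    exact: rintegrableB.
  by apply/funext => x; exact: gE.
transitivity (Rintegral mu setT (fun x => (`|g (x + u)| + g (x + u)) - `|g (x + u)|)).
  by apply: eq_Rintegral => x _; exact: gE.
rewrite RintegralB// e1 e2 -RintegralB//; last exact: rintegrableD.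
by apply: eq_Rintegral => x _; rewrite -gE.
Qed.

End TranslationInvariance.

Section LebesgueComparison.
Variable R : realType.
Local Notation mu := (@lebesgue_measure R).
Implicit Types f g : R -> R.

Lemma rintegrable_lebesgue_le f g : continuous f ->
  (forall x, `|f x| <= g x) -> rintegrable mu g -> rintegrable mu f.
Proof.
move=> cf fg; apply: (@rintegrable_le _ _ _ mu) => //.
exact: continuous_measurable_fun.
Qed.

Lemma rintegral_lebesgue_norm_le f g : rintegrable mu f ->
  (forall x, `|f x| <= g x) -> rintegrable mu g ->
  `|Rintegral mu setT f| <= Rintegral mu setT g.
Proof.
move=> fi; apply: (@rintegral_norm_le _ _ _ mu).
exact: rintegrable_measurable fi.
Qed.

End LebesgueComparison.

Section MeanValue.
Variable R : realType.
Implicit Types f df : R -> R.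

Lemma is_derive_continuous f df : (forall x : R, is_derive x 1 f (df x)) ->
  continuous f.
Proof.
move=> dfE x; apply/differentiable_continuous/derivable1_diffP.
exact: ex_derive.
Qed.

Lemma is_derive_comp_affine f (v a b s : R) : is_derive (a + b * s) 1 f v ->
  is_derive s 1 (fun s => f (a + b * s)) (v * b).
Proof.
move=> dfv; apply: (@is_derive1_comp _ f (fun s => a + b * s)) => //.
have d2 : is_derive s 1 (b \*: (@id R)) (b *: 1).
  by apply: is_deriveZ; exact: is_derive_id.
have := is_deriveD (is_derive_cst a s 1) d2; rewrite add0r scaler1 => H.
exact: H.
Qed.

Lemma mean_value_norm f df (a b M : R) :
  (forall x : R, is_derive x 1 f (df x)) -> 0 <= b ->
  (forall s, `|s| <= b -> `|df (a + s)| <= M) ->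
  forall s, `|s| <= b -> `|f (a + s) - f a| <= M * `|s|.
Proof.
move=> dfE b0 dfM s sb.
have cf : continuous f := is_derive_continuous dfE.
have [s0|s0] := leP 0 s.
  have as_ : a <= a + s by rewrite lerDl.
  have [c] := MVT_segment as_ (fun x _ => dfE x) (continuous_subspaceT cf).
  rewrite in_itv /= => /andP[ac cs] ->; rewrite addrAC subrr add0r normrM.
  rewrite ler_wpM2r// -[c](subrK a) addrC dfM//.
  rewrite ger0_norm ?subr_ge0// (le_trans _ sb)// ger0_norm//.
  by rewrite lerBlDr addrC.
have as_ : a + s <= a by rewrite gerDl ltW.
have [c] := MVT_segment as_ (fun x _ => dfE x) (continuous_subspaceT cf).
rewrite in_itv /= => /andP[ac cs]; rewrite distrC => ->.
rewrite opprD addNKr normrM normrN.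
rewrite ler_wpM2r// -[c](subrK a) addrC dfM//.
rewrite ler0_norm ?subr_le0// (le_trans _ sb)// ltr0_norm//.
by rewrite lerN2 lerBrDr addrC.
Qed.

End MeanValue.

Section MidpointRule.
Variable R : realType.
Local Notation mu := (@lebesgue_measure R).
Variable g : R -> R.
Hypotheses (cg : continuous g) (ig : rintegrable mu g).

Definition primitive (y : R) : R := (\int[mu]_(t in `]-oo, y]) g t).

Lemma is_derive_primitive (y : R) : is_derive y 1 primitive (g y).
Proof.
have [|||d e] := @continuous_FTC1 R g -oo%O y (y + 1) _ _ _ (@cg y).
- by rewrite ltrDl.
- exact: (integrableS measurableT _ _ ig).
- by rewrite ltNyr.
- by apply: DeriveDef; [exact: d|rewrite -derive1E e].
Qed.

(** As a function of the half-width, the error vanishes at 0 and its derivative is the symmetric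
    second difference of [g], at most [c * h ^ 2]; the mean value inequality supplies the third
    factor [h]. *)
Lemma midpoint_cell (c h x : R) : 0 <= h -> 0 <= c ->
  (forall s, `|s| <= h -> `|g (x + s) + g (x - s) - 2 * g x| <= c * s ^+ 2) ->
  `|primitive (x + h) - primitive (x - h) - 2 * h * g x| <= c * h ^+ 3.
Proof.
move=> h0 c0 H.
pose k s := primitive (x + 1 * s) - primitive (x + (- 1) * s) - (0 + 2 * g x * s).
pose dk s := g (x + s) + g (x - s) - 2 * g x.
have dkE (s : R) : is_derive s 1 k (dk s).
  have d1 := is_derive_comp_affine (is_derive_primitive (x + 1 * s)).
  have d2 := is_derive_comp_affine (is_derive_primitive (x + (- 1) * s)).
  have d3 := is_derive_comp_affine (is_derive_id (0 + 2 * g x * s) (1 : R)).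
  have := is_deriveB (is_deriveB d1 d2) d3.
  rewrite [X in is_derive _ _ _ X](_ : _ = dk s); first exact.
  by rewrite /dk !mul1r mulN1r; ring.
have dkM s : `|s| <= h -> `|dk (0 + s)| <= c * h ^+ 2.
  move=> sh; rewrite add0r /dk; apply: (le_trans (H s sh)).
  by rewrite ler_wpM2l// -real_normK ?num_real// ler_pXn2r// nnegrE.
have hh : `|h| <= h by rewrite ger0_norm.
have := mean_value_norm dkE h0 dkM hh; rewrite (ger0_norm h0).
have -> : k (0 + h) - k 0 = primitive (x + h) - primitive (x - h) - 2 * h * g x.
  by rewrite /k !add0r !mulr0 !addr0 subrr !subr0 mul1r mulN1r; ring.
by rewrite [h ^+ 3]exprSr mulrA.
Qed.

Lemma primitive_cvg (a : nat -> R) : (forall n, 0 <= a n) ->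
  (forall M, \forall n \near \oo, M <= a n) ->
  primitive (a n) - primitive (- a n) @[n --> \oo] --> Rintegral mu setT g.
Proof.
move=> a0 ay.
pose gn n := g \_ `]- a n, a n].
have E n : primitive (a n) - primitive (- a n) = Rintegral mu setT (gn n).
  have an0 := a0 n.
  rewrite /primitive Rintegral_itvB.
  - by rewrite Rintegral_mkcond.
  - exact: (integrableS measurableT _ _ ig).
  - by [].
  - by rewrite bnd_simp; lra.
rewrite (_ : (fun n => _) = (fun n => Rintegral mu setT (gn n))); last exact/funext.
apply: (@rintegral_cvg _ _ _ mu gn g (fun x => `|g x|) _ _ _ _).2.
- move=> n; apply/(measurable_restrictT _ _).1 => //.
  by apply: measurable_funTS; exact: continuous_measurable_fun.
- by move=> n x; rewrite /gn patchE; case: ifP; rewrite ?normr0.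
- exact: (integrable_norm ig).
- move=> x; apply: cvg_near_cst; near=> n.
  rewrite /gn patchE mem_set//= in_itv/=.
  have : `|x| + 1 <= a n by near: n; exact: ay.
  have := ler_norm x; have := ler_norm (- x); rewrite normrN => ? ? ?.
  by apply/andP; split; lra.
Unshelve. all: by end_near. Qed.

(** With [h = 1 / (2 * r)] each cell contributes at most [r * h ^ 3 * W], and the lattice sum of [W]
    is at most [K * r], so the total error is at most [K / (8 * r)]. *)
Lemma midpoint_rule (W : R -> R) (K r l : R) : 1 <= r ->
  (forall y, 0 <= W y) ->
  (forall y s, `|s| <= 1 -> `|g (y + s) + g (y - s) - 2 * g y| <= W y * s ^+ 2) ->
  (forall N, symsum (fun x => W (x%:~R / r)) N <= K * r) ->
  symsum (fun x => g (x%:~R / r)) N @[N --> \oo] --> l ->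
  `|l - r * Rintegral mu setT g| <= K / r.
Proof.
move=> r1 W0 gW WK gl; have r0 : 0 < r by rewrite (lt_le_trans _ r1).
pose h := 1 / (2 * r).
have h0 : 0 <= h by rewrite divr_ge0// mulr_ge0// ltW.
have h1 : h <= 1 by rewrite /h ler_pdivrMr; lra.
have K0 : 0 <= K.
  rewrite -(pmulr_lge0 _ r0); apply: le_trans (WK 0%N).
  by rewrite symsum0.
pose b n := n%:R *+ 2 * h + h.
have cellx (x : int) : x%:~R *+ 2 * h = x%:~R / r.
  by rewrite /h; field; rewrite gt_eqF.
have bnd N : `|symsum (fun x => g (x%:~R / r)) N -
    r * (primitive (b N) - primitive (- b N))| <= K / r.
  rewrite /b -symsum_telescope -symsumZ -symsumB.
  apply: (le_trans (norm_symsum_le _ _)).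
  apply: (@le_trans _ _ (symsum (fun x => r * h ^+ 3 * W (x%:~R / r)) N)).
    apply: symsum_le => x; rewrite cellx; set y := x%:~R / r.
    have := @midpoint_cell (W y) h y h0 (W0 y) (fun s sh => gW y s (le_trans sh h1)).
    set D := primitive _ - primitive _; move=> H.
    have -> : g y - r * D = - r * (D - 2 * h * g y).
      by rewrite /h; field; rewrite gt_eqF.
    by rewrite normrM normrN (gtr0_norm r0) -(mulrA r) ler_pM2l// [leRHS]mulrC.
  rewrite symsumZ; apply: (@le_trans _ _ (r * h ^+ 3 * (K * r))).
    by rewrite ler_wpM2l ?WK// mulr_ge0 ?exprn_ge0// ltW.
  rewrite (_ : r * h ^+ 3 * (K * r) = (K / r) * 8^-1).
    by rewrite ler_piMr ?divr_ge0 ?(ltW r0)//; lra.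
  by rewrite /h; field; rewrite gt_eqF.
have pc : (primitive (b n) - primitive (- b n)) @[n --> \oo] -->
    Rintegral mu setT g.
  apply: primitive_cvg => [n|M].
    by rewrite addr_ge0// mulr_ge0// mulrn_wge0.
  near=> n; rewrite /b (@le_trans _ _ (n%:R *+ 2 * h)) ?lerDl//.
  rewrite -[n%:R]/((Posz n)%:~R) cellx ler_pdivlMr//.
  by near: n; exact: nbhs_infty_ger.
have lim : `|symsum (fun x => g (x%:~R / r)) N -
    r * (primitive (b N) - primitive (- b N))| @[N --> \oo] -->
    `|l - r * Rintegral mu setT g|.
  by apply: cvg_norm; apply: cvgB => //; apply: cvgM; [exact: cvg_cst|exact: pc].
apply: (cvgr_to_le lim).
by apply: nearW => N; exact: bnd.
Unshelve. all: by end_near. Qed.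

End MidpointRule.

(** * The characteristic function near the origin *)

Section ScaledLimits.
Variable R : realType.
Variables (h : R -> R) (l M : R).
Hypotheses (hl : h t / `|t| @[t --> 0^'] --> l) (hM : forall t, `|h t| <= M).

(** Near 0 the limit gives the slope [|l| + 1]; at distance at least [d] boundedness gives the slope
    [M / d]. *)
Lemma linear_bound_of_limit : exists2 C : R, 0 < C &
  forall t, t != 0 -> `|h t| <= C * `|t|.
Proof.
have M0 : 0 <= M by apply: le_trans (hM 0).
have /cvgrPdist_lt /(_ 1 ltr01) := hl.
rewrite near_withinE => /nbhs_ballP[d /= d0 H].
exists (`|l| + 1 + M / d); first by rewrite ltr_pwDl ?divr_ge0// ?(ltW d0)// ltr_wpDl.
move=> t t0; have at0 : 0 < `|t| by rewrite normr_gt0.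
have [td|dt] := ltP `|t| d.
  have /H/(_ t0) : ball 0 d t by rewrite /ball /= sub0r normrN.
  move=> H1; rewrite -ler_pdivrMr//.
  rewrite (@le_trans _ _ (`|l| + 1))// ?lerDl ?divr_ge0// ?(ltW d0)//.
  rewrite -[X in _ / X]normr_id -normf_div.
  rewrite -[_ / _](subrK l) addrC (le_trans (ler_normD _ _))// lerD2l.
  by rewrite distrC ltW.
apply: (le_trans (hM t)); rewrite mulrDl ler_wpDl ?mulr_ge0 ?addr_ge0//.
by rewrite mulrAC ler_pdivlMr// ler_wpM2l.
Qed.

Lemma scaled_limit (s : R) : s != 0 -> r * h (s / r) @[r --> +oo] --> l * `|s|.
Proof.
move=> s0; have as0 : 0 < `|s| by rewrite normr_gt0.
suff H : h (s / r) / `|s / r| @[r --> +oo] --> l.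
  apply: (@cvg_trans _ (h (s / r) / `|s / r| * `|s| @[r --> +oo])); last first.
    by apply: cvgM => //; exact: cvg_cst.
  apply: near_eq_cvg; near=> r.
  have r0 : 0 < r by near: r; exact: nbhs_pinfty_gt.
  rewrite normf_div (gtr0_norm r0); field.
  by rewrite !gt_eqF//.
apply: (@cvg_comp _ _ _ (fun r => s / r) (fun t => h t / `|t|) _ 0^' _ _ hl).
move=> A [d /= d0 H]; rewrite nbhs_filterE /=.
near=> r.
have r0 : 0 < r by near: r; exact: nbhs_pinfty_gt.
apply: H => /=; last by rewrite mulf_neq0// invr_neq0// gt_eqF.
rewrite sub0r normrN normf_div (gtr0_norm r0) ltr_pdivrMr// -ltr_pdivrMl//.
by near: r; apply: nbhs_pinfty_gt; rewrite num_real.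
Unshelve. all: by end_near. Qed.

End ScaledLimits.

(** * Trigonometric inequalities and the truncated square *)

Section TrigBounds.
Variable R : realType.
Implicit Types u v : R.

Lemma norm_sin_le u : `|sin u| <= `|u|.
Proof.
have := @mean_value_norm R sin cos 0 `|u| 1 (fun x => is_derive_sin x)
  (normr_ge0 u) (fun s _ => cos_max _) u (lexx _).
by rewrite add0r sin0 subr0 mul1r.
Qed.

Lemma cos_sin_half u : 1 - cos u = 2 * sin (u / 2) ^+ 2.
Proof.
have -> : cos u = cos (u / 2 + u / 2) by rewrite -splitr.
by rewrite cosD -!expr2 cos2sin2; ring.
Qed.

Lemma onemcos_ge0 u : 0 <= 1 - cos u.
Proof. by rewrite subr_ge0 cos_le1. Qed.

Lemma onemcos_le u : 1 - cos u <= u ^+ 2 / 2.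
Proof.
rewrite cos_sin_half.
have : sin (u / 2) ^+ 2 <= (u / 2) ^+ 2.
  by rewrite -[leLHS]real_normK ?num_real// -[leRHS]real_normK ?num_real//
    lerXn2r ?nnegrE// norm_sin_le.
by lra.
Qed.

Lemma sub_sin_le u : `|u| <= 1 -> `|u - sin u| <= u ^+ 2.
Proof.
move=> u1.
have d (x : R) : is_derive x 1 (fun x : R => x - sin x) (1 - cos x).
  by apply: is_deriveB; exact: is_derive_id.
have := @mean_value_norm R (fun x => x - sin x) (fun x => 1 - cos x) 0 `|u|
  (`|u|) d (normr_ge0 u) _ u (lexx _).
rewrite add0r sin0 !subr0 -expr2 real_normK ?num_real//; apply.
move=> s su; rewrite add0r ger0_norm ?onemcos_ge0//.
apply: (le_trans (onemcos_le _)).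
rewrite -real_normK ?num_real//.
have := normr_ge0 s; nra.
Qed.

Lemma sin_sqr_lower u : `|u| <= 1 -> cos 1 ^+ 2 * u ^+ 2 <= sin u ^+ 2.
Proof.
have key v : 0 <= v -> v <= 1 -> cos 1 * v <= sin v.
  move=> v0 v1.
  have [c] := MVT_segment v0 (fun x _ => is_derive_sin x)
    (continuous_subspaceT (@continuous_sin R)).
  rewrite in_itv/= => /andP[c0 cv]; rewrite sin0 !subr0 => ->.
  rewrite ler_wpM2r//.
  have := @ltr_cos R c 1; rewrite !in_itv/= c0 ler01 /=.
  have p2 : (2 : R) <= pi by exact: pi_ge2.
  have [->//|c1 /(_ _ _) H] := eqVneq c 1.
  by apply/ltW; rewrite H ?lt_neqAle ?c1 ?(le_trans cv)//; lra.
move=> u1; have H := key _ (normr_ge0 u) u1.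
have E : sin `|u| ^+ 2 = sin u ^+ 2.
  have [u0|u0] := leP 0 u; first by rewrite ger0_norm.
  by rewrite ltr0_norm// sinN sqrrN.
have c0 : 0 <= cos (1 : R) * `|u|.
  by rewrite mulr_ge0//; exact/ltW/cos1_gt0.
rewrite -E -[u ^+ 2]real_normK ?num_real// -exprMn.
by rewrite lerXn2r// nnegrE// (le_trans c0).
Qed.

Lemma onemcos_lower : exists2 k : R, 0 < k &
  forall u, `|u| <= 1 -> k * u ^+ 2 <= 1 - cos u.
Proof.
exists (cos 1 ^+ 2 / 2); first by rewrite divr_gt0// exprn_gt0// cos1_gt0.
move=> u u1; rewrite cos_sin_half.
have := @sin_sqr_lower (u / 2); rewrite normf_div (@ger0_norm _ 2)// => /(_ _) H.
have {}H := H (_ : `|u| / 2 <= 1).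
have : cos 1 ^+ 2 * (u / 2) ^+ 2 <= sin (u / 2) ^+ 2 by apply: H; lra.
by lra.
Qed.

End TrigBounds.

Section Truncation.
Variable R : realType.
Implicit Types u : R.

(** The function against which Lévy measures are required to be integrable. *)
Definition trunc2 u : R := Num.min 1 (u ^+ 2).

Lemma trunc2_ge0 u : 0 <= trunc2 u.
Proof. by rewrite le_min ler01 sqr_ge0. Qed.

Lemma trunc2_le1 u : trunc2 u <= 1.
Proof. by rewrite ge_min lexx. Qed.

Lemma trunc2_le_sqr u : trunc2 u <= u ^+ 2.
Proof. by rewrite ge_min lexx orbT. Qed.

Lemma trunc2_small u : `|u| <= 1 -> trunc2 u = u ^+ 2.
Proof.
by move=> u1; rewrite /trunc2 min_r// -real_normK ?num_real// expr_le1.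
Qed.

Lemma trunc2_large u : 1 <= `|u| -> trunc2 u = 1.
Proof.
by move=> u1; rewrite /trunc2 min_l// -real_normK ?num_real// expr_ge1.
Qed.

Lemma continuous_trunc2 : continuous trunc2.
Proof.
move=> u; apply: (@continuous_min _ _ (cst 1) (fun u => u ^+ 2)).
  exact: cvg_cst.
exact: exprn_continuous.
Qed.

Lemma sin2_le_trunc2 u : sin u ^+ 2 <= trunc2 u.
Proof.
rewrite le_min -real_normK ?num_real//; apply/andP; split.
  by rewrite expr_le1// sin_max.
by rewrite -[u ^+ 2]real_normK ?num_real// lerXn2r ?nnegrE// norm_sin_le.
Qed.

(* With [u := X / r], the means of the summands on the right decay geometrically
   in [j] by the hypothesis on the characteristic function. *)
Lemma trunc2_dyadic : exists2 K : R, 0 < K & forall (n : nat) (u : R),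
  `|u| <= 2 ^+ n -> trunc2 u <= K * \sum_(j < n.+1) (1 - cos (u / 2 ^+ j)).
Proof.
have [k k0 H] := onemcos_lower R.
exists (4 / k); first by rewrite divr_gt0.
have kk : 0 <= 4 / k by apply: ltW; exact: divr_gt0.
move=> n u un.
have [u1|u1] := leP `|u| 1.
  rewrite trunc2_small// big_ord_recl expr0 divr1.
  rewrite mulrAC ler_pdivlMr// mulrDr.
  have := H u u1; have : 0 <= \sum_(i < n) (1 - cos (u / 2 ^+ lift ord0 i)).
    by apply: sumr_ge0 => i _; exact: onemcos_ge0.
  have := sqr_ge0 u; nra.
rewrite (le_trans (trunc2_le1 u))//.
elim: n un => [|n IH un]; first by rewrite expr0 leNgt u1.
rewrite big_ord_recr mulrDr.
have [un'|un'] := leP `|u| (2 ^+ n).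
  by apply: (le_trans (IH un')); rewrite lerDl mulr_ge0// onemcos_ge0.
apply: ler_wpDl.
  by apply: mulr_ge0 => //; apply: sumr_ge0 => i _; exact: onemcos_ge0.
have p0 : 0 < 2 ^+ n.+1 :> R by rewrite exprn_gt0.
have /H : `|u / 2 ^+ n.+1| <= 1.
  by rewrite normf_div (gtr0_norm p0) ler_pdivrMr// mul1r.
rewrite mulrAC ler_pdivlMr//= mul1r.
have : 2^-1 <= `|u / 2 ^+ n.+1|.
  rewrite normf_div (gtr0_norm p0) ler_pdivlMr// exprS.
  by rewrite mulrA mulVf ?mul1r ?ltW.
rewrite -[(u / _) ^+ 2]real_normK ?num_real//; set a := `|_| => a2.
have : k * (1 / 4) <= k * a ^+ 2 by rewrite ler_pM2l//; nra.
by lra.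
Qed.

End Truncation.

Section CauchyDomain.
Context {d : measure_display} {T : measurableType d} {R : realType}.
Variables (P : probability T R) (X : T -> R) (c : R).
Hypothesis mX : measurable_fun setT X.
Hypothesis cre : (1 - charfun_re P X t) / `|t| @[t --> 0^'] --> c.
Hypothesis cim : charfun_im P X t / `|t| @[t --> 0^'] --> 0.

Lemma measurable_comp_continuous (g : R -> R) (Y : T -> R) : continuous g ->
  measurable_fun setT Y -> measurable_fun setT (fun w => g (Y w)).
Proof.
by move=> cg mY; apply: measurableT_comp => //; exact: continuous_measurable_fun.
Qed.

Lemma measurable_scaled (Y : T -> R) (k : R) : measurable_fun setT Y ->
  measurable_fun setT (fun w => k * Y w).
Proof. by move=> mY; apply: measurable_funM. Qed.

Let mcos (k : R) : rintegrable P (fun w => cos (k * X w)).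
Proof.
apply: (@rintegrable_bounded _ _ _ _ _ 1) => [|w]; last exact: cos_max.
exact/(measurable_comp_continuous (@continuous_cos R))/measurable_scaled.
Qed.

Let msin (k : R) : rintegrable P (fun w => sin (k * X w)).
Proof.
apply: (@rintegrable_bounded _ _ _ _ _ 1) => [|w]; last exact: sin_max.
exact/(measurable_comp_continuous (@continuous_sin R))/measurable_scaled.
Qed.

Let h t := 1 - charfun_re P X t.

Let twopi_gt0 : 0 < 2 * pi :> R. Proof. by rewrite mulr_gt0// pi_gt0. Qed.

Let twopiK (k : R) : 2 * pi * (k / (2 * pi)) = k.
Proof. by rewrite mulrC divfK// gt_eqF. Qed.

Let cosE (k : R) :
  Rintegral P setT (fun w => 1 - cos (k * X w)) = h (k / (2 * pi)).
Proof.
rewrite RintegralB//; last 2 first.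
- exact: rintegrable_cst.
- exact: mcos.
rewrite rintegral_cst /h /charfun_re; congr (_ - _).
by apply: eq_Rintegral => w _; rewrite twopiK.
Qed.

Let sinE (k : R) : Rintegral P setT (fun w => sin (k * X w)) =
  charfun_im P X (k / (2 * pi)).
Proof.
by apply: eq_Rintegral => w _; rewrite twopiK.
Qed.

Let h2 t : `|h t| <= 2.
Proof.
rewrite (le_trans (ler_normB _ _))// normr1 -[2]/(1 + 1) lerD2l.
apply: rintegral_bounded => [|w]; last exact: cos_max.
exact: (rintegrable_measurable (mcos _)).
Qed.

Let im1 t : `|charfun_im P X t| <= 1.
Proof.
apply: rintegral_bounded => [|w]; last exact: sin_max.
exact: (rintegrable_measurable (msin _)).
Qed.

(** The limit is the integral of [1 - cos (t * u)] against the Cauchy Lévy density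
    [c / (2 * pi ^ 2 * u ^ 2)]; that measure itself is never introduced. *)
Lemma scaled_cos_cvg (t : R) :
  r * Rintegral P setT (fun w => 1 - cos (t * (X w / r))) @[r --> +oo] -->
  c * `|t| / (2 * pi).
Proof.
have [->|t0] := eqVneq t 0.
  rewrite normr0 mulr0 mul0r; apply: cvg_near_cst; apply: nearW => r.
  under eq_Rintegral do rewrite mul0r cos0 subrr.
  by rewrite rintegral_cst mulr0.
have -> : c * `|t| / (2 * pi) = c * `|t / (2 * pi)|.
  by rewrite normf_div (gtr0_norm twopi_gt0) mulrA.
have t1 : t / (2 * pi) != 0 by rewrite mulf_neq0// invr_neq0// gt_eqF.
rewrite [X in X @ _ --> _](_ : _ = fun r => r * h (t / (2 * pi) / r)).
  exact: scaled_limit.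
apply/funext => r; congr (_ * _).
rewrite mulrAC -cosE; apply: eq_Rintegral => w _.
by rewrite mulrAC mulrA.
Qed.

Lemma scaled_sin_cvg (t : R) :
  r * Rintegral P setT (fun w => sin (t * (X w / r))) @[r --> +oo] --> 0.
Proof.
have [->|t0] := eqVneq t 0.
  apply: cvg_near_cst; apply: nearW => r.
  under eq_Rintegral do rewrite mul0r sin0.
  by rewrite rintegral_cst mulr0.
have t1 : t / (2 * pi) != 0 by rewrite mulf_neq0// invr_neq0// gt_eqF.
have := scaled_limit cim t1; rewrite mul0r.
rewrite [X in _ -> X @ _ --> _](_ : _ =
  fun r => r * charfun_im P X (t / (2 * pi) / r)) //.
apply/funext => r; congr (_ * _).
rewrite mulrAC -sinE; apply: eq_Rintegral => w _.
by rewrite mulrAC mulrA.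
Qed.

Lemma scaled_sin_bound : exists2 C : R, 0 < C & forall r, 0 < r ->
  `|Rintegral P setT (fun w => sin (X w / r))| <= C / r.
Proof.
have [C C0 H] := linear_bound_of_limit cim im1.
exists (C / (2 * pi)); first exact: divr_gt0.
move=> r r0; have r1 : r^-1 / (2 * pi) != 0.
  by rewrite mulf_neq0 ?invr_neq0 ?gt_eqF.
have := H _ r1; rewrite -sinE normf_div (gtr0_norm twopi_gt0).
rewrite [`|r^-1|]gtr0_norm ?invr_gt0// => H1.
under eq_Rintegral do rewrite mulrC.
by rewrite mulrAC -mulrA.
Qed.

(** On the event [|X / r| <= 2 ^ n] finitely many dyadic scales suffice. The mean at scale
    [r * 2 ^ j] is at most [C / (r * 2 ^ j)], so the sum stays below [2 * C / r] for every [n], and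
    dominated convergence removes the event. All [r > 0] are covered because the bound is later used
    at the scales [r * dl] and [r * L]. *)
Lemma scaled_trunc2_bound : exists2 C : R, 0 < C & forall r, 0 < r ->
  Rintegral P setT (fun w => trunc2 (X w / r)) <= C / r.
Proof.
have [C C0 H] := linear_bound_of_limit cre h2.
have [K K0 HK] := trunc2_dyadic R.
exists (K * (C * 2)); first by rewrite !mulr_gt0.
move=> r r0.
have mXr : measurable_fun setT (fun w => X w / r).
  by apply: measurable_funM.
have mm : measurable_fun setT (fun w => trunc2 (X w / r)).
  exact: measurable_comp_continuous (@continuous_trunc2 R) mXr.
pose A n : set T := [set w | `|X w / r| <= 2 ^+ n].
have mA n : measurable (A n).
  apply: measurable_ler_set => //.
  by apply: measurable_comp_continuous mXr; exact: norm_continuous.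
have mind n : measurable_fun setT (fun w => trunc2 (X w / r) * \1_(A n) w).
  by apply: measurable_funM => //; exact: measurable_indic.
have Em : 0 <= h (r^-1 / (2 * pi)) by rewrite -cosE; apply: Rintegral_ge0 => w _; exact: onemcos_ge0.
have cosb (j : nat) : Rintegral P setT (fun w => 1 - cos (X w / r / 2 ^+ j)) <=
    C / r * (2^-1) ^+ j.
  have p0 : 0 < 2 ^+ j :> R by rewrite exprn_gt0.
  have t1 : (r * 2 ^+ j)^-1 / (2 * pi) != 0.
    by rewrite gt_eqF// divr_gt0// invr_gt0 mulr_gt0.
  have := H _ t1; rewrite -/(h _) -cosE => /(le_trans (ler_norm _)).
  under eq_Rintegral do rewrite mulrC invfM mulrA.
  move=> /le_trans; apply; rewrite -mulrA ler_pM2l//.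
  rewrite normf_div (gtr0_norm twopi_gt0) gtr0_norm ?invr_gt0 ?mulr_gt0//.
  rewrite invfM exprVn ler_pdivrMr// ler_peMr ?mulr_ge0 ?invr_ge0 ?(ltW r0) ?(ltW p0)//.
  by have := @pi_ge2 R; lra.
have icos (j : nat) : rintegrable P (fun w => 1 - cos (X w / r / 2 ^+ j)).
  apply: rintegrableB; first exact: rintegrable_cst.
  rewrite (_ : (fun _ => _) = (fun w => cos (((r * 2 ^+ j)^-1) * X w))); first exact: mcos.
  by apply/funext => w; rewrite invfM -mulrA [RHS in cos RHS]mulrC; congr cos; ring.
have bnd n : Rintegral P setT (fun w => trunc2 (X w / r) * \1_(A n) w) <= K * (C * 2) / r.
  apply: (@le_trans _ _ (K * \sum_(j < n.+1)
      Rintegral P setT (fun w => 1 - cos (X w / r / 2 ^+ j)))).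
    rewrite -rintegral_sum// -RintegralZl//; last exact: rintegrable_sum.
    apply: rintegral_le.
    - apply: (@rintegrable_bounded _ _ _ _ _ 1) => // w.
      rewrite normrM (ger0_norm (trunc2_ge0 _)) mulr_ile1 ?trunc2_ge0 ?trunc2_le1//.
      by rewrite indicE; case: (_ \in _); rewrite ?normr1 ?normr0.
    - by apply: rintegrableZ; exact: rintegrable_sum.
    - move=> w; rewrite indicE; case: (boolP (_ \in _)) => [|_].
        by rewrite inE mulr1 => Aw; exact: HK.
      rewrite mulr0 mulr_ge0 ?(ltW K0)// sumr_ge0// => i _; exact: onemcos_ge0.
  rewrite -(mulrA K) ler_pM2l//.
  apply: (@le_trans _ _ (\sum_(j < n.+1) C / r * (2^-1) ^+ j)).
    by apply: ler_sum => j _; exact: cosb.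
  rewrite -mulr_sumr [leRHS]mulrAC ler_pM2l ?divr_gt0//.
  have : forall m, \sum_(j < m) (2^-1 : R) ^+ j = 2 - 2 * 2^-1 ^+ m.
    elim=> [|m IH]; first by rewrite big_ord0 expr0 mulr1 subrr.
    by rewrite big_ord_recr /= IH exprS; field.
  by move=> ->; rewrite gerBl mulr_ge0// exprn_ge0// invr_ge0.
have [] := @rintegral_cvg _ _ _ P (fun n w => trunc2 (X w / r) * \1_(A n) w)
  (fun w => trunc2 (X w / r)) (cst 1) mind.
- move=> n w.
  rewrite normrM (ger0_norm (trunc2_ge0 _)) mulr_ile1 ?trunc2_ge0 ?trunc2_le1//.
  by rewrite indicE; case: (_ \in _); rewrite ?normr1 ?normr0.
- exact: rintegrable_cst.
- move=> w; apply: cvg_near_cst; near=> n.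
  rewrite indicE mem_set ?mulr1// /A /=.
  have xn : `|X w / r| <= n%:R by near: n; exact: nbhs_infty_ger.
  apply: (le_trans xn); rewrite -natrX ler_nat; exact/ltnW/ltn_expl.
- move=> _ lim; apply: (cvgr_to_le lim); apply: nearW => n; exact: bnd.
Unshelve. all: by end_near. Qed.

End CauchyDomain.

(** * Trigonometric approximation *)

Section UniformContinuity.
Variable R : realType.

(** Only [x] is confined to the segment; [y] may leave it. This is what the comparison with points
    outside [[-1, 1]] in Bernstein's argument requires. *)
Lemma segment_uniform_continuity (h : R -> R) (a b e : R) : continuous h ->
  0 < e -> exists2 d : R, 0 < d &
    forall x y, a <= x <= b -> `|x - y| < d -> `|h x - h y| < e.
Proof.
move=> ch e0.
have /compact_near_coveringP := @segment_compact R a b.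
move=> /(_ R 0^'+ (fun d x => forall y, `|x - y| < d -> `|h x - h y| < e)).
have cov (x : R) : `[a, b]%classic x -> \forall x' \near x & d \near 0^'+,
    forall y, `|x' - y| < d -> `|h x' - h y| < e.
  move=> _; have /cvgrPdist_lt /(_ (e / 2)) := ch x.
  rewrite divr_gt0// => /(_ isT) /nbhs_ballP[d /= d0 H].
  exists (ball x (d / 2), [set t | 0 < t < d / 2]).
    split => /=; first by apply: nbhsx_ballx; rewrite divr_gt0.
    near=> t; rewrite /=; apply/andP; split; near: t; first exact: nbhs_right_gt.
    by apply: nbhs_right_lt; rewrite divr_gt0.
  move=> [x' t] /= [xx' /andP[t0 td]] y x'y.
  move: xx'; rewrite /ball /= => xx'.
  have h1 : `|h x - h x'| < e / 2 by apply: H; rewrite /ball /= (lt_trans xx')//; lra.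
  have h2 : `|h x - h y| < e / 2.
    apply: H; rewrite /ball /= -(subrKA x') (le_lt_trans (ler_normD _ _))//.
    by rewrite (splitr d) ltrD// (lt_trans x'y).
  rewrite -(subrKA (h x)) (le_lt_trans (ler_normD _ _))//.
  by rewrite (splitr e) ltrD// distrC.
move=> /(_ _ cov) => H.
have : \forall d \near 0^'+, (0 < d /\ `[a, b]%classic `<=`
    (fun x : R => forall y : R, `|x - y| < d -> `|h x - h y| < e)).
  by near=> d; split; near: d; [exact: nbhs_right_gt|exact: H].
move=> /(@filter_ex _ _ _) [d [d0 Hd]]; exists d => // x y xab.
by apply: Hd; rewrite /= in_itv.
Unshelve. all: by end_near. Qed.

End UniformContinuity.

Section Bernstein.
Variable R : realType.
Implicit Types (phi : nat -> R) (x a : R).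

(* Expectation of [phi] under the binomial law with parameters [n] and [x]. *)
Fixpoint binomial_mean (n : nat) phi x : R :=
  if n is m.+1 then
    x * binomial_mean m (fun k => phi k.+1) x + (1 - x) * binomial_mean m phi x
  else phi 0%N.

Lemma binomial_mean_le n phi psi x : 0 <= x <= 1 -> (forall k, phi k <= psi k) ->
  binomial_mean n phi x <= binomial_mean n psi x.
Proof.
move=> /andP[x0 x1]; elim: n phi psi => [|n IH] phi psi H /=; first exact: H.
by rewrite lerD// ler_wpM2l ?subr_ge0// IH.
Qed.

Lemma binomial_meanD n phi psi x : binomial_mean n (fun k => phi k + psi k) x =
  binomial_mean n phi x + binomial_mean n psi x.
Proof. by elim: n phi psi => [|n IH] phi psi //=; rewrite !IH; ring. Qed.

Lemma binomial_meanZ n phi x a :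
  binomial_mean n (fun k => a * phi k) x = a * binomial_mean n phi x.
Proof. by elim: n phi => [|n IH] phi //=; rewrite !IH; ring. Qed.

Lemma binomial_mean_cst n x a : binomial_mean n (fun=> a) x = a.
Proof. by elim: n => [|n IH] //=; rewrite !IH; ring. Qed.

Lemma binomial_mean_sqr n x a :
  binomial_mean n (fun k => (k%:R - a) ^+ 2) x =
  n%:R * x * (1 - x) + (n%:R * x - a) ^+ 2.
Proof.
elim: n a => [|n IH] a /=; first by ring.
rewrite (_ : (fun k => (k.+1%:R - a) ^+ 2) = (fun k => (k%:R - (a - 1)) ^+ 2)).
  by rewrite !IH -natr1; ring.
by apply/funext => k; rewrite -natr1; congr (_ ^+ 2); ring.
Qed.

(** The Bernstein polynomial carried to [[-1, 1]] by [x = (1 + t) / 2]; it follows the recursion of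
    [binomial_mean], so evaluation is an immediate induction. *)
Fixpoint bernstein_poly (n : nat) phi : {poly R} :=
  if n is m.+1 then
    (2^-1 *: (1 + 'X)) * bernstein_poly m (fun k => phi k.+1) +
    (1 - 2^-1 *: (1 + 'X)) * bernstein_poly m phi
  else (phi 0%N)%:P.

Lemma horner_bernstein_poly n phi (t : R) :
  (bernstein_poly n phi).[t] = binomial_mean n phi ((1 + t) / 2).
Proof.
elim: n phi => [|n IH] phi /=; first by rewrite hornerC.
by rewrite !hornerE !IH; ring.
Qed.

(** Bernstein's proof with Chebyshev's inequality built in: uniform continuity and boundedness give
    [|h s - h t| <= e / 2 + c * (s - t) ^ 2], and the binomial mean of the square is a variance of
    order [1 / n]. *)
Theorem weierstrass_approximation (h : R -> R) (M e : R) : continuous h ->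
  (forall t, `|h t| <= M) -> 0 < e ->
  exists p : {poly R}, forall t, -1 <= t <= 1 -> `|p.[t] - h t| <= e.
Proof.
move=> ch hM e0.
have e20 : 0 < e / 2 by rewrite divr_gt0.
have [d d0 Hd] := @segment_uniform_continuity R h (-1) 1 (e / 2) ch e20.
have M0 : 0 <= M by apply: le_trans (hM 0).
pose c := 2 * M / d ^+ 2.
have c0 : 0 <= c.
  by apply: divr_ge0; [exact: mulr_ge0|exact: (exprn_ge0 _ (ltW d0))].
have quad s t : -1 <= t <= 1 -> `|h s - h t| <= e / 2 + c * (s - t) ^+ 2.
  move=> t1; have [std|dst] := ltP `|s - t| d.
    rewrite distrC in std; rewrite distrC.
    by rewrite (le_trans (ltW (Hd _ _ t1 std)))// lerDl mulr_ge0// sqr_ge0.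
  rewrite (le_trans (ler_normB _ _))// (@le_trans _ _ (2 * M))//.
    by have := hM s; have := hM t; lra.
  apply: ler_wpDl; first exact: ltW.
  rewrite /c mulrAC ler_pdivlMr ?exprn_gt0// ler_wpM2l ?mulr_ge0//.
  by rewrite -[leRHS]real_normK ?num_real// lerXn2r ?nnegrE// ltW.
pose n := (Num.truncn (2 * c / e)).+1.
have n0 : 0 < n%:R :> R by rewrite ltr0n.
have nc : c / n%:R <= e / 2.
  have := truncnS_gt (2 * c / e); rewrite -/n ltr_pdivrMr// => H.
  by rewrite ler_pdivrMr//; lra.
pose phi k := h (2 * (k%:R / n%:R) - 1).
exists (bernstein_poly n phi) => t t1.
rewrite horner_bernstein_poly; set x := (1 + t) / 2.
have x01 : 0 <= x <= 1 by rewrite /x; apply/andP; split; lra.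
(* Since [t = 2 * x - 1], the sample point differs from [t] by [2 * (k - n * x) / n], whence the
   factor [4 / n ^ 2]. *)
have bndk k : `|phi k - h t| <= e / 2 + 4 * c / n%:R ^+ 2 * (k%:R - n%:R * x) ^+ 2.
  apply: (le_trans (quad _ _ t1)); rewrite lerD2l le_eqVlt; apply/orP; left; apply/eqP.
  by rewrite /x; field; rewrite gt_eqF.
have E : binomial_mean n (fun k => e / 2 + 4 * c / n%:R ^+ 2 * (k%:R - n%:R * x) ^+ 2) x
    <= e.
  rewrite binomial_meanD binomial_mean_cst binomial_meanZ binomial_mean_sqr.
  rewrite subrr expr0n addr0.
  have -> : 4 * c / n%:R ^+ 2 * (n%:R * x * (1 - x)) = c / n%:R * (4 * (x * (1 - x))).
    by field; rewrite gt_eqF.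
  have : c / n%:R * (4 * (x * (1 - x))) <= c / n%:R * 1.
    apply: ler_wpM2l; first by rewrite divr_ge0.
    by have := sqr_ge0 (2 * x - 1); lra.
  by rewrite mulr1 => H; rewrite [leRHS](splitr e) lerD2l (le_trans H).
have Edist : binomial_mean n (fun k => phi k - h t) x = binomial_mean n phi x - h t.
  by rewrite binomial_meanD binomial_mean_cst.
rewrite -Edist ler_norml; apply/andP; split.
  rewrite -[leRHS]opprK lerN2 -mulN1r -binomial_meanZ (le_trans _ E)//.
  apply: binomial_mean_le => // k; rewrite mulN1r.
  by apply: le_trans (bndk k); rewrite -normrN ler_norm.
apply: le_trans E; apply: binomial_mean_le => // k.
by apply: le_trans (bndk k); rewrite ler_norm.
Qed.

End Bernstein.

Section TrigonometricClass.
Variables (R : realType) (C : (R -> R) -> Prop).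
Hypothesis CD : forall f g, C f -> C g -> C (fun x => f x + g x).
Hypothesis CZ : forall k f, C f -> C (fun x => k * f x).
Hypothesis Csin : forall t, C (fun x => sin (t * x)).
Hypothesis Ccos : forall s t, C (fun x => cos (s * x) - cos (t * x)).

(** Nonzero constants must stay out of [C], because [r * E 1] diverges. Cosines thus occur only in
    differences, and the product-to-sum formulas preserve this form: multiplying by a sine exchanges
    sines and differences of cosines. *)
Lemma sin_pow_class a k :
  (forall s t, C (fun x => sin (a * x) ^+ k * (cos (s * x) - cos (t * x)))) /\
  (forall t, C (fun x => sin (a * x) ^+ k * sin (t * x))).
Proof.
elim: k => [|k [IHc IHs]].
  split=> [s t|t].
    by rewrite (_ : (fun x => _) = (fun x => cos (s * x) - cos (t * x)))//;
      apply/funext => x; rewrite expr0 mul1r.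
  by rewrite (_ : (fun x => _) = (fun x => sin (t * x)))//;
    apply/funext => x; rewrite expr0 mul1r.
split=> [s t|t].
  rewrite (_ : (fun x => _) = (fun x =>
    (2^-1 * (sin (a * x) ^+ k * sin ((a + s) * x)) +
     2^-1 * (sin (a * x) ^+ k * sin ((a - s) * x))) +
    ((- 2^-1) * (sin (a * x) ^+ k * sin ((a + t) * x)) +
     (- 2^-1) * (sin (a * x) ^+ k * sin ((a - t) * x))))).
    by do ![apply: CD|apply: CZ].
  by apply/funext => x; rewrite exprSr !mulrDl !mulNr !sinD !sinN !cosN; field.
rewrite (_ : (fun x => _) = (fun x =>
    2^-1 * (sin (a * x) ^+ k * (cos ((a - t) * x) - cos ((a + t) * x))))).
  exact: CZ.
by apply/funext => x; rewrite exprSr !mulrDl !mulNr !cosD !sinN !cosN; field.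
Qed.

Lemma poly_sin_class (p : {poly R}) a : p.[0] = 0 -> C (fun x => p.[sin (a * x)]).
Proof.
move=> p0.
have C0 : C (fun=> 0).
  rewrite (_ : (fun=> 0) = (fun x => 0 * sin (0 * x))); first exact: CZ.
  by apply/funext => x; rewrite mul0r.
rewrite (_ : (fun x => _) = (fun x => \sum_(i < size p) p`_i * sin (a * x) ^+ i)).
  elim: (size p) => [|n IH].
    by rewrite (_ : (fun x => _) = (fun=> 0))//; apply/funext => x; rewrite big_ord0.
  rewrite (_ : (fun x => _) = (fun x => \sum_(i < n) p`_i * sin (a * x) ^+ i +
    p`_n * sin (a * x) ^+ n)); last by apply/funext => x; rewrite big_ord_recr.
  apply: CD => //; case: n {IH} => [|n].
    rewrite (_ : (fun x => _) = (fun=> 0))//; apply/funext => x.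
    by rewrite -horner_coef0 p0 mul0r.
  apply: CZ; rewrite (_ : (fun x => _) = (fun x => sin (a * x) ^+ n * sin (a * x))).
    exact: (sin_pow_class a n).2.
  by apply/funext => x; rewrite exprSr.
by apply/funext => x; rewrite horner_coef.
Qed.

End TrigonometricClass.

Section ClampedArcsin.
Variable R : realType.

(** Clamping between [- sin 1] and [sin 1] keeps the argument inside []-1, 1[], where [asin] is
    continuous, without disturbing [asin (sin x) = x] for [|x| <= 1]. *)
Definition clamp_asin (v : R) : R := asin (Num.max (- sin 1) (Num.min (sin 1) v)).

Lemma sin1_gt0 : 0 < sin 1 :> R.
Proof. by apply: sin2_gt0; lra. Qed.

Lemma sin1_lt1 : sin 1 < 1 :> R.
Proof.
rewrite lt_neqAle sin_le1 andbT; apply/eqP => s1.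
have := cos2Dsin2 (1 : R); rewrite s1.
by have := @cos1_gt0 R; nra.
Qed.

Lemma continuous_clamp_asin : continuous clamp_asin.
Proof.
move=> v; rewrite /clamp_asin; have s0 := sin1_gt0; have s1 := sin1_lt1.
apply: (@continuous_comp _ _ _ (fun v => Num.max (- sin 1) (Num.min (sin 1) v)) asin).
  apply: (@continuous_max _ _ (cst (- sin 1)) (fun v => Num.min (sin 1) v)).
    exact: cvg_cst.
  apply: (@continuous_min _ _ (cst (sin 1)) id); first exact: cvg_cst.
  exact: cvg_id.
apply: continuous_asin; rewrite lt_max gt_max !gt_min.
by rewrite s1 /= ltrN2 s1 /= andbT; lra.
Qed.

Lemma clamp_asinK (x : R) : `|x| <= 1 -> clamp_asin (sin x) = x.
Proof.
move=> x1; have p2 := @pi_ge2 R.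
have mono (a b : R) : - 1 <= a -> a <= b -> b <= 1 -> sin a <= sin b.
  move=> a1; rewrite le_eqVlt => /predU1P[->//|ab] b1; apply: ltW.
  by rewrite ltr_sin// in_itv/=; apply/andP; split; lra.
move: x1; rewrite ler_norml => /andP[xl xu].
rewrite /clamp_asin min_r ?mono// max_r; last by rewrite -sinN mono.
by rewrite sinK// in_itv/=; apply/andP; split; lra.
Qed.

End ClampedArcsin.

Section CauchyApproximation.
Context {R : realType} {I : Type} {F : set_system I} {FF : ProperFilter F}.

(** Completeness of the reals, used so that no candidate for the limit has to be named. *)
Lemma cvg_of_approx (f : I -> R) :
  (forall e : R, 0 < e -> exists2 v : I -> R,
     (exists l : R, v i @[i --> F] --> l) & \forall i \near F, `|f i - v i| <= e) ->
  exists l : R, f i @[i --> F] --> l.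
Proof.
move=> H; suff : cvg (f i @[i --> F]) by move=> cf; exists (lim (f i @[i --> F])).
apply/cauchy_cvgP/cauchy_exP => e e0.
have e20 : 0 < e / 2 by rewrite divr_gt0.
have [v [l vl] fv] := H _ e20.
exists l; rewrite nbhs_filterE /=.
have /cvgrPdist_lt /(_ _ e20) vl2 := vl.
near=> i; rewrite /ball /= -(subrKA (v i)) (le_lt_trans (ler_normD _ _))//.
rewrite (splitr e) ltr_leD//; first by near: i.
by rewrite distrC; near: i.
Unshelve. all: by end_near. Qed.

End CauchyApproximation.

Section ScaledExpectation.
Context {d : measure_display} {T : measurableType d} {R : realType}.
Variables (P : probability T R) (X : T -> R) (c : R).
Hypothesis mX : measurable_fun setT X.
Hypothesis cre : (1 - charfun_re P X t) / `|t| @[t --> 0^'] --> c.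
Hypothesis cim : charfun_im P X t / `|t| @[t --> 0^'] --> 0.

Definition scaled_mean (g : R -> R) (r : R) : R :=
  r * Rintegral P setT (fun w => g (X w / r)).

Definition bounded_continuous (g : R -> R) : Prop :=
  continuous g /\ exists M : R, forall u, `|g u| <= M.

Lemma rintegrable_scaled g r : bounded_continuous g ->
  rintegrable P (fun w => g (X w / r)).
Proof.
move=> [cg [M gM]]; apply: (@rintegrable_bounded _ _ _ _ _ M) => //.
by apply: measurable_comp_continuous => //; exact: measurable_funM.
Qed.

Lemma scaled_meanD f g r : bounded_continuous f -> bounded_continuous g ->
  scaled_mean (fun u => f u + g u) r = scaled_mean f r + scaled_mean g r.
Proof.
move=> bf bg; rewrite /scaled_mean RintegralD ?mulrDr//; exact: rintegrable_scaled.
Qed.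

Lemma scaled_meanZ k g r : bounded_continuous g ->
  scaled_mean (fun u => k * g u) r = k * scaled_mean g r.
Proof.
move=> bg; have ig := rintegrable_scaled r bg.
by rewrite /scaled_mean (RintegralZl k measurableT ig) mulrCA.
Qed.

Definition has_scaled_limit (g : R -> R) : Prop := bounded_continuous g /\
  exists l : R, scaled_mean g r @[r --> +oo] --> l.

Lemma has_scaled_limitD f g : has_scaled_limit f -> has_scaled_limit g ->
  has_scaled_limit (fun u => f u + g u).
Proof.
move=> [bf [l fl]] [bg [m gm]]; split.
  split; first by move=> x; apply: cvgD; [exact: bf.1|exact: bg.1].
  have [_ [M fM]] := bf; have [_ [N gN]] := bg.
  by exists (M + N) => u; rewrite (le_trans (ler_normD _ _))// lerD.
exists (l + m); rewrite [X in X @ _ --> _](_ : _ =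
  fun r => scaled_mean f r + scaled_mean g r); first exact: cvgD.
by apply/funext => r; exact: scaled_meanD.
Qed.

Lemma has_scaled_limitZ k g : has_scaled_limit g ->
  has_scaled_limit (fun u => k * g u).
Proof.
move=> [bg [l gl]]; split.
  split; first by move=> x; apply: cvgM; [exact: cvg_cst|exact: bg.1].
  have [_ [M gM]] := bg.
  by exists (`|k| * M) => u; rewrite normrM ler_wpM2l.
exists (k * l); rewrite [X in X @ _ --> _](_ : _ = fun r => k * scaled_mean g r).
  by apply: cvgM => //; exact: cvg_cst.
by apply/funext => r; exact: scaled_meanZ.
Qed.

Let continuous_scale (t : R) : continuous (fun u : R => t * u).
Proof. by move=> u; apply: cvgM; [exact: cvg_cst|exact: cvg_id]. Qed.

Lemma has_scaled_limit_sin t : has_scaled_limit (fun u => sin (t * u)).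
Proof.
split; last by exists 0; exact: scaled_sin_cvg.
split; last by exists 1 => u; exact: sin_max.
by move=> u; apply: continuous_comp; [exact: continuous_scale|exact: continuous_sin].
Qed.

Lemma has_scaled_limit_onemcos t : has_scaled_limit (fun u => 1 - cos (t * u)).
Proof.
split; last by exists (c * `|t| / (2 * pi)); exact: (scaled_cos_cvg mX cre).
split; last first.
  exists 2 => u; rewrite (le_trans (ler_normB _ _))// normr1.
  by rewrite -[2]/(1 + 1) lerD2l cos_max.
move=> u; apply: cvgB; first exact: cvg_cst.
by apply: continuous_comp; [exact: continuous_scale|exact: continuous_cos].
Qed.

Lemma has_scaled_limit_cos s t :
  has_scaled_limit (fun u => cos (s * u) - cos (t * u)).
Proof.
rewrite (_ : (fun u => _) =
    fun u => (1 - cos (t * u)) + (-1) * (1 - cos (s * u))).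
  apply: has_scaled_limitD; last apply: has_scaled_limitZ;
    exact: has_scaled_limit_onemcos.
by apply/funext => u; ring.
Qed.

(* The test function is approximated by a trigonometric polynomial vanishing to
   second order at the origin; the error is controlled by [trunc2] at a small
   scale [dl] (near the origin) and at a large scale [L] (at infinity). *)
Lemma trunc2_trig_approx (G : R -> R) (K dl L : R) : continuous G ->
  (forall u, `|G u| <= K * trunc2 u) -> 0 < dl -> 0 < L ->
  exists p : {poly R}, forall u,
    `|G u - (p * 'X ^+ 2).[sin (L^-1 * u)]| <=
    K * dl ^+ 2 * trunc2 (u / dl) + (2 * K + 1) * trunc2 (u / L).
Proof.
move=> cG GK d0 L0.
have K0 : 0 <= K.
  have := le_trans (normr_ge0 _) (GK 1).
  by rewrite trunc2_large ?normr1// mulr1.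
have GK1 u : `|G u| <= K by rewrite (le_trans (GK u))// ler_piMr// trunc2_le1.
pose k : R := cos 1 ^+ 2.
have k0 : 0 < k by rewrite exprn_gt0// cos1_gt0.
(* [tau] is the lower bound [k * (u / L) ^ 2] for [sin (u / L) ^ 2] taken at [|u| = dl]. It
   regularizes the quotient of [G] by the squared sine at the origin, at a cost confined to scale
   [dl]. *)
pose tau := k * dl ^+ 2 / L ^+ 2.
have tau0 : 0 < tau.
  by apply: divr_gt0; [apply: mulr_gt0 => //|]; exact: exprn_gt0.
have den v : 0 < v ^+ 2 + tau by rewrite ltr_wpDl// sqr_ge0.
pose h (v : R) := G (L * clamp_asin v) / (v ^+ 2 + tau).
have ch : continuous h.
  move=> v; apply: cvgM.
    apply: (@continuous_comp _ _ _ (fun v => L * clamp_asin v) G); last exact: cG.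
    by apply: cvgM; [exact: cvg_cst|exact: continuous_clamp_asin].
  apply: cvgV; first by rewrite gt_eqF.
  by apply: cvgD; [exact: exprn_continuous|exact: cvg_cst].
have hM v : `|h v| <= K / tau.
  rewrite normf_div (gtr0_norm (den v)) ler_pM ?invr_ge0 ?(ltW (den v))//.
  by rewrite lef_pV2 ?posrE// lerDr sqr_ge0.
have [p Hp] := weierstrass_approximation ch hM ltr01.
exists p => u; rewrite hornerM hornerXn.
set s := sin _.
have s2 : s ^+ 2 <= trunc2 (u / L) by rewrite /s mulrC sin2_le_trunc2.
have s20 : 0 <= s ^+ 2 by exact: sqr_ge0.
have {}Hp : `|p.[s] - h s| <= 1 by apply: Hp; rewrite sin_geN1 sin_le1.
have p2 : `|(p.[s] - h s) * s ^+ 2| <= s ^+ 2.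
  by rewrite normrM (ger0_norm s20) ler_piMl.
have t1 : 0 <= K * dl ^+ 2 * trunc2 (u / dl).
  by rewrite mulr_ge0 ?trunc2_ge0// mulr_ge0// sqr_ge0.
have [uL|uL] := leP `|u| L.
  have uL1 : `|L^-1 * u| <= 1.
    by rewrite normrM normfV (gtr0_norm L0) mulrC ler_pdivrMr// mul1r.
  have hE : h s = G u / (s ^+ 2 + tau).
    by rewrite /h /s clamp_asinK// mulrA mulfV ?gt_eqF// mul1r.
  have E : G u - p.[s] * s ^+ 2 =
      G u * (tau / (s ^+ 2 + tau)) - (p.[s] - h s) * s ^+ 2.
    by rewrite hE; field; rewrite gt_eqF.
  rewrite E (le_trans (ler_normB _ _))// lerD//.
    rewrite normrM (ger0_norm (_ : 0 <= tau / _)); last by rewrite divr_ge0// ltW.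
    have sl : k * (u / L) ^+ 2 <= s ^+ 2.
      by rewrite (mulrC u) sin_sqr_lower.
    rewrite mulrA ler_pdivrMr//.
    have [ud|ud] := leP `|u / dl| 1.
      rewrite trunc2_small//.
      have -> : K * dl ^+ 2 * (u / dl) ^+ 2 = K * u ^+ 2.
        by field; rewrite gt_eqF.
      apply: ler_pM => //; first exact: ltW.
        by rewrite (le_trans (GK u))// ler_wpM2l// trunc2_le_sqr.
      by rewrite lerDr.
    rewrite (trunc2_large (ltW ud)) mulr1.
    apply: (@le_trans _ _ (K * trunc2 u * tau)).
      by rewrite ler_wpM2r ?(ltW tau0).
    have : trunc2 u * tau <= dl ^+ 2 * (s ^+ 2 + tau).
      have : trunc2 u * tau <= u ^+ 2 * tau.
        by rewrite ler_wpM2r ?(ltW tau0)// trunc2_le_sqr.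
      have -> : u ^+ 2 * tau = dl ^+ 2 * (k * (u / L) ^+ 2).
        by rewrite /tau; field; rewrite gt_eqF.
      move=> /le_trans; apply; rewrite ler_wpM2l ?sqr_ge0//.
      by rewrite (le_trans sl)// lerDl ltW.
    by move=> H; rewrite -2!(mulrA K) ler_wpM2l.
  rewrite (le_trans p2)// (le_trans s2)// ler_peMl ?trunc2_ge0//.
  by rewrite lerDr mulr_ge0.
apply: ler_wpDl => //; rewrite trunc2_large ?mulr1; last first.
  by rewrite normf_div (gtr0_norm L0) ler_pdivlMr// mul1r ltW.
have E : G u - p.[s] * s ^+ 2 = G u - h s * s ^+ 2 - (p.[s] - h s) * s ^+ 2.
  by ring.
have hs : `|h s * s ^+ 2| <= K.
  rewrite normrM normf_div (gtr0_norm (den s)) (ger0_norm s20) mulrAC.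
  rewrite ler_pdivrMr// ler_pM// lerDl ltW//.
have s21 : s ^+ 2 <= 1 by rewrite (le_trans s2)// trunc2_le1.
rewrite E (le_trans (ler_normB _ _))// lerD//; last exact: le_trans p2 s21.
rewrite (le_trans (ler_normB _ _))//.
by have := GK1 u; lra.
Qed.

Lemma trunc2_dominated_limit (G : R -> R) (K : R) : continuous G ->
  (forall u, `|G u| <= K * trunc2 u) ->
  exists l : R, scaled_mean G r @[r --> +oo] --> l.
Proof.
move=> cG GK.
have K0 : 0 <= K.
  have := le_trans (normr_ge0 _) (GK 1).
  by rewrite trunc2_large ?normr1// mulr1.
have bG : bounded_continuous G.
  split => //; exists K => u.
  by rewrite (le_trans (GK u))// ler_piMr// trunc2_le1.
have [C C0 HC] := scaled_trunc2_bound mX cre.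
apply: cvg_of_approx => e e0.
(* The two error terms have scaled means at most [K * C * dl] and [(2 * K + 1) * C / L]; these
   choices make each at most [e / 2]. *)
pose dl := e / (2 * (K * C + 1)).
pose L := 2 * ((2 * K + 1) * C) / e.
have KC : 0 <= K * C by rewrite mulr_ge0// ltW.
have KC1 : 0 < K * C + 1 by rewrite ltr_wpDl.
have d0 : 0 < dl by rewrite divr_gt0// mulr_gt0.
have K1 : 0 < 2 * K + 1 by rewrite ltr_wpDl// mulr_ge0.
have L0 : 0 < L by rewrite divr_gt0// !mulr_gt0.
have [p Hp] := trunc2_trig_approx cG GK d0 L0.
have lq : has_scaled_limit (fun u => (p * 'X ^+ 2).[sin (L^-1 * u)]).
  apply: poly_sin_class.
  - exact: has_scaled_limitD.
  - exact: has_scaled_limitZ.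
  - exact: has_scaled_limit_sin.
  - exact: has_scaled_limit_cos.
  - by rewrite hornerM hornerXn expr0n mulr0.
exists (scaled_mean (fun u => (p * 'X ^+ 2).[sin (L^-1 * u)])); first exact: lq.2.
near=> r; have r0 : 0 < r by near: r; exact: nbhs_pinfty_gt.
have mtr (a : R) : rintegrable P (fun w => trunc2 (X w / r / a)).
  apply: (@rintegrable_bounded _ _ _ _ _ 1) => [|w].
    apply: (measurable_comp_continuous (@continuous_trunc2 R)).
    by do 2 apply: measurable_funM => //.
  by rewrite ger0_norm ?trunc2_ge0// trunc2_le1.
rewrite /scaled_mean -mulrBr -RintegralB//; last 2 first.
- exact: rintegrable_scaled.
- exact: rintegrable_scaled lq.1.
rewrite normrM (gtr0_norm r0) -ler_pdivlMl//.
apply: (@le_trans _ _ (Rintegral P setT (fun w =>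
  K * dl ^+ 2 * trunc2 (X w / r / dl) + (2 * K + 1) * trunc2 (X w / r / L)))).
  apply: rintegral_norm_le => [|w|].
  - by apply: rintegrable_measurable; apply: rintegrableB;
      [exact: rintegrable_scaled|exact: rintegrable_scaled lq.1].
  - exact: Hp.
  - by apply: rintegrableD; exact: rintegrableZ.
rewrite RintegralD//; last 2 first.
- exact: rintegrableZ.
- exact: rintegrableZ.
rewrite (RintegralZl _ measurableT (mtr dl)) (RintegralZl _ measurableT (mtr L)).
have b1 : Rintegral P setT (fun w => trunc2 (X w / r / dl)) <= C / (r * dl).
  under eq_Rintegral do rewrite -mulrA -invfM.
  by apply: HC; exact: mulr_gt0.
have b2 : Rintegral P setT (fun w => trunc2 (X w / r / L)) <= C / (r * L).
  under eq_Rintegral do rewrite -mulrA -invfM.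
  by apply: HC; exact: mulr_gt0.
have E1 : K * dl ^+ 2 * (C / (r * dl)) = r^-1 * (K * C * dl).
  by field; rewrite !gt_eqF.
have E2 : (2 * K + 1) * (C / (r * L)) = r^-1 * (e / 2).
  by rewrite /L; field; rewrite !gt_eqF.
rewrite (splitr e) mulrDr -E2 lerD// ?ler_pM2l//.
apply: (@le_trans _ _ (K * dl ^+ 2 * (C / (r * dl)))).
  by rewrite ler_wpM2l// mulr_ge0// sqr_ge0.
rewrite E1 E2 ler_pM2l ?invr_gt0//.
have -> : e / 2 = (K * C + 1) * dl by rewrite /dl; field; rewrite gt_eqF.
apply: ler_wpM2r; first exact: (ltW d0).
by rewrite lerDl.
Unshelve. all: by end_near. Qed.

End ScaledExpectation.

(** * Increments of Schwartz functions *)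

Ltac nonneg := repeat first
  [ exact: sqr_ge0 | exact: expR_ge0 | exact: pi_ge0 | exact: normr_ge0
  | exact: ler0n | exact: ler01 | exact: wt_ge0 | exact: trunc2_ge0
  | assumption | apply: exprn_ge0 | apply: mulr_ge0 | apply: addr_ge0
  | rewrite invr_ge0 | by apply: ltW ].

Section ExponentialBounds.
Variable R : realType.
Implicit Types a b x M : R.

Lemma norm_expR_sub1_le x : `|expR x - 1| <= `|x| * expR `|x|.
Proof.
have := @mean_value_norm R expR expR 0 `|x| (expR `|x|)
  (fun y => is_derive_expR y) (normr_ge0 x) _ x (lexx _).
rewrite add0r expR0 mulrC; apply => s sx.
by rewrite add0r ger0_norm ?expR_ge0// ler_expR (le_trans (ler_norm s)).
Qed.

Lemma norm_expR_taylor1_le x : `|expR x - 1 - x| <= x ^+ 2 * expR `|x|.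
Proof.
have d (y : R) : is_derive y 1 (fun y : R => expR y - y) (expR y - 1).
  by apply: is_deriveB; exact: is_derive_id.
have := @mean_value_norm R _ _ 0 `|x| (`|x| * expR `|x|) d (normr_ge0 x) _ x (lexx _).
rewrite add0r expR0 subr0 mulrAC -expr2 real_normK ?num_real// addrAC; apply.
move=> s sx; rewrite add0r (le_trans (norm_expR_sub1_le s))//.
by rewrite ler_pM ?expR_ge0// ler_expR.
Qed.

Lemma norm_expRB_le a b M : `|a| <= M -> `|b| <= M ->
  `|expR a - expR b| <= `|a - b| * expR (3 * M).
Proof.
move=> aM bM.
have -> : expR a - expR b = expR b * (expR (a - b) - 1).
  by rewrite mulrBr -expRD mulr1 (addrC b) subrK.
rewrite normrM (ger0_norm (expR_ge0 b)).
apply: (@le_trans _ _ (expR M * (`|a - b| * expR (2 * M)))).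
  rewrite ler_pM ?expR_ge0// ?ler_expR ?(le_trans (ler_norm b))//.
  rewrite (le_trans (norm_expR_sub1_le _))// ler_wpM2l// ler_expR.
  by rewrite (le_trans (ler_normB _ _))//; lra.
by rewrite mulrCA -expRD (_ : M + 2 * M = 3 * M)//; ring.
Qed.

End ExponentialBounds.

Section SmoothDecay.
Variable R : realType.
Local Notation mu := (@lebesgue_measure R).

(* The only consequences of rapid decay that the argument uses. *)
Definition smooth_decay (f df : R -> R) (C : R) : Prop :=
  [/\ continuous f, forall y, `|f y| <= C * wt y, forall y, `|df y| <= C * wt y &
    forall y s, `|s| <= 1 -> `|f (y + s) - f y - df y * s| <= C * s ^+ 2 * wt y].

Lemma schwartz_derive_decay (f : R -> R) n : schwartz f ->
  exists2 C : R, 0 <= C & forall y, `|derive1n n f y| <= C * wt y.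
Proof.
move=> [_ sf]; have [M0 H0] := sf 0%N n; have [M2 H2] := sf 2%N n.
exists (M0 + M2).
  rewrite addr_ge0//; first by apply: le_trans (H0 0); rewrite expr0 mul1r.
  by apply: le_trans (H2 0); rewrite normr0 expr0n mul0r.
move=> y; rewrite ler_pdivlMr ?ltr_pwDl ?sqr_ge0// mulrDr mulr1 lerD//.
  by have := H0 y; rewrite expr0 mul1r.
by have := H2 y; rewrite real_normK ?num_real// mulrC.
Qed.

Lemma schwartz_smooth_decay (f : R -> R) : schwartz f ->
  exists df C, smooth_decay f df C.
Proof.
move=> sf; have [df _] := sf.
have [C0 C00 H0] := schwartz_derive_decay 0 sf.
have [C1 C10 H1] := schwartz_derive_decay 1 sf.
have [C2 C20 H2] := schwartz_derive_decay 2 sf.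
have d0 (x : R) : is_derive x 1 f (derive1n 1 f x).
  by apply: DeriveDef; [exact: (df 0%N x)|rewrite /= derive1E].
have d1 (x : R) : is_derive x 1 (derive1n 1 f) (derive1n 2 f x).
  by apply: DeriveDef; [exact: (df 1%N x)|rewrite /= derive1E].
(* The factor 3 is that of [wt_shift]: it carries the bound on the second derivative from a nearby
   point back to [y]. *)
exists (derive1n 1 f), (C0 + C1 + 3 * C2).
have wk (a b : R) y : a <= b -> a * wt y <= b * wt y.
  by move=> ab; rewrite ler_wpM2r// wt_ge0.
split.
- exact: is_derive_continuous d0.
- by move=> y; rewrite (le_trans (H0 y))// wk//; lra.
- by move=> y; rewrite (le_trans (H1 y))// wk//; lra.
move=> y s s1.
have m1 t : `|t| <= `|s| ->
    `|derive1n 1 f (y + t) - derive1n 1 f y| <= 3 * C2 * wt y * `|s|.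
  move=> ts; apply: le_trans (_ : 3 * C2 * wt y * `|t| <= _); last first.
    by rewrite ler_wpM2l// !mulr_ge0// wt_ge0.
  apply: (mean_value_norm d1 (normr_ge0 s)) => // t' ts'.
  rewrite (le_trans (H2 _))// -mulrA mulrCA ler_wpM2l//.
  by rewrite wt_shift// (le_trans ts').
have d2 (x : R) : is_derive x 1 (fun x => f x - (0 + derive1n 1 f y * x))
    (derive1n 1 f x - 1 * derive1n 1 f y).
  apply: is_deriveB.
  exact: (is_derive_comp_affine (is_derive_id (0 + derive1n 1 f y * x) (1 : R))).
have := mean_value_norm d2 (normr_ge0 s) _ (lexx `|s|).
move=> /(_ y (3 * C2 * wt y * `|s|)); rewrite !add0r mul1r => /(_ m1) H.
have -> : f (y + s) - f y - derive1n 1 f y * s =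
  f (y + s) - derive1n 1 f y * (y + s) - (f y - derive1n 1 f y * y) by ring.
apply: (le_trans H); rewrite -mulrA -expr2 real_normK ?num_real//.
rewrite mulrAC wk// ler_wpM2r ?sqr_ge0//; lra.
Qed.

End SmoothDecay.

Section Increments.
Variable R : realType.
Local Notation mu := (@lebesgue_measure R).
Variables (f df : R -> R) (C : R).
Hypothesis fC : smooth_decay f df C.
Implicit Types (y u s th : R).

(** An increment by [u] lives near [y] and near [y + u], so decay is measured at both points; the
    integral and the lattice sums of this weight are bounded uniformly in [u]. *)
Definition wt2 u y : R := wt y + wt (y + u).

Lemma wt2_ge0 u y : 0 <= wt2 u y.
Proof. by rewrite addr_ge0// wt_ge0. Qed.

Lemma wt2_le2 u y : wt2 u y <= 2.
Proof. by have := wt_le1 y; have := wt_le1 (y + u); rewrite /wt2; lra. Qed.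

Lemma wt_le_wt2 u y : wt y <= wt2 u y.
Proof. by rewrite lerDl wt_ge0. Qed.

Lemma symsum_wt2 u r N : 1 <= r ->
  symsum (fun x => wt2 u (x%:~R / r)) N <= 6 * pi * r.
Proof.
move=> r1; rewrite symsumD.
have := @symsum_wt R r 0 N r1; have := @symsum_wt R r (u * r) N r1.
have -> : (fun x : int => wt ((x%:~R + u * r) / r)) = (fun x => wt (x%:~R / r + u)).
  by apply/funext => x; rewrite mulrDl mulfK// gt_eqF// (lt_le_trans _ r1).
have -> : (fun x : int => wt ((x%:~R + 0) / r)) = (fun x => wt (x%:~R / r)).
  by apply/funext => x; rewrite addr0.
by lra.
Qed.

Lemma rintegrable_wt2 u : rintegrable mu (wt2 u).
Proof.
apply: rintegrableD; first exact: rintegrable_wt.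
exact: (rintegral_shift u (@continuous_wt R) (rintegrable_wt R)).1.
Qed.

Definition wt_mass : R := Rintegral mu setT (@wt R).

Lemma rintegral_wt2 u : Rintegral mu setT (wt2 u) = 2 * wt_mass.
Proof.
have [i e] := rintegral_shift u (@continuous_wt R) (rintegrable_wt R).
rewrite RintegralD//; last exact: rintegrable_wt.
by rewrite e /wt_mass; ring.
Qed.

Lemma wt_mass_ge0 : 0 <= wt_mass.
Proof. by apply: Rintegral_ge0 => y _; exact: wt_ge0. Qed.

Let C0 : 0 <= C.
Proof.
have [_ H _ _] := fC; have := le_trans (normr_ge0 _) (H 0).
by rewrite pmulr_lge0// wt_gt0.
Qed.

Let cf : continuous f. Proof. by case: fC. Qed.

Let fw y : `|f y| <= C * wt y. Proof. by case: fC. Qed.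

Let dfw y : `|df y| <= C * wt y. Proof. by case: fC. Qed.

Let ftaylor y s : `|s| <= 1 -> `|f (y + s) - f y - df y * s| <= C * s ^+ 2 * wt y.
Proof. by case: fC => _ _ _; apply. Qed.

Let fle y : `|f y| <= C.
Proof. by rewrite (le_trans (fw y))// ler_piMr// wt_le1. Qed.

Lemma second_difference_le y s : `|s| <= 1 ->
  `|f (y + s) + f (y - s) - 2 * f y| <= 2 * C * wt y * s ^+ 2.
Proof.
move=> s1; have H1 := ftaylor y s1.
have := @ftaylor y (- s); rewrite normrN sqrrN => /(_ s1) H2.
have -> : f (y + s) + f (y - s) - 2 * f y =
  (f (y + s) - f y - df y * s) + (f (y - s) - f y - df y * - s) by ring.
by rewrite (le_trans (ler_normD _ _))//; lra.
Qed.

Lemma first_difference_le y s : `|s| <= 1 ->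
  `|f (y + s) - f y| <= 2 * C * wt y * `|s|.
Proof.
move=> s1; have H1 := ftaylor y s1.
rewrite -[f _ - _](subrK (df y * s)) (le_trans (ler_normD _ _))//.
have H2 : `|df y * s| <= C * wt y * `|s| by rewrite normrM ler_wpM2r.
have : s ^+ 2 <= `|s|.
  by rewrite -real_normK ?num_real// expr2 ler_piMl.
move=> H3; have : C * wt y * s ^+ 2 <= C * wt y * `|s|.
  by rewrite ler_wpM2l// mulr_ge0// wt_ge0.
by lra.
Qed.

Definition increment u y : R := f (y + u) - f y.

Lemma increment_le_wt2 u y : `|increment u y| <= C * wt2 u y.
Proof.
rewrite (le_trans (ler_normB _ _))//.
by have := fw (y + u); have := fw y; rewrite /wt2; lra.
Qed.

Lemma increment_le u y : `|increment u y| <= 2 * C.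
Proof.
by rewrite (le_trans (ler_normB _ _))//; have := fle (y + u); have := fle y; lra.
Qed.

(** The linear term is taken in [sin u] rather than [u], since [X] has no mean while [E sin (X / r)]
    is controlled. For small [u] the exchange costs [u ^ 2]; for large [u] every term is bounded
    separately. *)
Lemma increment_sin u y :
  `|increment u y - df y * sin u| <= 2 * C * trunc2 u * wt2 u y.
Proof.
have w0 := wt_ge0 y.
have [u1|u1] := leP `|u| 1.
  rewrite trunc2_small//.
  have -> : increment u y - df y * sin u =
    (f (y + u) - f y - df y * u) + df y * (u - sin u) by rewrite /increment; ring.
  rewrite (le_trans (ler_normD _ _))//.
  have H1 := ftaylor y u1.
  have H2 : `|df y * (u - sin u)| <= C * wt y * u ^+ 2.
    by rewrite normrM ler_pM// sub_sin_le.
  have : 2 * C * u ^+ 2 * wt y <= 2 * C * u ^+ 2 * wt2 u y.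
    apply: ler_wpM2l; last exact: wt_le_wt2.
    by rewrite mulr_ge0 ?sqr_ge0// mulr_ge0.
  by lra.
rewrite (trunc2_large (ltW u1)) mulr1 (le_trans (ler_normB _ _))//.
have H1 := increment_le_wt2 u y.
have H2 : `|df y * sin u| <= C * wt y.
  by rewrite normrM -[leRHS]mulr1 ler_pM// sin_max.
have : C * wt y <= C * wt2 u y by rewrite ler_wpM2l// wt_le_wt2.
by lra.
Qed.

Lemma increment_sqr u y : increment u y ^+ 2 <= 4 * C ^+ 2 * trunc2 u * wt2 u y.
Proof.
have w0 := wt_ge0 y; rewrite -real_normK ?num_real//.
have [u1|u1] := leP `|u| 1.
  rewrite trunc2_small//; have H := first_difference_le y u1.
  apply: (@le_trans _ _ ((2 * C * wt y * `|u|) ^+ 2)).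
    by rewrite lerXn2r ?nnegrE// !mulr_ge0.
  rewrite !exprMn real_normK ?num_real//.
  have H2 : wt y ^+ 2 <= wt2 u y.
    by rewrite (le_trans _ (wt_le_wt2 u y))// expr2 ler_piMl// wt_le1.
  rewrite [leLHS](_ : _ = 4 * C ^+ 2 * u ^+ 2 * wt y ^+ 2); last by ring.
  by apply: ler_wpM2l => //; rewrite mulr_ge0 ?sqr_ge0// mulr_ge0 ?sqr_ge0.
rewrite (trunc2_large (ltW u1)) mulr1 expr2.
have H1 := increment_le_wt2 u y; have H2 := increment_le u y.
apply: (@le_trans _ _ ((2 * C) * (C * wt2 u y))); first by rewrite ler_pM.
have := wt2_ge0 u y; have := sqr_ge0 C; nra.
Qed.

Section Exponential.
Variable th : R.

Definition expinc u y : R := expR (th * increment u y) - 1.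

Let E : R := expR (2 * C * `|th|).

Let E0 : 0 < E. Proof. exact: expR_gt0. Qed.

Let E1 : 1 <= E.
Proof. by rewrite -expR0 ler_expR !mulr_ge0. Qed.

Let thinc u y : `|th * increment u y| <= 2 * C * `|th|.
Proof. by rewrite normrM mulrC ler_wpM2r// increment_le. Qed.

Lemma expinc_taylor u y : `|expinc u y - th * increment u y| <=
  4 * C ^+ 2 * th ^+ 2 * E * trunc2 u * wt2 u y.
Proof.
rewrite (le_trans (norm_expR_taylor1_le _))//.
apply: (@le_trans _ _ (th ^+ 2 * (4 * C ^+ 2 * trunc2 u * wt2 u y) * E)).
  rewrite exprMn; apply: ler_pM.
  - by rewrite mulr_ge0 ?sqr_ge0.
  - exact: expR_ge0.
  - by rewrite ler_wpM2l ?sqr_ge0// increment_sqr.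
  - by rewrite ler_expR.
by rewrite le_eqVlt; apply/orP; left; apply/eqP; ring.
Qed.

Lemma expinc_sin : exists2 K, 0 <= K & forall u y,
  `|expinc u y - th * df y * sin u| <= K * trunc2 u * wt2 u y.
Proof.
exists (4 * C ^+ 2 * th ^+ 2 * E + `|th| * (2 * C)).
  by nonneg.
move=> u y; have -> : expinc u y - th * df y * sin u =
  (expinc u y - th * increment u y) + th * (increment u y - df y * sin u) by ring.
apply: (le_trans (ler_normD _ _)); rewrite 2!mulrDl; apply: lerD.
  exact: expinc_taylor.
by rewrite normrM -2!(mulrA `|th|) ler_wpM2l// increment_sin.
Qed.

Lemma expinc_le_wt2 : exists2 K, 0 <= K & forall u y, `|expinc u y| <= K * wt2 u y.
Proof.
exists (`|th| * C * E); first by nonneg.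
move=> u y; rewrite (le_trans (norm_expR_sub1_le _))//.
apply: (@le_trans _ _ (`|th| * (C * wt2 u y) * E)).
  rewrite ler_pM ?expR_ge0 ?ler_expR// normrM ler_wpM2l// increment_le_wt2//.
by rewrite le_eqVlt; apply/orP; left; apply/eqP; ring.
Qed.

(** With [k z = th * increment u z], the factor [expR (k y)] comes out and leaves
    [expR p + expR q - 2] for the changes [p] and [q] of [k]. Both are of order [s], so the Taylor
    remainders are quadratic in [s]; the linear part [p + q] is itself a second difference. *)
Lemma expinc_second_difference : exists2 K, 0 <= K & forall u y s, `|s| <= 1 ->
  `|expinc u (y + s) + expinc u (y - s) - 2 * expinc u y| <= K * wt2 u y * s ^+ 2.
Proof.
pose K1 := `|th| * (2 * C); pose K2 := 2 * (4 * C * `|th|) ^+ 2 * (E * E).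
have K10 : 0 <= K1 by rewrite /K1; nonneg.
have K20 : 0 <= K2 by rewrite /K2; nonneg.
exists (E * (K1 + K2)); first by nonneg.
move=> u y s s1.
pose k z := th * increment u z.
pose p := k (y + s) - k y; pose q := k (y - s) - k y.
have -> : expinc u (y + s) + expinc u (y - s) - 2 * expinc u y =
    expR (k y) * (expR p + expR q - 2).
  have e1 : expR (k y) * expR p = expR (k (y + s)).
    by rewrite -expRD /p (addrC (k y)) subrK.
  have e2 : expR (k y) * expR q = expR (k (y - s)).
    by rewrite -expRD /q (addrC (k y)) subrK.
  by rewrite (mulrBr (expR (k y))) (mulrDr (expR (k y))) e1 e2 /expinc -!/(k _); ring.
rewrite normrM (ger0_norm (expR_ge0 _)) -!(mulrA E).
apply: ler_pM; rewrite ?expR_ge0//.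
  by rewrite ler_expR (le_trans (ler_norm _) (thinc _ _)).
have w0 := wt2_ge0 u y.
have kdiff t : `|t| <= 1 -> `|k (y + t) - k y| <= `|th| * (2 * C) * wt2 u y * `|t|.
  move=> t1; rewrite -mulrBr normrM -!(mulrA `|th|) ler_wpM2l//.
  have -> : increment u (y + t) - increment u y =
    (f (y + u + t) - f (y + u)) - (f (y + t) - f y).
    by rewrite /increment (addrAC y t u); ring.
  rewrite (le_trans (ler_normB _ _))//.
  have := first_difference_le y t1; have := first_difference_le (y + u) t1.
  by rewrite /wt2; lra.
have sq t : `|t| <= 1 -> (k (y + t) - k y) ^+ 2 <= (4 * C * `|th|) ^+ 2 * wt2 u y * t ^+ 2.
  move=> t1; rewrite -real_normK ?num_real//.
  apply: (@le_trans _ _ ((`|th| * (2 * C) * wt2 u y * `|t|) ^+ 2)).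
    by rewrite lerXn2r ?nnegrE ?kdiff// !mulr_ge0.
  rewrite !exprMn [`|t| ^+ 2]real_normK ?num_real//.
  rewrite ler_wpM2r ?sqr_ge0//.
  have : wt2 u y ^+ 2 <= 2 * wt2 u y by rewrite expr2 ler_wpM2r// wt2_le2.
  have : 0 <= `|th| ^+ 2 * C ^+ 2 by rewrite mulr_ge0 ?sqr_ge0.
  have := w0; move: (wt2 u y) (`|th| ^+ 2) (C ^+ 2) => a b d a0 bd0 a2.
  have -> : b * (2 ^+ 2 * d) * a ^+ 2 = 4 * ((b * d) * a ^+ 2) by ring.
  have -> : 4 ^+ 2 * d * b * a = 4 * ((b * d) * (4 * a)) by ring.
  by rewrite ler_wpM2l// ler_wpM2l//; lra.
have pb t : `|k (y + t) - k y| <= 2 * C * `|th| + 2 * C * `|th|.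
  by apply: (le_trans (ler_normB _ _)); apply: lerD; exact: thinc.
have ex t : `|t| <= 1 -> `|expR (k (y + t) - k y) - 1 - (k (y + t) - k y)| <=
    (4 * C * `|th|) ^+ 2 * wt2 u y * t ^+ 2 * (E * E).
  move=> t1; rewrite (le_trans (norm_expR_taylor1_le _))//.
  by rewrite ler_pM ?sqr_ge0 ?expR_ge0 ?sq// -expRD ler_expR.
have -> : expR p + expR q - 2 = (expR p - 1 - p) + (expR q - 1 - q) + (p + q) by ring.
have e1 := ex _ s1; have := ex (- s); rewrite normrN sqrrN => /(_ s1) e2.
have pq : `|p + q| <= K1 * wt2 u y * s ^+ 2.
  have -> : p + q = th * ((f (y + u + s) + f (y + u - s) - 2 * f (y + u)) -
      (f (y + s) + f (y - s) - 2 * f y)).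
    by rewrite /p /q /k /increment (addrAC y s u) (addrAC y (- s) u); ring.
  rewrite normrM -!(mulrA `|th|) ler_wpM2l// (le_trans (ler_normB _ _))//.
  have := second_difference_le y s1; have := second_difference_le (y + u) s1.
  by rewrite /wt2; lra.
rewrite (le_trans (ler_normD _ _))// [leRHS](_ : _ =
  K2 * wt2 u y * s ^+ 2 + K1 * wt2 u y * s ^+ 2); last by ring.
rewrite lerD// (le_trans (ler_normD _ _))//.
by rewrite /K2; move: e1 e2; rewrite -/p -/q; lra.
Qed.

Lemma continuous_increment u : continuous (increment u).
Proof.
move=> y; apply: cvgB; last exact: cf.
apply: (@continuous_comp _ _ _ (fun y => y + u) f); last exact: cf.
by apply: cvgD; [exact: cvg_id|exact: cvg_cst].
Qed.

Lemma continuous_expinc u : continuous (expinc u).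
Proof.
move=> y; apply: cvgB; last exact: cvg_cst.
apply: (@continuous_comp _ _ _ (fun y => th * increment u y) expR).
  by apply: cvgM; [exact: cvg_cst|exact: continuous_increment].
exact: continuous_expR.
Qed.

Lemma rintegrable_decay (g : R -> R) : continuous g ->
  (forall y, `|g y| <= C * wt y) -> rintegrable mu g.
Proof.
move=> cg gC; exact: rintegrable_lebesgue_le cg gC (rintegrableZ C (rintegrable_wt R)).
Qed.

Lemma rintegrable_increment u : rintegrable mu (increment u) /\
  Rintegral mu setT (increment u) = 0.
Proof.
have fi := rintegrable_decay cf fw.
have [i e] := rintegral_shift u cf fi.
split; first exact: rintegrableB.
by rewrite RintegralB// e subrr.
Qed.

Lemma rintegrable_expinc u : rintegrable mu (expinc u).
Proof.
have [K K0 H] := expinc_le_wt2.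
apply: rintegrable_lebesgue_le (H u) (rintegrableZ K (rintegrable_wt2 u)).
exact: continuous_expinc.
Qed.

Definition mean_expinc u : R := Rintegral mu setT (expinc u).

(** Translation invariance gives [increment u] integral 0, so the linear term may be subtracted for
    free and only the quadratic Taylor remainder is left. *)
Lemma mean_expinc_trunc2 : exists2 K, 0 <= K & forall u,
  `|mean_expinc u| <= K * trunc2 u.
Proof.
exists (4 * C ^+ 2 * th ^+ 2 * E * (2 * wt_mass)).
  by move: wt_mass_ge0 => ?; nonneg.
move=> u; have [i e] := rintegrable_increment u.
have i2 := rintegrable_expinc u; have i3 := rintegrableZ th i.
have -> : mean_expinc u = Rintegral mu setT (fun y => expinc u y - th * increment u y).
  rewrite RintegralB// (RintegralZl th measurableT i) e mulr0 subr0//.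
have i4 := rintegrableZ (4 * C ^+ 2 * th ^+ 2 * E * trunc2 u) (rintegrable_wt2 u).
apply: (le_trans (rintegral_lebesgue_norm_le (rintegrableB i2 i3) (expinc_taylor u) i4)).
rewrite (RintegralZl _ measurableT (rintegrable_wt2 u)) rintegral_wt2.
by rewrite le_eqVlt; apply/orP; left; apply/eqP; ring.
Qed.

Lemma continuous_mean_expinc : continuous mean_expinc.
Proof.
move=> u; apply/cvgrPdist_lt => e e0.
pose K := `|th| * expR (3 * (2 * C * `|th|)) * (2 * C) * wt_mass.
have K0 : 0 <= K by move: wt_mass_ge0 => ?; rewrite /K; nonneg.
have K1 : 0 < K + 1 by rewrite ltr_wpDl.
have eK : 0 < e / (K + 1) by rewrite divr_gt0.
near=> v.
have uv1 : `|v - u| <= 1.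
  by rewrite distrC ltW//; near: v; apply: nbhsx_ballx.
have uvK : `|v - u| < e / (K + 1).
  by rewrite distrC; near: v; exact: (nbhsx_ballx u _ eK).
suff : `|mean_expinc u - mean_expinc v| <= K * `|v - u|.
  move=> /le_lt_trans; apply; move: uvK; rewrite ltr_pdivlMr// mulrC => H.
  by rewrite (le_lt_trans _ H)// ler_wpM2r// lerDl.
have iu := rintegrable_expinc u; have iv := rintegrable_expinc v.
rewrite /mean_expinc -RintegralB//.
have [iw ew] := rintegral_shift u (@continuous_wt R) (rintegrable_wt R).
have i4 := rintegrableZ (`|th| * expR (3 * (2 * C * `|th|)) * (2 * C) * `|v - u|) iw.
apply: (le_trans (rintegral_lebesgue_norm_le (rintegrableB iu iv) _ i4)).
- move=> y; rewrite /expinc opprB addrA subrK.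
  rewrite (le_trans (norm_expRB_le (thinc u y) (thinc v y)))//.
  rewrite -mulrBr normrM /increment opprB addrA subrK distrC.
  have := @first_difference_le (y + u) _ uv1.
  have -> : y + u + (v - u) = y + v by ring.
  move=> H; rewrite [leRHS](_ : _ = `|th| * (2 * C * wt (y + u) * `|v - u|) *
    expR (3 * (2 * C * `|th|))); last by ring.
  by rewrite ler_wpM2r ?expR_ge0// ler_wpM2l.
- rewrite (RintegralZl _ measurableT iw) ew -/wt_mass.
  by rewrite le_eqVlt; apply/orP; left; apply/eqP; rewrite /K; ring.
Unshelve. all: by end_near. Qed.

(** [K] does not depend on [u], so [u = X w / r] may be substituted before the expectation is
    taken. *)
Lemma symsum_expinc : exists2 K, 0 <= K & forall r u, 1 <= r ->
  (forall N, symsum (fun x => `|expinc u (x%:~R / r)|) N <= K * r) /\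
  `|limn (symsum (fun x => expinc u (x%:~R / r))) - r * mean_expinc u| <= K / r.
Proof.
have [K K0 H] := expinc_le_wt2; have [M M0 HM] := expinc_second_difference.
exists (K * (6 * pi) + M * (6 * pi)).
  by nonneg.
move=> r u r1; have r0 : 0 < r by rewrite (lt_le_trans _ r1).
have p0 : 0 <= M * (6 * pi) by nonneg.
have p1 : 0 <= K * (6 * pi) by nonneg.
have bnd N : symsum (fun x => `|expinc u (x%:~R / r)|) N <= K * (6 * pi) * r.
  apply: (@le_trans _ _ (symsum (fun x => K * wt2 u (x%:~R / r)) N)).
    by apply: symsum_le => x; exact: H.
  by rewrite symsumZ -mulrA ler_wpM2l// symsum_wt2.
split=> [N|]; first by rewrite (le_trans (bnd N))// ler_pM2r// lerDl.
have cv := symsum_cvg bnd.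
have := @midpoint_rule R (expinc u) (@continuous_expinc u) (rintegrable_expinc u)
  (fun y => M * wt2 u y) (M * (6 * pi)) r _ r1 _ (HM u) _ cv.
move=> /(_ _ _)/le_trans; apply.
- by move=> y; rewrite mulr_ge0// wt2_ge0.
- by move=> N; rewrite symsumZ -mulrA ler_wpM2l// symsum_wt2.
- by rewrite ler_pM2r ?invr_gt0// lerDr.
Qed.

End Exponential.

Lemma symsum_smooth_decay r : 1 <= r ->
  cvgn (symsum (fun x => f (x%:~R / r))) /\
  `|limn (symsum (fun x => f (x%:~R / r))) - r * Rintegral mu setT f| <=
    2 * C * (3 * pi) / r.
Proof.
move=> r1.
have sw N : symsum (fun x : int => wt (x%:~R / r)) N <= 3 * pi * r.
  have := @symsum_wt R r 0 N r1.
  by under [X in symsum X]eq_fun do rewrite addr0.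
have cv : cvgn (symsum (fun x => f (x%:~R / r))).
  apply: (@symsum_cvg _ _ (C * (3 * pi * r))) => N.
  apply: (@le_trans _ _ (symsum (fun x => C * wt (x%:~R / r)) N)).
    by apply: symsum_le => x; exact: fw.
  by rewrite symsumZ ler_wpM2l.
split=> //; apply: (@midpoint_rule R f cf (rintegrable_decay cf fw)
  (fun y => 2 * C * wt y)) => //.
- by move=> y; rewrite !mulr_ge0// wt_ge0.
- exact: second_difference_le.
- by move=> N; rewrite symsumZ -[leRHS]mulrA ler_wpM2l// mulr_ge0.
Qed.

End Increments.

(** * Expectations of independent products *)

Section LayerCake.
Variable R : realType.

(** The sum counts the positive integers up to [y], so it is the integer part of [y]. *)
Lemma sum_steps_le (n : nat) (y : R) : 0 <= y -> y <= n%:R ->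
  y - 1 <= \sum_(k < n) ((k.+1%:R <= y)%R : nat)%:R <= y.
Proof.
have full m z : m%:R <= z -> \sum_(k < m) ((k.+1%:R <= z)%R : nat)%:R = m%:R :> R.
  elim: m => [|m IH] mz; first by rewrite big_ord0.
  rewrite big_ord_recr /= mz -natr1 IH//.
  by rewrite (le_trans _ mz)// ler_nat.
elim: n => [|n IH] y0 yn.
  by rewrite big_ord0; apply/andP; split; move: yn; rewrite ?mulr0n; lra.
have [yn'|ny] := leP y n%:R.
  rewrite big_ord_recr /= (_ : (n.+1%:R <= y) = false) ?addr0; first exact: IH.
  by apply/negbTE; rewrite -ltNge (le_lt_trans yn')// ltr_nat.
rewrite big_ord_recr /= full ?(ltW ny)//.
move: yn; rewrite -natr1 => yn.
by case: (leP (n%:R + 1) y) => /= h; apply/andP; split; lra.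
Qed.

End LayerCake.

Section BoundedClass.
Context {d : measure_display} {T : measurableType d} {R : realType}.
Variables (P : probability T R).

Lemma rintegral_indic (A : set T) : measurable A ->
  Rintegral P setT (\1_A) = fine (P A).
Proof. by move=> mA; rewrite /Rintegral integral_indic// setIT. Qed.

Variables (H X Y : T -> R) (k K M : R) (g : R -> R).
Hypotheses (mH : measurable_fun setT H) (HK : forall w, `|H w| <= K).
Hypotheses (mX : measurable_fun setT X) (mY : measurable_fun setT Y).
Hypothesis HXY : forall D : set R, measurable D ->
  Rintegral P setT (fun w => H w * \1_D (X w)) =
  k * Rintegral P setT (fun w => \1_D (Y w)).
Hypotheses (mg : measurable_fun setT g) (gM : forall x, 0 <= g x <= M).

(* Functions with values in [0, M] are uniform limits of combinations of
   indicators of their superlevel sets. *)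
Lemma rintegral_bounded_class :
  Rintegral P setT (fun w => H w * g (X w)) = k * Rintegral P setT (fun w => g (Y w)).
Proof.
have K0 : 0 <= K.
  exact: le_trans (rintegral_bounded P mH HK).
have M0 : 0 <= M by have /andP[] := gM 0; exact: le_trans.
have gN x : `|g x| <= M by have /andP[g0 g1] := gM x; rewrite ger0_norm.
pose Dn n j : set R := [set x | j.+1%:R * M <= n%:R * g x].
have mD n j : measurable (Dn n j).
  by apply: measurable_ler_set => //; exact: measurable_funM.
pose gn n x : R := M / n%:R * \sum_(j < n) \1_(Dn n j) x.
have approx n x : (0 < n)%N -> `|g x - gn n x| <= M / n%:R.
  move=> n0; have n0' : 0 < n%:R :> R by rewrite ltr0n.
  have /andP[g0 g1] := gM x.
  have [M00|Mn0] := eqVneq M 0.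
    by rewrite /gn M00 !mul0r subr0; move: (gN x); rewrite M00.
  have Mp : 0 < M by rewrite lt_neqAle eq_sym Mn0.
  have y0 : 0 <= n%:R * g x / M by nonneg.
  have yn : n%:R * g x / M <= n%:R by rewrite ler_pdivrMr// ler_pM2l.
  have := sum_steps_le y0 yn.
  have -> : \sum_(j < n) ((j.+1%:R <= n%:R * g x / M)%R : nat)%:R =
      \sum_(j < n) \1_(Dn n j) x :> R.
    apply: eq_bigr => j _; rewrite indicE; congr (nat_of_bool _)%:R.
    rewrite ler_pdivlMr//; apply/idP/idP; first by move=> h; rewrite inE.
    by rewrite inE.
  rewrite /gn; set S := \sum_(j < n) _ => /andP[h1 h2].
  have E : g x - M / n%:R * S = M / n%:R * (n%:R * g x / M - S).
    by field; rewrite ?gt_eqF// (gt_eqF Mp).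
  rewrite E normrM ger0_norm ?divr_ge0// ler_piMr ?divr_ge0//.
  by rewrite ger0_norm; lra.
have mind n j (Z : T -> R) : measurable_fun setT Z ->
    measurable_fun setT (fun w => \1_(Dn n j) (Z w) : R).
  by move=> mZ; apply: measurableT_comp => //; exact: measurable_indic.
have indb n j (Z : T -> R) w : `|\1_(Dn n j) (Z w) : R| <= 1.
  by rewrite indicE; case: (_ \in _); rewrite ?normr1 ?normr0.
have iY n j : rintegrable P (fun w => \1_(Dn n j) (Y w) : R).
  by apply: (@rintegrable_bounded _ _ _ _ _ 1); [exact: mind|exact: indb].
have iHX n j : rintegrable P (fun w => H w * \1_(Dn n j) (X w)).
  apply: (@rintegrable_bounded _ _ _ _ _ (K * 1)).
    by apply: measurable_funM => //; exact: mind.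
  by move=> w; rewrite normrM ler_pM.
have gnE n : Rintegral P setT (fun w => H w * gn n (X w)) =
    k * Rintegral P setT (fun w => gn n (Y w)).
  have -> : (fun w => H w * gn n (X w)) =
      (fun w => M / n%:R * \sum_(j < n) H w * \1_(Dn n j) (X w)).
    by apply/funext => w; rewrite /gn mulrCA mulr_sumr.
  have iS1 : rintegrable P (fun w => \sum_(j < n) H w * \1_(Dn n j) (X w)).
    by apply: rintegrable_sum => j; exact: iHX.
  have iS2 : rintegrable P (fun w => \sum_(j < n) \1_(Dn n j) (Y w) : R).
    by apply: rintegrable_sum => j; exact: iY.
  rewrite (RintegralZl _ measurableT iS1) (RintegralZl _ measurableT iS2).
  rewrite [RHS]mulrCA; congr (_ * _).
  rewrite rintegral_sum; last by move=> j; exact: iHX.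
  rewrite rintegral_sum; last by move=> j; exact: iY.
  by rewrite mulr_sumr; apply: eq_bigr => j _; exact: HXY.
have mgX : measurable_fun setT (fun w => g (X w)) by exact: measurableT_comp.
have mgY : measurable_fun setT (fun w => g (Y w)) by exact: measurableT_comp.
have iHg : rintegrable P (fun w => H w * g (X w)).
  apply: (@rintegrable_bounded _ _ _ _ _ (K * M)); first exact: measurable_funM.
  by move=> w; rewrite normrM ler_pM.
have igY : rintegrable P (fun w => g (Y w)) by apply: (@rintegrable_bounded _ _ _ _ _ M).
have ign n : rintegrable P (fun w => gn n (Y w)).
  by apply: rintegrableZ; exact: rintegrable_sum.
have iHgn n : rintegrable P (fun w => H w * gn n (X w)).
  have -> : (fun w => H w * gn n (X w)) =
      (fun w => M / n%:R * \sum_(j < n) H w * \1_(Dn n j) (X w)).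
    by apply/funext => w; rewrite /gn mulrCA mulr_sumr.
  by apply: rintegrableZ; exact: rintegrable_sum.
set L := Rintegral P setT _; set Q := Rintegral P setT _.
have key n : (0 < n)%N -> `|L - k * Q| * n%:R <= (K + `|k|) * M.
  move=> n0; have n0' : 0 < n%:R :> R by rewrite ltr0n.
  rewrite -ler_pdivlMr// -mulrA mulrDl.
  have -> : L - k * Q = (L - Rintegral P setT (fun w => H w * gn n (X w))) -
     k * (Q - Rintegral P setT (fun w => gn n (Y w))).
    by rewrite gnE; ring.
  apply: (le_trans (ler_normB _ _)); apply: lerD.
    rewrite -(RintegralB measurableT iHg (iHgn n)).
    apply: (@rintegral_bounded _ _ _ P _ (K * (M / n%:R))).
      exact: rintegrable_measurable (rintegrableB iHg (iHgn n)).
    by move=> w; rewrite -mulrBr normrM ler_pM// approx.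
  rewrite normrM ler_wpM2l// -(RintegralB measurableT igY (ign n)).
  apply: (@rintegral_bounded _ _ _ P _ (M / n%:R)).
    exact: rintegrable_measurable (rintegrableB igY (ign n)).
  by move=> w; exact: approx.
apply/eqP; rewrite -subr_eq0 -normr_le0 leNgt; apply/negP => h.
pose n := (Num.truncn ((K + `|k|) * M / `|L - k * Q|)).+1.
have := key n isT; rewrite leNgt => /negP; apply.
by rewrite [ltRHS]mulrC -ltr_pdivrMr//; exact: truncnS_gt.
Qed.

End BoundedClass.

Section Independence.
Context {d : measure_display} {T : measurableType d} {R : realType}.
Variables (P : probability T R) (xi : int -> T -> R).
Hypothesis mxi : forall x, measurable_fun setT (xi x).

Lemma identically_distributed_mean (g : R -> R) (M : R) x :
  identically_distributed P xi -> measurable_fun setT g ->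
  (forall y, 0 <= g y <= M) ->
  Rintegral P setT (fun w => g (xi x w)) = Rintegral P setT (fun w => g (xi 0 w)).
Proof.
move=> iid mg gM.
have := @rintegral_bounded_class _ _ _ P (cst 1) (xi x) (xi 0) 1 1 M g
  (measurable_cst _) _ (mxi x) (mxi 0) _ mg gM.
rewrite mul1r; under eq_Rintegral do rewrite mul1r; apply.
  by move=> w; rewrite normr1.
move=> D mD; rewrite mul1r; under eq_Rintegral do rewrite mul1r.
have E z : Rintegral P setT (fun w => \1_D (xi z w)) = fine (P (xi z @^-1` D)).
  rewrite -rintegral_indic; first exact: eq_Rintegral.
  by rewrite -[X in measurable X]setTI; exact: mxi.
by rewrite !E iid.
Qed.

Lemma independent_mean_prod (h : int -> R -> R) (M : R) (s : seq int) :
  mutually_independent P xi -> (forall x, measurable_fun setT (h x)) ->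
  (forall x y, 0 <= h x y <= M) -> uniq s ->
  Rintegral P setT (fun w => \prod_(x <- s) h x (xi x w)) =
  \prod_(x <- s) Rintegral P setT (fun w => h x (xi x w)).
Proof.
move=> ind mh hM.
have mpre x (D : set R) : measurable D -> measurable (xi x @^-1` D).
  by move=> mD; rewrite -[X in measurable X]setTI; exact: mxi.
have mcap (t : seq int) (B : int -> set R) : (forall x, measurable (B x)) ->
    measurable (\big[setI/setT]_(x <- t) (xi x @^-1` B x)).
  move=> mB; elim: t => [|x t IH]; first by rewrite big_nil.
  by rewrite big_cons; apply: measurableI => //; exact: mpre.
have M0 : 0 <= M by have /andP[] := hM 0 0; exact: le_trans.
(* Generalization to functions at the sites of [s] and indicators at further sites [t]. To treat a
   site [a], its function is first replaced by the indicator of a set [D], which puts [a] into [t];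
   [rintegral_bounded_class] then passes from indicators back to [h a]. *)
suff gen t (B : int -> set R) : (forall x, measurable (B x)) -> uniq (s ++ t) ->
    Rintegral P setT (fun w => (\prod_(x <- s) h x (xi x w)) *
      \1_(\big[setI/setT]_(x <- t) (xi x @^-1` B x)) w) =
    (\prod_(x <- s) Rintegral P setT (fun w => h x (xi x w))) *
    \prod_(x <- t) fine (P (xi x @^-1` B x)).
  move=> us; have := gen [::] (fun=> setT) (fun=> measurableT).
  rewrite cats0 !big_nil mulr1 => /(_ us) <-.
  by apply: eq_Rintegral => w _; rewrite indicT mulr1.
elim: s t B => [|a s IH] t B mB us.
  rewrite big_nil mul1r.
  under eq_Rintegral do rewrite big_nil mul1r.
  rewrite rintegral_indic; last exact: mcap.
  rewrite ind//; elim: t {us} => [|x t IHt]; first by rewrite !big_nil.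
  rewrite !big_cons fineM ?IHt//.
    by rewrite fin_num_measure//; exact: mpre.
  elim: (t) => [|z t' IHt']; first by rewrite big_nil.
  by rewrite big_cons fin_numM// fin_num_measure//; exact: mpre.
have /andP[aNs us'] : (a \notin s ++ t) && uniq (s ++ t) by [].
have aNt : a \notin t by apply: contra aNs; rewrite mem_cat => ->; rewrite orbT.
pose H w := (\prod_(x <- s) h x (xi x w)) *
      \1_(\big[setI/setT]_(x <- t) (xi x @^-1` B x)) w : R.
pose k := (\prod_(x <- s) Rintegral P setT (fun w => h x (xi x w))) *
    \prod_(x <- t) fine (P (xi x @^-1` B x)).
have prodM w : 0 <= \prod_(x <- s) h x (xi x w) <= \prod_(x <- s) M.
  apply/andP; split; first by apply: prodr_ge0 => x _; case/andP: (hM x (xi x w)).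
  by apply: ler_prod => x _; exact: hM.
have mprod (t' : seq int) : measurable_fun setT (fun w => \prod_(x <- t') h x (xi x w)).
  elim: t' => [|x t' IHt].
    rewrite (_ : (fun w => _) = cst 1)//.
    by apply/funext => w; rewrite big_nil.
  rewrite (_ : (fun w => _) =
    (fun w => h x (xi x w) * \prod_(y <- t') h y (xi y w))).
    by apply: measurable_funM => //; apply: measurableT_comp.
  by apply/funext => w; rewrite big_cons.
suff key : Rintegral P setT (fun w => H w * h a (xi a w)) =
    k * Rintegral P setT (fun w => h a (xi a w)).
  rewrite big_cons -mulrA [RHS]mulrC -/k -key.
  by apply: eq_Rintegral => w _; rewrite /H big_cons; ring.
apply: (@rintegral_bounded_class _ _ _ P H (xi a) (xi a) k (\prod_(x <- s) M) M) => //.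
- by apply: measurable_funM => //; apply: measurable_indic; exact: mcap.
- move=> w; have /andP[p0 pM] := prodM w.
  rewrite /H normrM ger0_norm// -[leRHS]mulr1 ler_pM//.
  by rewrite indicE; case: (_ \in _); rewrite ?normr1 ?normr0.
move=> D mD.
pose B' x := if x == a then D else B x.
have mB' x : measurable (B' x) by rewrite /B'; case: ifP.
have us2 : uniq (s ++ a :: t).
  by rewrite -(cat1s a t) uniq_catCA.
have := IH (a :: t) B' mB' us2.
have B't : \big[setI/setT]_(x <- t) (xi x @^-1` B' x) =
    \big[setI/setT]_(x <- t) (xi x @^-1` B x).
  apply: eq_big_seq => x xt; rewrite /B'; case: eqP => // xa.
  by move: aNt; rewrite -xa xt.
have PB't : \prod_(x <- t) fine (P (xi x @^-1` B' x)) =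
    \prod_(x <- t) fine (P (xi x @^-1` B x)).
  apply: eq_big_seq => x xt; rewrite /B'; case: eqP => // xa.
  by move: aNt; rewrite -xa xt.
rewrite !big_cons B't PB't /B' eqxx => E.
transitivity (Rintegral P setT (fun w => \prod_(x <- s) h x (xi x w) *
    \1_(xi a @^-1` D `&` \big[setI/setT]_(x <- t) (xi x @^-1` B x)) w)).
  apply: eq_Rintegral => w _; rewrite /H indicI/= -mulrA; congr (_ * _).
  by rewrite mulrC.
rewrite E /k -mulrA; congr (_ * _); rewrite mulrC; congr (_ * _).
by rewrite -rintegral_indic//; exact: mpre.
Qed.

End Independence.

(** * Measurability and exponential integrability of random series *)

Section MeasurableLimit.
Context {d : measure_display} {T : measurableType d} {R : realType}.
Variable S : nat -> T -> R.
Hypothesis mS : forall n, measurable_fun setT (S n).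

Lemma measurable_cvg_set : measurable [set w | cvgn (S ^~ w)].
Proof.
have -> : [set w | cvgn (S ^~ w)] = \bigcap_k \bigcup_m \bigcap_n
    [set w | `|S (m + n)%N w - S m w| <= k.+1%:R^-1].
  apply/seteqP; split => w /=.
    move=> cw k _; have k0 : 0 < (k.+1%:R^-1 / 2 : R) by rewrite divr_gt0 ?invr_gt0.
    have /cvgrPdist_lt /(_ _ k0) [m _ Hm] := cw.
    exists m => // n _ /=.
    have h1 := Hm m (leqnn m); have h2 := Hm (m + n)%N (leq_addr n m).
    rewrite -(subrKA (limn (S ^~ w))) (le_trans (ler_normD _ _))//.
    rewrite distrC [leRHS](splitr (k.+1%:R^-1)) lerD// ltW//.
  move=> H; apply/cauchy_cvgP/cauchy_exP => e e0.
  pose k := Num.truncn e^-1.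
  have ke : k.+1%:R^-1 < e.
    by rewrite invf_plt ?posrE//; exact: truncnS_gt.
  have [m _ Hm] := H k I.
  exists (S m w); exists m => // n /= mn.
  have := Hm (n - m)%N I; rewrite /= subnKC// => h.
  by rewrite /ball /= distrC (le_lt_trans h).
apply: bigcap_measurable => // k _; apply: bigcup_measurable => m _.
apply: bigcap_measurable => // n _; apply: measurable_ler_set => //.
apply: measurable_comp_continuous; first exact: norm_continuous.
exact: measurable_funB.
Qed.

Lemma measurable_limn : measurable_fun setT (fun w => limn (S ^~ w)).
Proof.
pose A := [set w | cvgn (S ^~ w)].
have mA : measurable A by exact: measurable_cvg_set.
(* Where the sequence diverges, [limn] takes this default value; the sequence is altered there so as
   to converge everywhere. *)
pose pt : R := point.
pose g n w : R := \1_A w * S n w + (1 - \1_A w) * pt.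
have mg n : measurable_fun setT (g n).
  apply: measurable_funD; apply: measurable_funM => //.
  exact: measurable_funB.
apply: (measurable_fun_cvg mg) => w _; rewrite /g indicE.
have [wA|wA] := boolP (w \in A).
  rewrite (_ : (fun n => _) = S ^~ w); last first.
    by apply/funext => n; rewrite mul1r subrr mul0r addr0.
  by move: wA; rewrite inE.
rewrite (_ : (fun n => _) = (fun=> pt)); last first.
  by apply/funext => n; rewrite mul0r subr0 mul1r add0r.
rewrite (dvgP (_ : ~ cvgn (S ^~ w))); first exact: cvg_cst.
by move=> cw; move/negP: wA; apply; rewrite inE.
Qed.

End MeasurableLimit.

Section SymmetricSeriesOfFunctions.
Context {d : measure_display} {T : measurableType d} {R : realType}.
Variables (P : probability T R) (a : int -> T -> R) (C : R).
Hypothesis ma : forall x, measurable_fun setT (a x).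
Hypothesis aC : forall x w, `|a x w| <= C.

Lemma measurable_symsum (b : int -> T -> R) N :
  (forall x, measurable_fun setT (b x)) ->
  measurable_fun setT (fun w => symsum (b ^~ w) N).
Proof. by move=> mb; apply: measurable_sum => i; exact: mb. Qed.

Hypothesis expbnd : forall k : R, 0 <= k -> exists B : R, forall N,
  Rintegral P setT (fun w => expR (k * symsum (fun x => `|a x w|) N)) <= B.

Let mA N : measurable_fun setT (fun w => symsum (fun x => `|a x w|) N).
Proof.
by apply: (@measurable_symsum (fun x w => `|a x w|)) => x;
  apply: measurable_comp_continuous => //; exact: norm_continuous.
Qed.

Let mexp k N :
  measurable_fun setT (fun w => expR (k * symsum (fun x => `|a x w|) N)).
Proof.
apply: measurable_comp_continuous; first exact: continuous_expR.
exact: measurable_funM.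
Qed.

Let And w : nondecreasing_seq (symsum (fun x => `|a x w|)).
Proof.
by apply/nondecreasing_seqP => n; rewrite symsumS lerDl addr_ge0.
Qed.

Let AN (N : nat) w : symsum (fun x => `|a x w|) N <= (2 * N).+1%:R * C.
Proof.
rewrite /symsum (le_trans (ler_sum _ (fun i _ => aC _ w)))//.
by rewrite sumr_const card_ord mulr_natl.
Qed.

(** Monotone convergence makes the limit [Ginf] of the exponentials of the absolute sums integrable.
    Being finite almost everywhere, it forces absolute convergence of the series there, and it also
    dominates the exponentials of the signed sums. *)
Lemma exp_symsum_cvg (th : R) :
  rintegrable P (fun w => expR (th * limn (symsum (a ^~ w)))) /\
  Rintegral P setT (fun w => expR (th * symsum (a ^~ w) N)) @[N --> \oo] -->
  Rintegral P setT (fun w => expR (th * limn (symsum (a ^~ w)))).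
Proof.
(* [k >= |th|] serves the domination; [k >= 1] bounds the absolute sum [S] by [expR (k * S)]. *)
pose k := `|th| + 1; have k0 : 0 <= k by rewrite addr_ge0.
pose G N w : \bar R := (expR (k * symsum (fun x => `|a x w|) N))%:E.
have mG N : measurable_fun setT (G N) by apply/measurable_EFinP; exact: mexp.
have ndG w : nondecreasing_seq (G ^~ w).
  by move=> n m nm; rewrite lee_fin ler_expR ler_wpM2l// And.
have [B HB] := expbnd k0.
have iG N : rintegrable P (fun w => expR (k * symsum (fun x => `|a x w|) N)).
  apply: (@rintegrable_bounded _ _ _ _ _ (expR (k * ((2 * N).+1%:R * C)))) => //.
  by move=> w; rewrite ger0_norm ?expR_ge0// ler_expR ler_wpM2l.
have GB N : (\int[P]_w G N w <= B%:E)%E.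
  rewrite -[leLHS]fineK; last exact: (integrable_fin_num measurableT (iG N)).
  by rewrite lee_fin; exact: HB.
have G0 N w : (0 <= G N w)%E by rewrite lee_fin expR_ge0.
pose Ginf w := limn (G ^~ w).
have cG w : G ^~ w @ \oo --> Ginf w by exact: ereal_nondecreasing_is_cvgn.
have GleI N w : (G N w <= Ginf w)%E.
  apply: lime_ge; first exact: ereal_nondecreasing_is_cvgn.
  by exists N => // n /= Nn; exact: ndG.
have mGinf : measurable_fun setT Ginf.
  by apply: (emeasurable_fun_cvg _ _ mG) => w _; exact: cG.
have iGinf : P.-integrable setT Ginf.
  apply/integrableP; split => //.
  have Ginf0 w : (0 <= Ginf w)%E by rewrite (le_trans (G0 0%N w)).
  under eq_integral do rewrite gee0_abs//.
  have := @cvg_monotone_convergence _ _ _ P _ measurableT _ mG (fun N w _ => G0 N w)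
    (fun w _ => ndG w).
  move=> lim; rewrite (@le_lt_trans _ _ B%:E) ?ltry//.
  move/cvg_lim : lim => <- //; apply: lime_le; last exact: nearW.
  apply: ereal_nondecreasing_is_cvgn => m n mn.
  by apply: ge0_le_integral => // w _; exact: ndG.
pose F N w := (expR (th * symsum (a ^~ w) N))%:E.
pose Finf w := (expR (th * limn (symsum (a ^~ w))))%:E.
have mSN N : measurable_fun setT (fun w => symsum (a ^~ w) N).
  exact: measurable_symsum.
have mF N : measurable_fun setT (F N).
  apply/measurable_EFinP; apply: measurable_comp_continuous.
    exact: continuous_expR.
  exact: measurable_funM.
have mFinf : measurable_fun setT Finf.
  apply/measurable_EFinP; apply: measurable_comp_continuous.
    exact: continuous_expR.
  by apply: measurable_funM => //; exact: measurable_limn.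
have FF : {ae P, forall w, setT w -> F ^~ w @ \oo --> Finf w}.
  have := integrable_ae measurableT iGinf; apply: filterS => w /(_ I) fw _.
  apply: cvg_EFin; first exact: nearW.
  apply: continuous_cvg; first exact: continuous_expR.
  apply: cvgM; first exact: cvg_cst.
  apply: (@symsum_cvg _ _ (fine (Ginf w))) => N.
  have := GleI N w; rewrite -[leRHS]fineK// lee_fin; apply: le_trans.
  apply: (@le_trans _ _ (k * symsum (fun x => `|a x w|) N)); last first.
    by rewrite (le_trans _ (expR_ge1Dx _))// lerDr.
  by rewrite ler_peMl ?sumr_ge0// lerDr.
have FG : {ae P, forall w N, setT w -> (`|F N w| <= Ginf w)%E}.
  apply: nearW => w N _; apply: le_trans (GleI N w).
  rewrite lee_fin ger0_norm ?expR_ge0// ler_expR (le_trans (ler_norm _))//.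
  by rewrite normrM ler_pM// ?lerDl//; exact: norm_symsum_le.
have [i _ c] := dominated_convergence measurableT mF mFinf FF iGinf FG.
split; first exact: i.
apply: fine_cvg; rewrite fineK; last exact: (integrable_fin_num measurableT i).
exact: c.
Qed.

End SymmetricSeriesOfFunctions.

(** * Convergence of the moment generating function *)

Lemma continuous_comp_real (R : realType) (g h : R -> R) :
  continuous h -> continuous g -> continuous (fun x => g (h x)).
Proof. by move=> ch cg x; exact: (continuous_comp (ch x) (cg _)). Qed.

Section LogarithmBound.
Variable R : realType.

Lemma norm_ln1p_sub_le (b : R) : `|b| <= 2^-1 -> `|ln (1 + b) - b| <= 2 * b ^+ 2.
Proof.
rewrite ler_norml => /andP[b1 b2].
have p : 0 < 1 + b by lra.
have u : ln (1 + b) <= b by apply: le_ln1Dx; lra.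
have l : - (b / (1 + b)) >= - ln (1 + b).
  rewrite -lnV ?posrE//.
  rewrite [X in ln X](_ : _ = 1 + - (b / (1 + b))); last first.
    by field; rewrite gt_eqF.
  by apply: le_ln1Dx; rewrite ltrN2 ltr_pdivrMr// mul1r; lra.
have e : b / (1 + b) = b - b ^+ 2 / (1 + b) by field; rewrite gt_eqF.
have : b ^+ 2 / (1 + b) <= 2 * b ^+ 2.
  by rewrite ler_pdivrMr//; have := sqr_ge0 b; nra.
rewrite ler0_norm ?subr_le0//; lra.
Qed.

Lemma norm_ln1p_le (b : R) : `|b| <= 2^-1 -> `|ln (1 + b)| <= 2 * `|b|.
Proof.
move=> b1; rewrite -[ln _](subrK b) (le_trans (ler_normD _ _))//.
have := norm_ln1p_sub_le b1; rewrite -real_normK ?num_real//.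
have := normr_ge0 b; nra.
Qed.

End LogarithmBound.

Section SymmetricIndex.
Variable R : realType.

Definition symidx (N : nat) : seq int :=
  [seq (Posz i - Posz N)%R | i <- iota 0 (2 * N).+1].

Lemma symidx_uniq N : uniq (symidx N).
Proof. by rewrite map_inj_uniq ?iota_uniq// => i j; lia. Qed.

Lemma symsum_symidx (a : int -> R) N : symsum a N = \sum_(x <- symidx N) a x.
Proof.
rewrite big_map /symsum -(big_mkord xpredT (fun i => a (Posz i - Posz N)%R)).
by rewrite /index_iota subn0.
Qed.

End SymmetricIndex.

Section MomentGeneratingFunction.
Context {d : measure_display} {T : measurableType d} {R : realType}.
Variables (P : probability T R) (xi : int -> T -> R) (c : R).
Variables (f df : R -> R) (C : R).
Hypothesis mxi : forall x, measurable_fun setT (xi x).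
Hypothesis ind : mutually_independent P xi.
Hypothesis iid : identically_distributed P xi.
Hypothesis cre : (1 - charfun_re P (xi 0) t) / `|t| @[t --> 0^'] --> c.
Hypothesis cim : charfun_im P (xi 0) t / `|t| @[t --> 0^'] --> 0.
Hypothesis fC : smooth_decay f df C.
Local Notation mu := (@lebesgue_measure R).
Local Notation X := (xi 0).

Let C0 : 0 <= C.
Proof.
have [_ H _ _] := fC; have := le_trans (normr_ge0 _) (H 0).
by rewrite pmulr_lge0// wt_gt0.
Qed.

Let cf : continuous f. Proof. by case: fC. Qed.

Let fw y : `|f y| <= C * wt y. Proof. by case: fC. Qed.

Let fle y : `|f y| <= C.
Proof. by rewrite (le_trans (fw y))// ler_piMr// wt_le1. Qed.

Let mXr r : measurable_fun setT (fun w => X w / r).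
Proof. exact: measurable_funM. Qed.

Definition summand r (x : int) w : R := f ((x%:~R + xi x w) / r).

Let msummand r x : measurable_fun setT (summand r x).
Proof.
apply: measurable_comp_continuous => //.
by apply: measurable_funM => //; exact: measurable_funD.
Qed.

Let mean_site r x (g : R -> R) (M : R) : continuous g -> (forall y, 0 <= g y <= M) ->
  Rintegral P setT (fun w => g ((x%:~R + xi x w) / r)) =
  Rintegral P setT (fun w => g (x%:~R / r + X w / r)).
Proof.
move=> cg gM.
rewrite (@identically_distributed_mean _ _ _ P xi mxi
  (fun y => g ((x%:~R + y) / r)) M x iid) //.
- by apply: eq_Rintegral => w _; rewrite mulrDl.
- apply: continuous_measurable_fun.
  apply: (@continuous_comp_real R g (fun y => (x%:~R + y) / r)) => // y.
  by apply: cvgM; [apply: cvgD; [exact: cvg_cst|exact: cvg_id]|exact: cvg_cst].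
Qed.

Let prod_site r N (g : R -> R) (M : R) : continuous g -> (forall y, 0 <= g y <= M) ->
  Rintegral P setT (fun w => \prod_(x <- symidx N) g ((x%:~R + xi x w) / r)) =
  \prod_(x <- symidx N) Rintegral P setT (fun w => g (x%:~R / r + X w / r)).
Proof.
move=> cg gM.
rewrite (@independent_mean_prod _ _ _ P xi mxi
  (fun x y => g ((x%:~R + y) / r)) M) ?symidx_uniq//.
- by apply: eq_bigr => x _; exact: mean_site gM.
- move=> x; apply: continuous_measurable_fun.
  apply: (@continuous_comp_real R g (fun y => (x%:~R + y) / r)) => // y.
  by apply: cvgM; [apply: cvgD; [exact: cvg_cst|exact: cvg_id]|exact: cvg_cst].
Qed.

Let mshift (g : R -> R) r (y : R) : continuous g ->
  measurable_fun setT (fun w => g (y + X w / r)).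
Proof.
move=> cg; apply: measurable_comp_continuous => //.
exact: measurable_funD.
Qed.

(** By independence the mean is a product, and each factor is at most
    [1 + K * E wt <= expR (K * E wt)]. As only the marginal laws remain, a single [X] serves all
    sites; the exponents add up to the mean of a lattice sum of [wt] shifted by [X], which is
    bounded for every value of the shift. *)
Lemma exp_abs_partial_bound r (k : R) : 1 <= r -> 0 <= k -> exists B : R, forall N,
  Rintegral P setT (fun w => expR (k * symsum (fun x => `|summand r x w|) N)) <= B.
Proof.
move=> r1 k0.
pose K := k * C * expR (k * C); have K0 : 0 <= K by rewrite /K; nonneg.
exists (expR (K * (3 * pi * r))) => N.
have gM y : 0 <= expR (k * `|f y|) <= expR (k * C).
  by rewrite expR_ge0 ler_expR ler_wpM2l.
have cg : continuous (fun y => expR (k * `|f y|)).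
  move=> y; apply: continuous_comp; last exact: continuous_expR.
  apply: cvgM; first exact: cvg_cst.
  by apply: cvg_norm; exact: cf.
have E w : expR (k * symsum (fun x => `|summand r x w|) N) =
    \prod_(x <- symidx N) expR (k * `|f ((x%:~R + xi x w) / r)|).
  by rewrite symsum_symidx mulr_sumr expR_sum.
under eq_Rintegral do rewrite E.
rewrite (prod_site r N cg gM).
have iw y : rintegrable P (fun w => wt (y + X w / r)).
  apply: (@rintegrable_bounded _ _ _ _ _ 1); first exact: mshift (@continuous_wt R).
  by move=> w; rewrite ger0_norm ?wt_ge0// wt_le1.
have site x : Rintegral P setT (fun w => expR (k * `|f (x%:~R / r + X w / r)|)) <=
    expR (K * Rintegral P setT (fun w => wt (x%:~R / r + X w / r))).
  set y := x%:~R / r.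
  rewrite (le_trans _ (expR_ge1Dx _))// -(RintegralZl _ measurableT (iw y)).
  rewrite -[X in X + _](rintegral_cst P 1) -RintegralD//; last 2 first.
  - exact: rintegrable_cst.
  - exact: rintegrableZ.
  apply: rintegral_le.
  - apply: (@rintegrable_bounded _ _ _ _ _ (expR (k * C))); first exact: mshift cg.
    by move=> w; have /andP[? ?] := gM (y + X w / r); rewrite ger0_norm.
  - by apply: rintegrableD; [exact: rintegrable_cst|exact: rintegrableZ].
  move=> w; set z := y + X w / r.
  have kz : `|k * `|f z| | = k * `|f z| by rewrite ger0_norm// mulr_ge0.
  have := norm_expR_sub1_le (k * `|f z|); rewrite kz => /(le_trans (ler_norm _)).
  rewrite lerBlDl => /le_trans; apply; rewrite lerD2l.
  rewrite /K [leRHS]mulrAC; apply: ler_pM.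
  - by nonneg.
  - exact: expR_ge0.
  - by rewrite -mulrA ler_wpM2l.
  - by rewrite ler_expR ler_wpM2l.
apply: (@le_trans _ _ (\prod_(x <- symidx N)
    expR (K * Rintegral P setT (fun w => wt (x%:~R / r + X w / r))))).
  apply: ler_prod => x _; rewrite site andbT.
  by apply: Rintegral_ge0 => w _; exact: expR_ge0.
rewrite -expR_sum ler_expR -mulr_sumr ler_wpM2l//.
rewrite -rintegral_sum; last by move=> x; exact: iw.
apply: (le_trans (ler_norm _)); apply: rintegral_bounded.
  by apply: measurable_sum => x; exact: mshift (@continuous_wt R).
move=> w; rewrite -symsum_symidx ger0_norm; last first.
  by apply: sumr_ge0 => x _; exact: wt_ge0.
rewrite (_ : (fun x => _) = (fun x : int => wt ((x%:~R + X w) / r))).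
  exact: symsum_wt.
by apply/funext => x; rewrite mulrDl.
Qed.

Lemma exp_Tstat_cvg r (th : R) : 1 <= r ->
  rintegrable P (fun w => expR (th * Tstat f xi r w)) /\
  Rintegral P setT (fun w => expR (th * symsum (summand r ^~ w) N)) @[N --> \oo] -->
  Rintegral P setT (fun w => expR (th * Tstat f xi r w)).
Proof.
move=> r1; apply: (@exp_symsum_cvg _ _ _ P (summand r) C).
- exact: msummand.
- by move=> x w; exact: fle.
- by move=> k k0; exact: exp_abs_partial_bound.
Qed.

Lemma measurable_Tstat r : measurable_fun setT (Tstat f xi r).
Proof.
apply: (@measurable_limn _ _ _ (fun N w => symsum (summand r ^~ w) N)) => N.
exact: measurable_symsum (msummand r).
Qed.

Section Exponent.
Variable th : R.

(** This is [b_r(x)], with base point [x / r] and displacement [X / r]. *)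
Definition site_defect r (x : int) : R :=
  Rintegral P setT (fun w => expinc f th (X w / r) (x%:~R / r)).

Let einc_le u y : `|expinc f th u y| <= expR (2 * C * `|th|) + 1.
Proof.
rewrite (le_trans (ler_normB _ _))// normr1 lerD2r ger0_norm ?expR_ge0//.
rewrite ler_expR (le_trans (ler_norm _))// normrM mulrC ler_wpM2r//.
exact: increment_le fC u y.
Qed.

Let ceinc y : continuous (fun u => expinc f th u y).
Proof.
move=> u; apply: cvgB; last exact: cvg_cst.
apply: continuous_comp; last exact: continuous_expR.
apply: cvgM; first exact: cvg_cst.
apply: cvgB; last exact: cvg_cst.
apply: (@continuous_comp _ _ _ (fun u => y + u) f); last exact: cf.
by apply: cvgD; [exact: cvg_cst|exact: cvg_id].
Qed.

Let iexpinc r y : rintegrable P (fun w => expinc f th (X w / r) y).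
Proof.
apply: (@rintegrable_bounded _ _ _ _ _ (expR (2 * C * `|th|) + 1)) => //.
by apply: (measurable_comp_continuous (@ceinc y)); exact: mXr.
Qed.

Lemma mgf_partial r N :
  Rintegral P setT (fun w => expR (th * symsum (summand r ^~ w) N)) =
  expR (th * symsum (fun x => f (x%:~R / r)) N) *
  \prod_(x <- symidx N) (1 + site_defect r x).
Proof.
have E w : expR (th * symsum (summand r ^~ w) N) =
    \prod_(x <- symidx N) expR (th * f ((x%:~R + xi x w) / r)).
  by rewrite symsum_symidx mulr_sumr expR_sum.
under eq_Rintegral do rewrite E.
have cg : continuous (fun y => expR (th * f y)).
  move=> y; apply: continuous_comp; last exact: continuous_expR.
  by apply: cvgM; [exact: cvg_cst|exact: cf].
have gM y : 0 <= expR (th * f y) <= expR (`|th| * C).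
  rewrite expR_ge0 ler_expR (le_trans (ler_norm _))// normrM.
  by rewrite ler_wpM2l.
rewrite (prod_site r N cg gM) symsum_symidx mulr_sumr expR_sum -big_split /=.
apply: eq_bigr => x _; set y := x%:~R / r.
rewrite -[X in _ * (X + _)](rintegral_cst P 1) -RintegralD//; last 2 first.
- exact: rintegrable_cst.
- exact: iexpinc.
rewrite -RintegralZl//; last by apply: rintegrableD; [exact: rintegrable_cst|exact: iexpinc].
apply: eq_Rintegral => w _; rewrite /expinc (addrC 1) subrK -expRD -mulrDr /increment.
by congr (expR (th * _)); ring.
Qed.

(** The linear part is [th * df (x / r) * E sin (X / r)], of order [wt (x / r) / r]. The remainder
    is at most a multiple of the mean of [trunc2 * wt2]; summing over [x] inside the expectation
    turns [wt2] into [6 * pi * r], which the order [1 / r] of [E trunc2 (X / r)] compensates. *)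
Lemma site_defect_bounds : exists2 K, 0 <= K & forall r, 1 <= r ->
  [/\ forall x, `|site_defect r x| <= K / r,
      forall N, symsum (fun x => `|site_defect r x|) N <= K,
      cvgn (symsum (site_defect r)) &
      `|limn (symsum (site_defect r)) - scaled_mean P X (mean_expinc f th) r| <= K / r].
Proof.
have [K1 K10 H1] := expinc_sin fC th.
have [Cs Cs0 Hs] := scaled_sin_bound (mxi 0) cim.
have [Ct Ct0 Ht] := scaled_trunc2_bound (mxi 0) cre.
have [K2 K20 H2] := symsum_expinc fC th.
pose Ka := `|th| * C * Cs + K1 * (2 * Ct).
pose Kb := `|th| * C * Cs * (3 * pi) + K1 * (6 * pi * Ct).
have Ka0 : 0 <= Ka by rewrite /Ka; nonneg.
have Kb0 : 0 <= Kb by rewrite /Kb; nonneg.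
exists (Ka + Kb + K2); first by nonneg.
move=> r r1; have r0 : 0 < r by rewrite (lt_le_trans _ r1).
pose e x := Rintegral P setT (fun w => trunc2 (X w / r) * wt2 (X w / r) (x%:~R / r)).
have mt : measurable_fun setT (fun w => trunc2 (X w / r)).
  exact: measurable_comp_continuous (@continuous_trunc2 R) (mXr r).
have mw y : measurable_fun setT (fun w => wt2 (X w / r) y).
  by apply: measurable_funD => //; exact: mshift (@continuous_wt R).
have ie x : rintegrable P (fun w => trunc2 (X w / r) * wt2 (X w / r) (x%:~R / r)).
  apply: (@rintegrable_bounded _ _ _ _ _ (1 * 2)); first exact: measurable_funM.
  move=> w; rewrite ger0_norm ?mulr_ge0 ?trunc2_ge0 ?wt2_ge0//.
  by rewrite ler_pM ?trunc2_ge0 ?wt2_ge0 ?trunc2_le1 ?wt2_le2.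
have it : rintegrable P (fun w => trunc2 (X w / r)).
  apply: (@rintegrable_bounded _ _ _ _ _ 1) => // w.
  by rewrite ger0_norm ?trunc2_ge0// trunc2_le1.
have is_ : rintegrable P (fun w => sin (X w / r)).
  apply: (@rintegrable_bounded _ _ _ _ _ 1) => [|w]; last exact: sin_max.
  exact: measurable_comp_continuous (@continuous_sin R) (mXr r).
have dle x : `|site_defect r x| <= `|th| * C * Cs / r * wt (x%:~R / r) + K1 * e x.
  set y := x%:~R / r.
  have dfw : `|df y| <= C * wt y by case: fC.
  have -> : site_defect r x = Rintegral P setT (fun w =>
      expinc f th (X w / r) y - th * df y * sin (X w / r)) +
      th * df y * Rintegral P setT (fun w => sin (X w / r)).
    rewrite RintegralB//; last 2 first.
    - exact: iexpinc.
    - exact: rintegrableZ.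
    by rewrite (RintegralZl _ measurableT is_) subrK.
  rewrite addrC (le_trans (ler_normD _ _))// lerD//.
    rewrite !normrM.
    have -> : `|th| * C * Cs / r * wt y = `|th| * (C * wt y) * (Cs / r) by ring.
    by rewrite ler_pM// ?Hs// ler_wpM2l.
  rewrite -(RintegralZl K1 measurableT (ie x)).
  apply: rintegral_norm_le; last exact: rintegrableZ.
    apply: rintegrable_measurable; apply: rintegrableB; first exact: iexpinc.
    exact: rintegrableZ.
  by move=> w; rewrite mulrA; exact: H1.
have ele x : e x <= 2 * Ct / r.
  apply: (@le_trans _ _ (2 * Rintegral P setT (fun w => trunc2 (X w / r)))).
    rewrite -(RintegralZl 2 measurableT it); apply: rintegral_le => //.
      exact: rintegrableZ.
    by move=> w; rewrite mulrC ler_wpM2r ?trunc2_ge0// wt2_le2.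
  by rewrite -mulrA ler_wpM2l// Ht.
have esum N : symsum e N <= 6 * pi * Ct.
  rewrite symsum_symidx -rintegral_sum; last by move=> x; exact: ie.
  apply: (@le_trans _ _ (6 * pi * r * Rintegral P setT (fun w => trunc2 (X w / r)))).
    rewrite -(RintegralZl _ measurableT it); apply: rintegral_le.
    - by apply: rintegrable_sum => x; exact: ie.
    - exact: rintegrableZ.
    - move=> w; rewrite -mulr_sumr -symsum_symidx mulrC.
      by rewrite ler_wpM2r ?trunc2_ge0// symsum_wt2.
  rewrite -[leLHS]mulrA ler_wpM2l//; first by nonneg.
  by rewrite mulrC -ler_pdivlMr// Ht.
have swt N : symsum (fun x : int => wt (x%:~R / r)) N <= 3 * pi * r.
  have := @symsum_wt R r 0 N r1.
  by under [X in symsum X]eq_fun do rewrite addr0.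
have s1 N : symsum (fun x => `|site_defect r x|) N <= Kb.
  apply: (@le_trans _ _ (symsum (fun x =>
      `|th| * C * Cs / r * wt (x%:~R / r) + K1 * e x) N)).
    exact: symsum_le.
  rewrite symsumD !symsumZ /Kb lerD ?ler_wpM2l//.
  have -> : `|th| * C * Cs * (3 * pi) = `|th| * C * Cs / r * (3 * pi * r).
    by field; rewrite gt_eqF.
  by rewrite ler_wpM2l// mulr_ge0 ?invr_ge0 ?(ltW r0)//; nonneg.
have cv : cvgn (symsum (site_defect r)) := symsum_cvg s1.
split.
- move=> x; rewrite (le_trans (dle x))//.
  apply: (@le_trans _ _ (Ka / r)); last by rewrite ler_pM2r ?invr_gt0//; lra.
  rewrite /Ka [leRHS]mulrDl lerD//.
    by rewrite ler_piMr ?wt_le1// mulr_ge0 ?invr_ge0 ?(ltW r0)//; nonneg.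
  by rewrite -[leRHS]mulrA ler_wpM2l.
- by move=> N; rewrite (le_trans (s1 N))//; lra.
- exact: cv.
have r'1 := H2 r _ r1.
pose SN (N : nat) w := symsum (fun x => expinc f th (X w / r) (x%:~R / r)) N.
pose Sinf w := limn (symsum (fun x => expinc f th (X w / r) (x%:~R / r))).
have mSN N : measurable_fun setT (SN N).
  by apply: measurable_sum => i; exact: rintegrable_measurable (iexpinc _ _).
have SNle N w : `|SN N w| <= K2 * r.
  exact: le_trans (norm_symsum_le _ _) ((H2 r (X w / r) r1).1 N).
have [iS cS] := @rintegral_cvg _ _ _ P SN Sinf (cst (K2 * r)) mSN SNle
  (rintegrable_cst P _) (fun w => symsum_cvg (H2 r (X w / r) r1).1).
(* Sum and expectation are exchanged by dominated convergence, so that the midpoint estimate applies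
   for each fixed value of [X]. *)
have limE : limn (symsum (site_defect r)) = Rintegral P setT Sinf.
  apply/cvg_lim => //; rewrite (_ : symsum _ = fun N => Rintegral P setT (SN N)) //.
  apply/funext => N; rewrite symsum_symidx -rintegral_sum; last first.
    by move=> x; exact: iexpinc.
  by apply: eq_Rintegral => w _; rewrite /SN symsum_symidx.
have [KG KG0 HG] := mean_expinc_trunc2 fC th.
have bG : bounded_continuous (mean_expinc f th).
  split; first exact: continuous_mean_expinc fC th.
  exists KG => u.
  by rewrite (le_trans (HG u))// ler_piMr// trunc2_le1.
have iG := rintegrable_scaled P (mxi 0) r bG.
rewrite limE /scaled_mean -(RintegralZl _ measurableT iG) -RintegralB//; last first.
  exact: rintegrableZ.
apply: (@le_trans _ _ (K2 / r)); last by rewrite ler_pM2r ?invr_gt0//; lra.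
apply: rintegral_bounded.
  exact: (rintegrable_measurable (rintegrableB iS (rintegrableZ r iG))).
by move=> w; exact: (H2 r (X w / r) r1).2.
Qed.

Lemma centered_mgf : exists K, exists2 rho : R -> R,
  (forall r, 1 <= r -> K <= r -> `|rho r - scaled_mean P X (mean_expinc f th) r| <= K / r) &
  (forall r, 1 <= r -> K <= r ->
    Rintegral P setT (fun w => expR (th * (Tstat f xi r w - r * Rintegral mu setT f)))
    = expR (rho r)).
Proof.
have [K1 K10 H1] := site_defect_bounds.
pose Kf := 2 * C * (3 * pi).
have Kf0 : 0 <= Kf by rewrite /Kf; nonneg.
(* [K] is both the error constant and the threshold for [r]: the summand [2 * K1] ensures
   [|b_r(x)| <= 1 / 2], and the others come from the lattice sum of [f], from the logarithm and from
   the sum of the defects. *)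
pose K := 2 * K1 + (`|th| * Kf + 2 * K1 ^+ 2 + K1).
exists K.
pose lnd r x := ln (1 + site_defect r x).
pose rho r := th * limn (symsum (fun x => f (x%:~R / r))) + limn (symsum (lnd r))
   - th * (r * Rintegral mu setT f).
have main r : 1 <= r -> K <= r -> [/\ forall x, `|site_defect r x| <= 2^-1,
    cvgn (symsum (lnd r)) & cvgn (symsum (fun x => f (x%:~R / r)))].
  move=> r1 Kr; have r0 : 0 < r by rewrite (lt_le_trans _ r1).
  have [h1 h2 _ _] := H1 r r1.
  have dh x : `|site_defect r x| <= 2^-1.
    rewrite (le_trans (h1 x))// ler_pdivrMr// ler_pdivlMl//.
    rewrite (le_trans _ Kr)// /K lerDl; nonneg.
  split => //; last exact: (symsum_smooth_decay fC r1).1.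
  apply: (@symsum_cvg _ _ (2 * K1)) => N.
  apply: (@le_trans _ _ (symsum (fun x => 2 * `|site_defect r x|) N)).
    by apply: symsum_le => x; exact: norm_ln1p_le.
  by rewrite symsumZ ler_wpM2l.
exists rho => r r1 Kr; have r0 : 0 < r by rewrite (lt_le_trans _ r1).
  have [dh cl cF] := main r r1 Kr.
  have [h1 h2 cv h3] := H1 r r1.
  have [_ hf] := symsum_smooth_decay fC r1.
  set I := Rintegral mu setT f.
  have -> : rho r - scaled_mean P X (mean_expinc f th) r =
     th * (limn (symsum (fun x => f (x%:~R / r))) - r * I) +
     (limn (symsum (lnd r)) - limn (symsum (site_defect r))) +
     (limn (symsum (site_defect r)) - scaled_mean P X (mean_expinc f th) r).
    by rewrite /rho -/I; ring.
  have hl : `|limn (symsum (lnd r)) - limn (symsum (site_defect r))| <= 2 * K1 ^+ 2 / r.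
    have lim : `|symsum (lnd r) N - symsum (site_defect r) N| @[N --> \oo] -->
        `|limn (symsum (lnd r)) - limn (symsum (site_defect r))|.
      by apply: cvg_norm; exact: cvgB.
    apply: (cvgr_to_le lim); apply: nearW => N.
    rewrite -symsumB (le_trans (norm_symsum_le _ _))//.
    apply: (@le_trans _ _ (symsum (fun x => 2 * (K1 / r) * `|site_defect r x|) N)).
      apply: symsum_le => x; rewrite (le_trans (norm_ln1p_sub_le (dh x)))//.
      by rewrite -mulrA ler_wpM2l// -real_normK ?num_real// expr2 ler_wpM2r.
    rewrite symsumZ.
    have -> : 2 * K1 ^+ 2 / r = 2 * (K1 / r) * K1 by ring.
    by rewrite ler_wpM2l// mulr_ge0// divr_ge0// ltW.
  apply: (le_trans (ler_normD _ _)).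
  apply: (@le_trans _ _ ((`|th| * Kf / r + 2 * K1 ^+ 2 / r) + K1 / r)).
    apply: lerD => //; apply: (le_trans (ler_normD _ _)); apply: lerD => //.
    by rewrite normrM -mulrA ler_wpM2l.
  rewrite -!mulrDl ler_pM2r ?invr_gt0// /K lerDr; nonneg.
have [dh cl cF] := main r r1 Kr.
have [iT cT] := exp_Tstat_cvg th r1.
set I := Rintegral mu setT f.
have -> : (fun w => expR (th * (Tstat f xi r w - r * I))) =
    (fun w => expR (- (th * (r * I))) * expR (th * Tstat f xi r w)).
  by apply/funext => w; rewrite -expRD mulrBr addrC.
rewrite (RintegralZl _ measurableT iT).
have pos x : 0 < 1 + site_defect r x.
  by have := dh x; rewrite ler_norml => /andP[? ?]; lra.
have E N : Rintegral P setT (fun w => expR (th * symsum (summand r ^~ w) N)) =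
    expR (th * symsum (fun x => f (x%:~R / r)) N + symsum (lnd r) N).
  rewrite mgf_partial expRD; congr (_ * _).
  rewrite symsum_symidx expR_sum; apply: eq_bigr => x _.
  by rewrite /lnd lnK// posrE.
have cE : expR (th * symsum (fun x => f (x%:~R / r)) N + symsum (lnd r) N)
    @[N --> \oo] --> expR (th * limn (symsum (fun x => f (x%:~R / r))) +
      limn (symsum (lnd r))).
  apply: continuous_cvg; first exact: continuous_expR.
  by apply: cvgD => //; apply: cvgM => //; exact: cvg_cst.
have -> : Rintegral P setT (fun w => expR (th * Tstat f xi r w)) =
    expR (th * limn (symsum (fun x => f (x%:~R / r))) + limn (symsum (lnd r))).
  apply: (cvg_unique _ cT) => //.
  rewrite [X in X @ _](_ : _ = fun N =>
    expR (th * symsum (fun x => f (x%:~R / r)) N + symsum (lnd r) N)) //.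
  by apply/funext => N; exact: E.
by rewrite -expRD /rho -/I addrC.
Qed.

Theorem centered_mgf_cvg : exists2 psi : R,
  scaled_mean P X (mean_expinc f th) r @[r --> +oo] --> psi &
  Rintegral P setT (fun w => expR (th * (Tstat f xi r w - r * Rintegral mu setT f)))
    @[r --> +oo] --> expR psi.
Proof.
have [KG KG0 HG] := mean_expinc_trunc2 fC th.
have cm : continuous (mean_expinc f th) by move=> u; exact: (@continuous_mean_expinc _ _ _ _ fC th u).
have [psi hpsi] := trunc2_dominated_limit (mxi 0) cre cim cm HG.
exists psi => //.
have [K [rho H1 H2]] := centered_mgf.
have crho : rho r @[r --> +oo] --> psi.
  apply/cvgrPdist_le => e e0.
  have e20 : 0 < e / 2 by rewrite divr_gt0.
  have /cvgrPdist_le /(_ _ e20) h := hpsi.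
  near=> r.
  have r1 : 1 <= r by near: r; apply: nbhs_pinfty_ge; rewrite num_real.
  have Kr : K <= r by near: r; apply: nbhs_pinfty_ge; rewrite num_real.
  have r0 : 0 < r by rewrite (lt_le_trans _ r1).
  have er : (e / 2)^-1 * K <= r by near: r; apply: nbhs_pinfty_ge; rewrite num_real.
  have hr : `|psi - scaled_mean P X (mean_expinc f th) r| <= e / 2 by near: r.
  rewrite -(subrKA (scaled_mean P X (mean_expinc f th) r)).
  rewrite (le_trans (ler_normD _ _))// (splitr e) lerD//.
  by rewrite distrC (le_trans (H1 r r1 Kr))// ler_pdivrMr// -ler_pdivrMl.
apply: (@cvg_trans _ (expR (rho r) @[r --> +oo])).
  apply: near_eq_cvg; near=> r.
  have r1 : 1 <= r by near: r; apply: nbhs_pinfty_ge; rewrite num_real.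
  have Kr : K <= r by near: r; apply: nbhs_pinfty_ge; rewrite num_real.
  by rewrite H2.
by apply: continuous_cvg => //; exact: continuous_expR.
Unshelve. all: by end_near. Qed.

End Exponent.

End MomentGeneratingFunction.

(** * From moment generating functions to bounded continuous functions *)

Section ExponentialSeries.
Variable R : realType.
Implicit Types (x y : R) (q : nat -> R).

Lemma series_exp_coeff_le_expR x n : 0 <= x ->
  \sum_(k < n) x ^+ k / k`!%:R <= expR x.
Proof.
move=> x0.
have nd : nondecreasing_seq (series (exp_coeff x)).
  by apply: nondecreasing_series => k _ _; exact: exp_coeff_ge0.
have := nondecreasing_cvgn_le nd (is_cvg_series_exp_coeff x) n.
by rewrite -/(expR x) [X in X <= _ -> _]big_mkord; exact.
Qed.

Lemma power_le_expR x n : 0 <= x -> x ^+ n <= n`!%:R * expR x.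
Proof.
move=> x0; have f0 : 0 < n`!%:R :> R by rewrite ltr0n fact_gt0.
rewrite mulrC -ler_pdivrMr//; apply: le_trans (series_exp_coeff_le_expR n.+1 x0).
by rewrite big_ord_recr /= lerDr sumr_ge0// => i _; rewrite divr_ge0 ?exprn_ge0.
Qed.

(** For [k >= N] the factor [2 ^ k / 2 ^ N] is at least 1; inserting it bounds the tail by
    [2 ^ (- N)] times part of the series of [expR (2 * |y|)]. *)
Lemma power_series_tail q y l N : (forall n, `|q n| <= (n`!%:R)^-1) ->
  series (fun n => q n * y ^+ n) @ \oo --> l ->
  `|l - \sum_(k < N) q k * y ^+ k| <= 2^-1 ^+ N * expR (2 * `|y|).
Proof.
move=> qb ql.
have lim : `|series (fun n => q n * y ^+ n) n - \sum_(k < N) q k * y ^+ k|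
    @[n --> \oo] --> `|l - \sum_(k < N) q k * y ^+ k|.
  by apply: cvg_norm; apply: cvgB => //; exact: cvg_cst.
apply: (cvgr_to_le lim); near=> n.
have Nn : (N <= n)%N by near: n; exact: nbhs_infty_ge.
rewrite seriesEnat /= (big_cat_nat (leq0n N) Nn) /= -[in X in _ - X](big_mkord xpredT
  (fun k => q k * y ^+ k)) addrAC subrr add0r.
rewrite (le_trans (ler_norm_sum _ _ _))//.
apply: (@le_trans _ _ (\sum_(N <= k < n) 2^-1 ^+ N * ((2 * `|y|) ^+ k / k`!%:R))).
  rewrite big_nat_cond [leRHS]big_nat_cond; apply: ler_sum => k /andP[/andP[Nk _] _].
  rewrite normrM normrX (le_trans (ler_wpM2r _ (qb k))) ?exprn_ge0//.
  rewrite exprMn [leRHS](_ : _ = (2^-1 ^+ N * 2 ^+ k) * ((k`!%:R)^-1 * `|y| ^+ k)).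
    apply: ler_peMl; first by rewrite mulr_ge0 ?invr_ge0 ?exprn_ge0.
    by rewrite exprVn mulrC ler_pdivlMr ?exprn_gt0// mul1r ler_weXn2l// ler1n.
  by ring.
rewrite -mulr_sumr ler_wpM2l ?exprn_ge0 ?invr_ge0//.
apply: le_trans (series_exp_coeff_le_expR n _); last by rewrite mulr_ge0.
rewrite -(big_mkord xpredT (fun k => (2 * `|y|) ^+ k / k`!%:R)).
rewrite [leRHS](big_cat_nat (leq0n N) Nn) /= lerDr.
by apply: sumr_ge0 => k _; rewrite divr_ge0 ?exprn_ge0 ?mulr_ge0.
Unshelve. all: by end_near. Qed.

End ExponentialSeries.

Section ExponentialWeight.
Variable R : realType.
Implicit Types K x : R.

(** [2 * cosh (K * x)]: it dominates [expR (K * |x|)], yet its mean is read off the moment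
    generating function. *)
Definition expweight K x : R := expR (K * x) + expR (- K * x).

Lemma expR_norm_le_expweight K x : expR (K * `|x|) <= expweight K x.
Proof.
have [x0|x0] := leP 0 x; first by rewrite ger0_norm// lerDl expR_ge0.
by rewrite ltr0_norm// mulrN -mulNr lerDr expR_ge0.
Qed.

Lemma expweight_ge1 K x : 0 <= K -> 1 <= expweight K x.
Proof.
move=> K0; apply: le_trans (expR_norm_le_expweight K x).
by rewrite -expR0 ler_expR mulr_ge0.
Qed.

End ExponentialWeight.

Section ExpectationClass.
Context {d : measure_display} {T : measurableType d} {R : realType}.
Context {I : Type} {F : set_system I} {FF : ProperFilter F}.
Variables (P : I -> probability T R) (Y : I -> T -> R).
Hypothesis mY : forall i, measurable_fun setT (Y i).

(** Law and variable may both depend on the index: for the limit theorem [P] is fixed and [Y] varies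
    with [r], for moment determinacy [Y] is the identity and two laws are compared. *)
Definition mean_of (g : R -> R) (i : I) : R :=
  Rintegral (P i) setT (fun w => g (Y i w)).

(** Integrability is asked only eventually, because the exponential moments are obtained for
    [r >= 1]. *)
Definition converges (g : R -> R) : Prop := [/\ measurable_fun setT g,
  \forall i \near F, rintegrable (P i) (fun w => g (Y i w)) &
  exists l : R, mean_of g i @[i --> F] --> l].

Hypothesis bounded_expweight : forall K : R, exists B : R, \forall i \near F,
  rintegrable (P i) (fun w => expweight K (Y i w)) /\ mean_of (expweight K) i <= B.

Lemma convergesD f g : converges f -> converges g -> converges (fun x => f x + g x).
Proof.
move=> [mf fi [l fl]] [mg gi [m gm]]; split.
- exact: measurable_funD.
- by near=> i; apply: rintegrableD; near: i.
- exists (l + m); apply: cvg_trans (cvgD fl gm); apply: near_eq_cvg.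
  near=> i; have h1 : rintegrable (P i) (fun w => f (Y i w)) by near: i.
  have h2 : rintegrable (P i) (fun w => g (Y i w)) by near: i.
  by rewrite /mean_of RintegralD.
Unshelve. all: by end_near. Qed.

Lemma convergesZ k g : converges g -> converges (fun x => k * g x).
Proof.
move=> [mg gi [m gm]]; split.
- exact: measurable_funM.
- by near=> i; apply: rintegrableZ; near: i.
- exists (k * m); apply: cvg_trans (cvgM (cvg_cst k) gm); apply: near_eq_cvg.
  near=> i; have h2 : rintegrable (P i) (fun w => g (Y i w)) by near: i.
  by rewrite /mean_of (RintegralZl k measurableT h2).
Unshelve. all: by end_near. Qed.

Lemma converges_sum (n : nat) (h : nat -> R -> R) :
  (forall k, converges (h k)) -> converges (fun=> 0) ->
  converges (fun x => \sum_(k < n) h k x).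
Proof.
move=> ch c0; elim: n => [|n IH].
  by rewrite (_ : (fun x => _) = (fun=> 0))//; apply/funext => x; rewrite big_ord0.
rewrite (_ : (fun x => _) = (fun x => \sum_(k < n) h k x + h n x)).
  exact: convergesD.
by apply/funext => x; rewrite big_ord_recr.
Qed.

(** The means of the weight are eventually bounded, so a small weighted uniform error gives a small
    error in the means, and completeness concludes. *)
Lemma converges_closed (g : R -> R) (K : R) : measurable_fun setT g ->
  (forall e, 0 < e -> exists2 p, converges p &
     forall x, `|g x - p x| <= e * expweight K x) ->
  converges g.
Proof.
move=> mg H; have [B HB] := bounded_expweight K.
have ig : \forall i \near F, rintegrable (P i) (fun w => g (Y i w)).
  have [p [mp pi_ _] gp] := H 1 ltr01.
  near=> i.
  have ip : rintegrable (P i) (fun w => p (Y i w)) by near: i.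
  have [iw _] : rintegrable (P i) (fun w => expweight K (Y i w)) /\
    mean_of (expweight K) i <= B by near: i.
  apply: (rintegrable_le _ _ (rintegrableD (integrable_norm ip) iw)).
    exact: measurableT_comp.
  move=> w /=; rewrite -[g _](subrK (p (Y i w))) addrC.
  by rewrite (le_trans (ler_normD _ _))// lerD2l -[leRHS]mul1r.
split => //; apply: cvg_of_approx => e e0.
have eB : 0 < e / (`|B| + 1) by rewrite divr_gt0// ltr_wpDl.
have [p [mp pi_ pl] gp] := H _ eB; exists (mean_of p) => //.
near=> i.
have iG : rintegrable (P i) (fun w => g (Y i w)) by near: i.
have ip : rintegrable (P i) (fun w => p (Y i w)) by near: i.
have [iw wB] : rintegrable (P i) (fun w => expweight K (Y i w)) /\
    mean_of (expweight K) i <= B by near: i.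
rewrite /mean_of -RintegralB//.
apply: (@le_trans _ _ (e / (`|B| + 1) * mean_of (expweight K) i)).
  rewrite /mean_of -(RintegralZl _ measurableT iw).
  apply: rintegral_norm_le; last exact: rintegrableZ.
    exact: rintegrable_measurable (rintegrableB iG ip).
  by move=> w; exact: gp.
rewrite mulrAC ler_pdivrMr ?ltr_wpDl// ler_pM2l//.
by rewrite (le_trans wB)// (le_trans (ler_norm B))// lerDl.
Unshelve. all: by end_near. Qed.

(* [x ^+ j * expR (th * x)] is differentiated in [th] by difference quotients. *)
Lemma converges_pow_of_exp : (forall th, converges (fun x => expR (th * x))) ->
  forall j, converges (fun x => x ^+ j).
Proof.
move=> He j.
suff : forall th, converges (fun x => x ^+ j * expR (th * x)).
  move=> /(_ 0); congr converges; apply/funext => x.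
  by rewrite mul0r expR0 mulr1.
elim: j => [|j IH] th.
  by have := He th; congr converges; apply/funext => x; rewrite mul1r.
apply: (@converges_closed _ (`|th| + 2)).
  apply: measurable_funM; first exact: exprn_measurable.
  apply: continuous_measurable_fun; apply: continuous_comp_real; last exact: continuous_expR.
  by move=> x; apply: cvgM; [exact: cvg_cst|exact: cvg_id].
move=> e e0; have f0 : 0 < j.+2`!%:R :> R by rewrite ltr0n fact_gt0.
(* Divided by [h], the Taylor remainder is [h * |x| ^ (j + 2)] times exponentials, and
   [|x| ^ (j + 2)] is at most [(j + 2)!] times [expR |x|]. As [h <= 1], the remainder brings one
   more [expR |x|]; these two account for the 2 in the weight. *)
pose h : R := Num.min 1 (e / j.+2`!%:R).
have h0 : 0 < h by rewrite lt_min ltr01 divr_gt0.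
have h1 : h <= 1 by rewrite ge_min lexx.
have he : h * j.+2`!%:R <= e by rewrite -ler_pdivlMr// ge_min lexx orbT.
exists (fun x => h^-1 * (x ^+ j * expR ((th + h) * x)) +
    (- h^-1) * (x ^+ j * expR (th * x))).
  by apply: convergesD; exact: convergesZ.
move=> x.
have -> : x ^+ j.+1 * expR (th * x) - (h^-1 * (x ^+ j * expR ((th + h) * x)) +
    - h^-1 * (x ^+ j * expR (th * x))) =
  - (h^-1 * (x ^+ j * expR (th * x)) * (expR (h * x) - 1 - h * x)).
  by rewrite mulrDl expRD exprS; field; rewrite gt_eqF.
rewrite normrN !normrM normfV (gtr0_norm h0) normrX (ger0_norm (expR_ge0 _)).
apply: (@le_trans _ _ (h^-1 * (`|x| ^+ j * expR (`|th| * `|x|)) *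
    (h ^+ 2 * `|x| ^+ 2 * expR `|x|))).
  apply: ler_pM => //.
  - by rewrite mulr_ge0 ?invr_ge0 ?(ltW h0)// mulr_ge0 ?exprn_ge0 ?expR_ge0.
  - rewrite ler_wpM2l ?invr_ge0 ?(ltW h0)// ler_wpM2l ?exprn_ge0// ler_expR.
    by rewrite (le_trans (ler_norm _))// normrM.
  - rewrite (le_trans (norm_expR_taylor1_le _))// exprMn [`|x| ^+ 2]real_normK ?num_real//.
    apply: ler_wpM2l; first by rewrite mulr_ge0 ?sqr_ge0.
    by rewrite ler_expR normrM (gtr0_norm h0) ler_piMl.
have -> : h^-1 * (`|x| ^+ j * expR (`|th| * `|x|)) * (h ^+ 2 * `|x| ^+ 2 * expR `|x|)
    = h * `|x| ^+ j.+2 * (expR (`|th| * `|x|) * expR `|x|).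
  by rewrite !exprS; field; rewrite gt_eqF.
apply: (@le_trans _ _ (h * (j.+2`!%:R * expR `|x|) * (expR (`|th| * `|x|) * expR `|x|))).
  rewrite ler_wpM2r ?mulr_ge0 ?expR_ge0// ler_wpM2l ?(ltW h0)//.
  exact: power_le_expR.
have -> : h * (j.+2`!%:R * expR `|x|) * (expR (`|th| * `|x|) * expR `|x|) =
    h * j.+2`!%:R * expR ((`|th| + 2) * `|x|).
  rewrite mulrDl expRD (_ : 2 * `|x| = `|x| + `|x|); last by ring.
  by rewrite expRD; ring.
rewrite ler_pM ?expR_ge0 ?expR_norm_le_expweight// mulr_ge0// ltW//.
Qed.

Section FromMoments.
Hypothesis converges_pow : forall j, converges (fun x => x ^+ j).

Let converges_cst c : converges (fun=> c).
Proof.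
have := convergesZ c (converges_pow 0); congr converges.
by apply/funext => x; rewrite expr0 mulr1.
Qed.

(** Truncating the power series after [N] terms leaves an error [2 ^ (- N) * expR (2 * |t| * |x|)],
    small for all [x] at once relative to the weight. *)
Lemma converges_entire (q : nat -> R) (L : R -> R) t : continuous L ->
  (forall n, `|q n| <= (n`!%:R)^-1) ->
  (forall y, series (fun n => q n * y ^+ n) @ \oo --> L y) ->
  converges (fun x => L (t * x)).
Proof.
move=> cL qb qL; apply: (@converges_closed _ (2 * `|t|)).
  apply: continuous_measurable_fun; apply: continuous_comp_real => // x.
  by apply: cvgM; [exact: cvg_cst|exact: cvg_id].
move=> e e0.
have [N HN] : exists N, (2^-1 : R) ^+ N <= e.
  exists (Num.truncn e^-1).+1; rewrite exprVn -[leRHS]invrK lef_pV2 ?posrE ?invr_gt0 ?exprn_gt0//.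
  apply: (@le_trans _ _ (Num.truncn e^-1).+1%:R); first exact/ltW/truncnS_gt.
  by rewrite -natrX ler_nat; exact/ltnW/ltn_expl.
exists (fun x => \sum_(k < N) (q k * t ^+ k) * x ^+ k).
  by apply: (@converges_sum N (fun k x => (q k * t ^+ k) * x ^+ k)) => // k;
    exact: convergesZ.
move=> x.
have -> : \sum_(k < N) (q k * t ^+ k) * x ^+ k = \sum_(k < N) q k * (t * x) ^+ k.
  by apply: eq_bigr => k _; rewrite exprMn mulrA.
rewrite (le_trans (power_series_tail N qb (qL _)))//.
rewrite normrM mulrA ler_pM ?expR_ge0 ?exprn_ge0 ?invr_ge0//.
exact: expR_norm_le_expweight.
Qed.

Let sign_bound (b : bool) (m n : nat) :
  `|(b%:R * (-1) ^+ m * (n`!%:R)^-1 : R)| <= (n`!%:R)^-1.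
Proof.
rewrite !normrM normfV normrX normrN1 expr1n mulr1 !normr_nat.
by case: b; rewrite ?mul1r ?mul0r// invr_ge0.
Qed.

Lemma converges_sin t : converges (fun x => sin (t * x)).
Proof.
apply: (@converges_entire (fun n => (odd n)%:R * (-1) ^+ n.-1./2 * (n`!%:R)^-1)).
- exact: continuous_sin.
- by move=> n; exact: sign_bound.
- move=> y; have := @is_cvg_series_sin_coeff R y.
  by rewrite sin_coeffE sinE.
Qed.

Lemma converges_cos t : converges (fun x => cos (t * x)).
Proof.
apply: (@converges_entire (fun n => (~~ odd n)%:R * (-1) ^+ n./2 * (n`!%:R)^-1)).
- exact: continuous_cos.
- by move=> n; exact: sign_bound.
- move=> y; have := @is_cvg_series_cos_coeff R y.
  by rewrite cos_coeffE cosE.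
Qed.

(** On [[-L, L]], [g] is a continuous function of [sin (x / L)], hence nearly a polynomial in it.
    Outside, the weight is so large that the crude bound [2 * M] is an acceptable error. *)
Theorem converges_bounded_continuous (g : R -> R) :
  bounded_continuous g -> converges g.
Proof.
move=> [cg [M gM]]; have M0 : 0 <= M by apply: le_trans (gM 0).
apply: (@converges_closed _ 1); first exact: continuous_measurable_fun.
(* Chosen so that [2 * M = e / 2 * (L - 1)], to be compared with [expR |x| >= 1 + |x|] for
   [|x| > L]. *)
move=> e e0; pose L := 4 * M / e + 1.
have L0 : 0 < L by rewrite ltr_wpDl// divr_ge0 ?(ltW e0)// mulr_ge0.
pose h v := g (L * clamp_asin v).
have ch : continuous h.
  apply: (@continuous_comp_real R g (fun v => L * clamp_asin v)) => // v.
  by apply: cvgM; [exact: cvg_cst|exact: continuous_clamp_asin].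
have e20 : 0 < e / 2 by rewrite divr_gt0.
have [p Hp] := weierstrass_approximation ch (fun v => gM _) e20.
exists (fun x => p.[sin (L^-1 * x)]).
  have -> : (fun x => p.[sin (L^-1 * x)]) =
      (fun x => (p - p.[0]%:P).[sin (L^-1 * x)] + p.[0]).
    by apply/funext => x; rewrite !hornerE subrK.
  apply: convergesD => //; apply: poly_sin_class.
  - exact: convergesD.
  - exact: convergesZ.
  - exact: converges_sin.
  - move=> s t; rewrite (_ : (fun x => _) =
      (fun x => cos (s * x) + (-1) * cos (t * x))).
      by apply: convergesD; [|apply: convergesZ]; exact: converges_cos.
    by apply/funext => x; rewrite mulN1r.
  - by rewrite !hornerE subrr.
move=> x; set s := sin _.
have {}Hp : `|p.[s] - h s| <= e / 2 by apply: Hp; rewrite sin_geN1 sin_le1.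
have [xL|xL] := leP `|x| L.
  have hE : h s = g x.
    rewrite /h /s clamp_asinK ?mulrA ?mulfV ?mul1r ?gt_eqF//.
    by rewrite normrM normfV (gtr0_norm L0) mulrC ler_pdivrMr// mul1r.
  rewrite distrC -hE (le_trans Hp)//.
  apply: (@le_trans _ _ (e * 1)); first by lra.
  by rewrite ler_pM2l// expweight_ge1.
have tail : 2 * M <= e / 2 * expweight 1 x.
  rewrite -ler_pdivrMl//; apply: le_trans (expR_norm_le_expweight 1 x).
  have -> : (e / 2)^-1 * (2 * M) = L - 1 by rewrite /L; field; rewrite gt_eqF.
  by rewrite mul1r; have := expR_ge1Dx `|x|; lra.
have -> : g x - p.[s] = (g x - h s) - (p.[s] - h s) by ring.
rewrite (le_trans (ler_normB _ _))//.
have b1 : `|g x - h s| <= 2 * M.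
  by rewrite (le_trans (ler_normB _ _))//; have := gM x; have := gM (L * clamp_asin s); rewrite /h; lra.
have b2 : e / 2 * 1 <= e / 2 * expweight 1 x by rewrite ler_pM2l// expweight_ge1.
by lra.
Qed.

End FromMoments.

End ExpectationClass.

(** * The limit law *)

Section Ramp.
Variable R : realType.
Implicit Types a b x : R.

Definition ramp a b x : R := Num.max 0 (Num.min 1 ((b - x) / (b - a))).

Lemma ramp_ge0 a b x : 0 <= ramp a b x.
Proof. by rewrite le_max lexx. Qed.

Lemma ramp_le1 a b x : ramp a b x <= 1.
Proof. by rewrite ge_max ler01 ge_min lexx. Qed.

Lemma ramp_left a b x : a < b -> x <= a -> ramp a b x = 1.
Proof.
move=> ab xa; rewrite /ramp min_l ?max_r ?ler01//.
by rewrite ler_pdivlMr ?subr_gt0// mul1r; lra.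
Qed.

Lemma ramp_right a b x : a < b -> b <= x -> ramp a b x = 0.
Proof.
move=> ab bx; have h : (b - x) / (b - a) <= 0.
  by rewrite ler_pdivrMr ?subr_gt0// mul0r subr_le0.
by rewrite /ramp min_r ?max_l// (le_trans h).
Qed.

Lemma continuous_ramp a b : continuous (ramp a b).
Proof.
move=> x; apply: (@continuous_max _ _ (cst 0) (fun x => Num.min 1 ((b - x) / (b - a)))).
  exact: cvg_cst.
apply: (@continuous_min _ _ (cst 1) (fun x => (b - x) / (b - a))).
  exact: cvg_cst.
by apply: cvgM; [apply: cvgB; [exact: cvg_cst|exact: cvg_id]|exact: cvg_cst].
Qed.

Lemma bounded_continuous_ramp a b : bounded_continuous (ramp a b).
Proof.
split; first exact: continuous_ramp.
by exists 1 => x; rewrite ger0_norm ?ramp_ge0// ramp_le1.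
Qed.

Lemma bounded_continuous_cst (c : R) : bounded_continuous (fun=> c).
Proof. by split; [move=> x; exact: cvg_cst|exists `|c|]. Qed.

Lemma bounded_continuousD (f g : R -> R) : bounded_continuous f ->
  bounded_continuous g -> bounded_continuous (fun x => f x + g x).
Proof.
move=> [cf [M fM]] [cg [N gN]]; split.
  by move=> x; apply: cvgD; [exact: cf|exact: cg].
by exists (M + N) => x; rewrite (le_trans (ler_normD _ _))// lerD.
Qed.

Lemma bounded_continuousZ (k : R) (g : R -> R) : bounded_continuous g ->
  bounded_continuous (fun x => k * g x).
Proof.
move=> [cg [M gM]]; split; first by move=> x; apply: cvgM; [exact: cvg_cst|exact: cg].
by exists (`|k| * M) => x; rewrite normrM ler_wpM2l.
Qed.

End Ramp.

(** * Positive functionals bracketed by a distribution function *)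

Section Functionals.
Variable R : realType.
Variable G : R -> R.

(* A positive normalized functional on bounded continuous functions, whose
   values on ramps are bracketed by the distribution function [G]. *)
Definition bracketed_functional (Phi : (R -> R) -> R) : Prop :=
  [/\ forall f g, bounded_continuous f -> bounded_continuous g ->
        Phi (fun x => f x + g x) = Phi f + Phi g,
      forall k g, bounded_continuous g -> Phi (fun x => k * g x) = k * Phi g,
      forall f g, bounded_continuous f -> bounded_continuous g ->
        (forall x, f x <= g x) -> Phi f <= Phi g,
      Phi (fun=> 1) = 1 &
      forall a b, a < b -> G a <= Phi (ramp a b) <= G b].

Variables (g : R -> R) (t : nat -> R).
Hypothesis tS : forall i, t i < t i.+1.

(** The piecewise linear interpolant of [g] at the nodes [t], constant beyond the extreme nodes,
    written after summation by parts so that a functional meets it only through ramps. *)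
Definition ramp_interpolant n x : R :=
  \sum_(i < n) (g (t i) - g (t i.+1)) * ramp (t i) (t i.+1) x + g (t n).

Lemma ramp_interpolantS n x : ramp_interpolant n.+1 x =
  ramp_interpolant n x + (g (t n) - g (t n.+1)) * (ramp (t n) (t n.+1) x - 1).
Proof. by rewrite /ramp_interpolant big_ord_recr /=; ring. Qed.

Lemma ramp_interpolant_right n x : t n <= x -> ramp_interpolant n x = g (t n).
Proof.
elim: n => [|n IH] tx; first by rewrite /ramp_interpolant big_ord0 add0r.
rewrite ramp_interpolantS IH ?(le_trans (ltW (tS n)) tx)//.
by rewrite ramp_right//; ring.
Qed.

Lemma ramp_interpolant_left n x : x <= t 0%N -> ramp_interpolant n x = g (t 0%N).
Proof.
have t0 m : t 0%N <= t m by elim: m => // m IH; rewrite (le_trans IH)// ltW.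
move=> xt; elim: n => [|n IH]; first by rewrite /ramp_interpolant big_ord0 add0r.
by rewrite ramp_interpolantS IH ramp_left ?(le_trans xt)//; ring.
Qed.

Lemma ramp_interpolant_mid n x (e : R) : 0 <= e -> t 0%N <= x <= t n ->
  (forall i y, (i < n)%N -> t i <= y <= t i.+1 ->
    `|g y - g (t i)| <= e /\ `|g y - g (t i.+1)| <= e) ->
  `|g x - ramp_interpolant n x| <= e.
Proof.
move=> e0; elim: n => [|n IH] /andP[tx xt] H.
  have -> : x = t 0%N by apply/eqP; rewrite eq_le tx xt.
  by rewrite ramp_interpolant_right// subrr normr0.
have [xn|nx] := leP x (t n).
  rewrite ramp_interpolantS ramp_left// subrr mulr0 addr0 IH ?tx// => i y ni.
  by apply: H; rewrite ltnS ltnW.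
rewrite ramp_interpolantS (ramp_interpolant_right (ltW nx)).
have tnx : t n <= x <= t n.+1 by rewrite ltW.
have [h1 h2] := H n x (ltnSn n) tnx.
set r := ramp _ _ x.
have -> : g x - (g (t n) + (g (t n) - g (t n.+1)) * (r - 1)) =
  r * (g x - g (t n)) + (1 - r) * (g x - g (t n.+1)) by ring.
apply: (le_trans (ler_normD _ _)); rewrite !normrM.
have r0 : 0 <= r by exact: ramp_ge0.
have r1 : r <= 1 by exact: ramp_le1.
rewrite (ger0_norm r0) (@ger0_norm _ (1 - r)) ?subr_ge0//.
have : r * `|g x - g (t n)| <= r * e by rewrite ler_wpM2l.
have : (1 - r) * `|g x - g (t n.+1)| <= (1 - r) * e by rewrite ler_wpM2l// subr_ge0.
by lra.
Qed.

Lemma bounded_continuous_interpolant n : bounded_continuous (ramp_interpolant n).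
Proof.
elim: n => [|n IH].
  rewrite (_ : ramp_interpolant 0 = fun=> g (t 0%N)).
    exact: bounded_continuous_cst.
  by apply/funext => x; rewrite /ramp_interpolant big_ord0 add0r.
rewrite (_ : ramp_interpolant n.+1 = fun x => ramp_interpolant n x +
    ((g (t n) - g (t n.+1)) * ramp (t n) (t n.+1) x + (g (t n.+1) - g (t n)))).
  apply: bounded_continuousD => //; apply: bounded_continuousD.
    by apply: bounded_continuousZ; exact: bounded_continuous_ramp.
  exact: bounded_continuous_cst.
by apply/funext => x; rewrite ramp_interpolantS; ring.
Qed.

Lemma bracketed_functional_cst Phi c : bracketed_functional Phi ->
  Phi (fun=> c) = c.
Proof.
move=> [_ PZ _ P1 _].
have := PZ c _ (bounded_continuous_cst (1 : R)); rewrite P1 mulr1 => h.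
by rewrite -[RHS]h; congr Phi; apply/funext => x; rewrite mulr1.
Qed.

(** Both values on the ramp from [t i] to [t i.+1] lie between [G (t i)] and [G (t i.+1)]. Each ramp
    thus contributes at most [e] times that increment of [G], and the increments telescope. *)
Lemma bracketed_functional_interpolant Phi Psi n (e : R) :
  bracketed_functional Phi -> bracketed_functional Psi ->
  (forall i, (i < n)%N -> `|g (t i) - g (t i.+1)| <= e) -> 0 <= e ->
  `|Phi (ramp_interpolant n) - Psi (ramp_interpolant n)| <= e * (G (t n) - G (t 0%N)).
Proof.
move=> bP bQ H e0.
have [PD PZ Ple P1 Pr] := bP; have [QD QZ Qle Q1 Qr] := bQ.
elim: n H => [|n IH] H.
  have E : ramp_interpolant 0 = fun=> g (t 0%N).
    by apply/funext => x; rewrite /ramp_interpolant big_ord0 add0r.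
  by rewrite !E !bracketed_functional_cst// !subrr mulr0 normr0.
have brr := bounded_continuous_ramp (t n) (t n.+1).
have bri := bounded_continuous_interpolant n.
have bc := bounded_continuous_cst (g (t n.+1) - g (t n)).
have E Xi : bracketed_functional Xi -> Xi (ramp_interpolant n.+1) =
    Xi (ramp_interpolant n) + ((g (t n) - g (t n.+1)) * Xi (ramp (t n) (t n.+1)) +
      (g (t n.+1) - g (t n))).
  move=> bX; have [XD XZ _ _ _] := bX.
  rewrite -XZ// -[X in _ = _ + (_ + X)](bracketed_functional_cst (g (t n.+1) - g (t n)) bX).
  rewrite -XD//; last exact: bounded_continuousZ.
  rewrite -XD//; last by apply: bounded_continuousD => //; exact: bounded_continuousZ.
  by congr Xi; apply/funext => x; rewrite ramp_interpolantS; ring.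
rewrite !E//.
have {}IH := IH (fun i ni => H i (ltnW ni)).
have /andP[p1 p2] := Pr _ _ (tS n); have /andP[q1 q2] := Qr _ _ (tS n).
set u := Phi (ramp_interpolant n) in IH *; set v := Psi (ramp_interpolant n) in IH *.
set p := Phi _ in p1 p2 *; set q := Psi _ in q1 q2 *.
have -> : u + ((g (t n) - g (t n.+1)) * p + (g (t n.+1) - g (t n))) -
    (v + ((g (t n) - g (t n.+1)) * q + (g (t n.+1) - g (t n)))) =
    (u - v) + (g (t n) - g (t n.+1)) * (p - q) by ring.
rewrite (le_trans (ler_normD _ _))//.
have : `|(g (t n) - g (t n.+1)) * (p - q)| <= e * (G (t n.+1) - G (t n)).
  rewrite normrM ler_pM ?H// ler_norml.
  by apply/andP; split; lra.
by lra.
Qed.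

End Functionals.

Section FunctionalUniqueness.
Variable R : realType.
Variable G : R -> R.
Hypothesis Gtail : forall e : R, 0 < e -> exists A : R, [/\ 0 < A, G (- A) <= e & 1 - e <= G A].

Theorem bracketed_functional_unique Phi Psi (g : R -> R) :
  bracketed_functional G Phi -> bracketed_functional G Psi ->
  bounded_continuous g -> Phi g = Psi g.
Proof.
move=> bP bQ bg; have [cg [B gB]] := bg.
have B0 : 0 <= B by apply: le_trans (gB 0).
have G01 x : 0 <= G x <= 1.
  have [_ _ Ple P1 Pr] := bP.
  have xl : x - 1 < x by rewrite gtrBl.
  have xr : x < x + 1 by rewrite ltrDl.
  apply/andP; split.
    have /andP[_] := Pr _ _ xl; apply: le_trans.
    rewrite -(bracketed_functional_cst 0 bP); apply: Ple.
    - exact: bounded_continuous_cst.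
    - exact: bounded_continuous_ramp.
    - by move=> y; exact: ramp_ge0.
  have /andP[+ _] := Pr _ _ xr; move=> /le_trans; apply.
  rewrite -P1; apply: Ple.
  - exact: bounded_continuous_ramp.
  - exact: bounded_continuous_cst.
  - by move=> y; exact: ramp_le1.
(* Replacing [g] by its interpolant costs [e + 4 * B * e] for each functional, and comparing them on
   the interpolant costs [e]. *)
suff key e : 0 < e -> `|Phi g - Psi g| <= (3 + 8 * B) * e.
  apply/eqP; rewrite -subr_eq0 -normr_le0; apply/ler_addgt0Pr => e e0.
  have K0 : 0 < 3 + 8 * B by rewrite ltr_pwDl// mulr_ge0.
  rewrite add0r; have := key (e / (3 + 8 * B)).
  by rewrite (mulrC (3 + 8 * B)) divfK ?gt_eqF// divr_gt0// => /(_ isT).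
move=> e0; have [A [A0 GA1 GA2]] := Gtail e0.
have [d d0 Hd] := segment_uniform_continuity (- (A + 1)) (A + 1) cg e0.
pose n := (Num.truncn (2 * (A + 1) / d)).+1.
have n0 : 0 < n%:R :> R by rewrite ltr0n.
pose del := 2 * (A + 1) / n%:R.
have del0 : 0 < del by rewrite divr_gt0//; lra.
have deld : del < d.
  by rewrite /del ltr_pdivrMr// [ltRHS]mulrC -ltr_pdivrMr//; exact: truncnS_gt.
pose t (i : nat) := - (A + 1) + i%:R * del.
have tS i : t i < t i.+1 by rewrite /t ltrD2l ltr_pM2r// ltr_nat.
have t0 : t 0%N = - (A + 1) by rewrite /t mul0r addr0.
have tn : t n = A + 1.
  rewrite /t /del mulrC divfK ?gt_eqF//; ring.
have tin i : (i <= n)%N -> - (A + 1) <= t i <= A + 1.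
  move=> ni; apply/andP; split; first by rewrite lerDl mulr_ge0// ltW.
  by rewrite -[leRHS]tn lerD2l ler_wpM2r ?ler_nat ?(ltW del0).
have osc i y : (i < n)%N -> t i <= y <= t i.+1 ->
    `|g y - g (t i)| <= e /\ `|g y - g (t i.+1)| <= e.
  move=> ni /andP[h1 h2]; have tSE : t i.+1 = t i + del.
    by rewrite /t -natr1; ring.
  split; rewrite distrC ltW// Hd ?tin ?(ltnW ni)//.
    by rewrite ler0_norm; lra.
  by rewrite ger0_norm; lra.
pose s := ramp_interpolant g t n.
have bs : bounded_continuous s by exact: bounded_continuous_interpolant.
(* A continuous tail function: zero on [[-A, A]] and at least 1 where [|x| >= A + 1]. Bracketing
   gives it a value of at most [1 - G A + G (- A) <= 2 * e]. *)
pose tau x := (1 + (-1) * ramp A (A + 1) x) + ramp (- (A + 1)) (- A) x.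
have btau : bounded_continuous tau.
  apply: bounded_continuousD; last exact: bounded_continuous_ramp.
  apply: bounded_continuousD; first exact: bounded_continuous_cst.
  by apply: bounded_continuousZ; exact: bounded_continuous_ramp.
have AA : A < A + 1 by rewrite ltrDl.
have AN : - (A + 1) < - A by rewrite ltrN2.
have tau0 x : 0 <= tau x.
  by rewrite /tau; have := ramp_le1 A (A + 1) x; have := ramp_ge0 (- (A + 1)) (- A) x; lra.
have gs x : `|g x - s x| <= e + 2 * B * tau x.
  have [xl|lx] := leP x (- (A + 1)).
    have : 1 <= tau x.
      by rewrite /tau [X in _ + X]ramp_left//; have := ramp_le1 A (A + 1) x; lra.
    move=> h; have h2 : 2 * B * 1 <= 2 * B * tau x by rewrite ler_wpM2l// mulr_ge0.
    rewrite /s ramp_interpolant_left ?t0// (le_trans (ler_normB _ _))//.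
    by have := gB x; have := gB (t 0%N); rewrite t0; lra.
  have [xr|rx] := leP (A + 1) x.
    have : 1 <= tau x.
      rewrite /tau [X in 1 + (-1) * X]ramp_right// mulr0 addr0 lerDl.
      exact: ramp_ge0.
    move=> h; have h2 : 2 * B * 1 <= 2 * B * tau x by rewrite ler_wpM2l// mulr_ge0.
    rewrite /s ramp_interpolant_right ?tn// (le_trans (ler_normB _ _))//.
    by have := gB x; have := gB (t n); rewrite tn; lra.
  apply: ler_wpDr; first by rewrite mulr_ge0// mulr_ge0.
  by apply: ramp_interpolant_mid => //; rewrite ?t0 ?tn !ltW.
have close Xi : bracketed_functional G Xi -> `|Xi g - Xi s| <= e + 4 * B * e.
  move=> bX; have [XD XZ Xle X1 Xr] := bX.
  have bm : bounded_continuous (fun x => e + 2 * B * tau x).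
    apply: bounded_continuousD; first exact: bounded_continuous_cst.
    exact: bounded_continuousZ.
  have Xtau : Xi tau <= 2 * e.
    rewrite /tau XD; last 2 first.
    - apply: bounded_continuousD; first exact: bounded_continuous_cst.
      by apply: bounded_continuousZ; exact: bounded_continuous_ramp.
    - exact: bounded_continuous_ramp.
    rewrite XD; last 2 first.
    - exact: bounded_continuous_cst.
    - by apply: bounded_continuousZ; exact: bounded_continuous_ramp.
    rewrite X1 XZ; last exact: bounded_continuous_ramp.
    by have /andP[? _] := Xr _ _ AA; have /andP[_ ?] := Xr _ _ AN; lra.
  have Xm : Xi (fun x => e + 2 * B * tau x) <= e + 4 * B * e.
    rewrite XD; [|exact: bounded_continuous_cst|exact: bounded_continuousZ].
    rewrite XZ// (bracketed_functional_cst e bX) lerD2l.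
    have : 2 * B * Xi tau <= 2 * B * (2 * e) by rewrite ler_wpM2l// mulr_ge0.
    by lra.
  have bgs : bounded_continuous (fun x => g x + (-1) * s x).
    by apply: bounded_continuousD => //; exact: bounded_continuousZ.
  have E1 : Xi (fun x => g x + (-1) * s x) = Xi g - Xi s.
    by rewrite XD// ?XZ ?mulN1r//; exact: bounded_continuousZ.
  have bsg : bounded_continuous (fun x => s x + (-1) * g x).
    by apply: bounded_continuousD => //; exact: bounded_continuousZ.
  have E2 : Xi (fun x => s x + (-1) * g x) = Xi s - Xi g.
    by rewrite XD// ?XZ ?mulN1r//; exact: bounded_continuousZ.
  rewrite ler_norml.
  have h1 : Xi (fun x => g x + (-1) * s x) <= e + 4 * B * e.
    apply: le_trans Xm; apply: Xle => // x.
    by rewrite mulN1r (le_trans (ler_norm _)).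
  have h2 : Xi (fun x => s x + (-1) * g x) <= e + 4 * B * e.
    apply: le_trans Xm; apply: Xle => // x.
    by rewrite mulN1r (le_trans (ler_norm _))// distrC.
  by move: h1 h2; rewrite E1 E2 => h1 h2; apply/andP; split; lra.
have oscS i : (i < n)%N -> `|g (t i) - g (t i.+1)| <= e.
  move=> ni; have tt : t i <= t i <= t i.+1 by rewrite lexx ltW.
  exact: (osc i (t i) ni tt).2.
have mid := bracketed_functional_interpolant tS bP bQ oscS (ltW e0).
have Gb : e * (G (t n) - G (t 0%N)) <= e * 1.
  by rewrite ler_pM2l//; have /andP[? ?] := G01 (t n); have /andP[? ?] := G01 (t 0%N); lra.
have h1 := close _ bP; have h2 := close _ bQ.
have -> : Phi g - Psi g = (Phi g - Phi s) + (Phi s - Psi s) - (Psi g - Psi s) by ring.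
rewrite (le_trans (ler_normB _ _))//.
have := ler_normD (Phi g - Phi s) (Phi s - Psi s).
by move: mid; rewrite -/s; lra.
Qed.

End FunctionalUniqueness.

Section ProbabilityOfCdf.
Variable R : realType.
Variable G : R -> R.
Hypothesis G_nd : nondecreasing G.
Hypothesis G_rc : right_continuous G.
Hypothesis G_Ny : G @ -oo --> (0 : R).
Hypothesis G_y : G @ +oo --> (1 : R).

#[local] HB.instance Definition _ := isCumulative.Build R _ R G G_nd G_rc.
#[local] HB.instance Definition _ := isCumulativeBounded.Build R 0 1 G G_Ny G_y.

Lemma exists_probability_cdf :
  exists mu : probability R R, forall a, mu `]-oo, a]%classic = (G a)%:E.
Proof.
pose ls := lebesgue_stieltjes_measure G.
(* [measurableTypeR R] and [R] have the same measurable sets but different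
   displays; the pushforward along the identity bridges them. *)
pose idR : measurableTypeR R -> R := idfun.
have mid : measurable_fun setT idR by move=> _ A mA; rewrite setTI.
pose X : {mfun measurableTypeR R >-> R} := mfun_Sub (mem_set mid).
exists (distribution ls X) => a.
by rewrite -(cdf_lebesgue_stieltjes_id G a).
Qed.

End ProbabilityOfCdf.

Section RampInequalities.
Variable R : realType.
Implicit Types a b c x : R.

Lemma ramp_le_ramp a b c x : a < b -> b < c -> ramp a b x <= ramp b c x.
Proof.
move=> ab bc; have [xb|bx] := leP x b.
  by rewrite [leRHS]ramp_left// ramp_le1.
by rewrite ramp_right ?ramp_ge0// ltW.
Qed.

Lemma ramp_mid a b x : a < b -> a <= x <= b -> ramp a b x = (b - x) / (b - a).
Proof.
move=> ab /andP[ax xb]; have ba : 0 < b - a by rewrite subr_gt0.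
rewrite /ramp min_r ?max_r//.
  by rewrite divr_ge0 ?(ltW ba)// subr_ge0.
by rewrite ler_pdivrMr// mul1r lerD2l lerN2.
Qed.

(** Source of right continuity for the distribution function: moving the left end of a ramp slightly
    to the right raises it only slightly, uniformly in [x]. *)
Lemma ramp_shift_le a a' b x : a <= a' -> a' < b ->
  ramp a' b x <= ramp a b x + (a' - a) / (b - a).
Proof.
move=> aa' a'b; have ab : a < b by exact: le_lt_trans a'b.
have ba : 0 < b - a by rewrite subr_gt0.
have ba' : 0 < b - a' by rewrite subr_gt0.
have q0 : 0 <= (a' - a) / (b - a) by rewrite divr_ge0 ?subr_ge0// ltW.
have [xa|ax] := leP x a.
  by rewrite [in leRHS]ramp_left// (le_trans (ramp_le1 _ _ _))// lerDl.
have [bx|xb] := leP b x.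
  by rewrite ramp_right// addr_ge0 ?ramp_ge0.
rewrite (@ramp_mid a b) ?(ltW ax) ?(ltW xb)// -mulrDl.
have [xa'|a'x] := leP x a'.
  by apply: le_trans (ramp_le1 _ _ _) _; rewrite ler_pdivlMr//; lra.
rewrite ramp_mid ?(ltW a'x) ?(ltW xb)// ler_pdivlMr// mulrAC ler_pdivrMr//.
have : 0 <= (a' - a) * (x - a') by rewrite mulr_ge0; lra.
nra.
Qed.

End RampInequalities.

Section RieszRepresentation.
Variable R : realType.

Lemma rintegral_bracketed (mu : probability R R) :
  bracketed_functional (fun a => fine (mu `]-oo, a]%classic)) (Rintegral mu setT).
Proof.
have ib g : bounded_continuous g -> rintegrable mu g.
  move=> [cg [M gM]]; apply: rintegrable_bounded gM.
  exact: continuous_measurable_fun.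
have mI (a : R) : measurable (`]-oo, a]%classic : set R) by exact: measurable_itv.
have ii a : rintegrable mu (\1_(`]-oo, a]%classic) : R -> R).
  apply: (@rintegrable_bounded _ _ _ _ _ 1); first exact: measurable_indic.
  by move=> x; rewrite indicE; case: (_ \in _); rewrite ?normr1 ?normr0.
split.
- by move=> f g bf bg; rewrite RintegralD//; exact: ib.
- by move=> k g bg; rewrite RintegralZl//; exact: ib.
- by move=> f g bf bg fg; apply: rintegral_le => //; exact: ib.
- by rewrite rintegral_cst.
- move=> a b ab; have ir := ib _ (bounded_continuous_ramp a b).
  rewrite -!rintegral_indic//; apply/andP; split; apply: rintegral_le => // x.
  + rewrite indicE; case: (boolP (_ \in _)); rewrite ?ramp_ge0//.
    by rewrite inE/= in_itv/= => xa; rewrite ramp_left.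
  + rewrite indicE; case: (boolP (_ \in _)); rewrite ?ramp_le1//.
    rewrite notin_setE/= in_itv/= => /negP; rewrite -ltNge => bx.
    by rewrite ramp_right// ltW.
Qed.

Variable Phi : (R -> R) -> R.
Hypothesis PhiD : forall f g, bounded_continuous f -> bounded_continuous g ->
  Phi (fun x => f x + g x) = Phi f + Phi g.
Hypothesis PhiZ : forall k g, bounded_continuous g ->
  Phi (fun x => k * g x) = k * Phi g.
Hypothesis Phi_le : forall f g, bounded_continuous f -> bounded_continuous g ->
  (forall x, f x <= g x) -> Phi f <= Phi g.
Hypothesis Phi1 : Phi (fun=> 1) = 1.
Hypothesis Phi_tight : forall e : R, 0 < e -> exists A : R,
  Phi (ramp (- A) (- A + 1)) <= e /\ 1 - e <= Phi (ramp (A - 1) A).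

(** If [Phi] is integration against a probability this is its distribution function, since the ramps
    from [a] to [b] decrease to the indicator of []-oo, a]] as [b] falls to [a]. *)
Let G (a : R) : R := inf [set Phi (ramp a b) | b in `]a, +oo[%classic].

Let Phi_cst k : Phi (fun=> k) = k.
Proof.
rewrite -[RHS]mulr1 -[X in _ = _ * X]Phi1 -PhiZ; last exact: bounded_continuous_cst.
by congr Phi; apply/funext => x; rewrite mulr1.
Qed.

Let Phi_ramp_ge0 a b : 0 <= Phi (ramp a b).
Proof.
rewrite -(Phi_cst 0).
apply: Phi_le; [exact: bounded_continuous_cst|exact: bounded_continuous_ramp|].
by move=> x; exact: ramp_ge0.
Qed.

Let Phi_ramp_le1 a b : Phi (ramp a b) <= 1.
Proof.
rewrite -Phi1; apply: Phi_le; [exact: bounded_continuous_ramp|exact: bounded_continuous_cst|].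
by move=> x; exact: ramp_le1.
Qed.

Let G_inf a : has_inf [set Phi (ramp a b) | b in `]a, +oo[%classic].
Proof.
split; first by exists (Phi (ramp a (a + 1))), (a + 1) => //=; rewrite in_itv/= andbT ltrDl.
by exists 0 => _ [b _ <-]; exact: Phi_ramp_ge0.
Qed.

Let G_le_ramp a b : a < b -> G a <= Phi (ramp a b).
Proof.
move=> ab; apply: ge_inf; first by have [] := G_inf a.
by exists b => //=; rewrite in_itv/= ab.
Qed.

Let ramp_le_G a b : a < b -> Phi (ramp a b) <= G b.
Proof.
move=> ab; apply: lb_le_inf; first by have [] := G_inf b.
move=> x [c +] <-; rewrite /= in_itv/= andbT => bc.
apply: Phi_le; [exact: bounded_continuous_ramp|exact: bounded_continuous_ramp|].
by move=> y; exact: ramp_le_ramp.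
Qed.

Let G_nd : nondecreasing G.
Proof.
move=> a b; rewrite le_eqVlt => /orP[/eqP->//|ab].
exact: le_trans (G_le_ramp ab) (ramp_le_G ab).
Qed.

Let G_rc : right_continuous G.
Proof.
move=> a; apply/cvgrPdist_le => e e0.
have e2 : 0 < e / 2 by rewrite divr_gt0.
have [_ [b /= + <-]] := inf_adherent e2 (G_inf a).
rewrite in_itv/= andbT -/(G a) => ab Gb.
have ba : 0 < b - a by rewrite subr_gt0.
have u0 : 0 < Num.min (b - a) (e / 2 * (b - a)) by rewrite lt_min ba mulr_gt0.
near=> x.
have ax : a < x by near: x; exact: nbhs_right_gt.
have : x < a + Num.min (b - a) (e / 2 * (b - a)).
  by near: x; apply: nbhs_right_lt; rewrite ltrDl.
rewrite -ltrBlDl lt_min => /andP[xb xe].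
have {}xb : x < b by lra.
have Gax : G a <= G x by apply: G_nd; exact: ltW.
have Gx : G x <= Phi (ramp a b) + (x - a) / (b - a).
  apply: le_trans (G_le_ramp xb) _.
  rewrite -(Phi_cst ((x - a) / (b - a))) -PhiD; [|exact: bounded_continuous_ramp|
    exact: bounded_continuous_cst].
  apply: Phi_le; first exact: bounded_continuous_ramp.
    apply: bounded_continuousD; first exact: bounded_continuous_ramp.
    exact: bounded_continuous_cst.
  by move=> y; apply: ramp_shift_le => //; exact: ltW.
have : (x - a) / (b - a) <= e / 2 by rewrite ler_pdivrMr// ltW.
by rewrite distrC ger0_norm ?subr_ge0//; lra.
Unshelve. all: by end_near. Qed.

Let G_tail (e : R) : 0 < e -> exists A : R, [/\ 0 < A, G (- A) <= e & 1 - e <= G A].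
Proof.
move=> e0; have [A [h1 h2]] := Phi_tight e0.
have A1 : - A < - A + 1 by rewrite ltrDl.
have A2 : A - 1 < A by rewrite gtrBl.
have AM : A <= Num.max A 1 by rewrite le_max lexx.
exists (Num.max A 1); split; first by rewrite lt_max ltr01 orbT.
- apply: le_trans h1; apply: le_trans (G_le_ramp A1).
  by apply: G_nd; rewrite lerN2.
- by apply: le_trans h2 _; apply: le_trans (ramp_le_G A2) _; exact: G_nd.
Qed.

Let G_ge0 a : 0 <= G a.
Proof.
apply: lb_le_inf; first by have [] := G_inf a.
by move=> _ [c _ <-]; exact: Phi_ramp_ge0.
Qed.

Let G_le1 a : G a <= 1.
Proof.
have a1 : a < a + 1 by rewrite ltrDl.
by apply: le_trans (G_le_ramp a1) _; exact: Phi_ramp_le1.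
Qed.

Let G_Ny : G @ -oo --> (0 : R).
Proof.
apply/cvgrPdist_le => e e0; have [A [A0 h1 h2]] := G_tail e0.
near=> x; rewrite sub0r normrN ger0_norm//; apply: le_trans h1.
by apply: G_nd; near: x; apply: nbhs_ninfty_le; rewrite num_real.
Unshelve. all: by end_near. Qed.

Let G_y : G @ +oo --> (1 : R).
Proof.
apply/cvgrPdist_le => e e0; have [A [A0 h1 h2]] := G_tail e0.
near=> x; rewrite ger0_norm ?subr_ge0// lerBlDl -lerBlDr; apply: le_trans h2 _.
by apply: G_nd; near: x; apply: nbhs_pinfty_ge; rewrite num_real.
Unshelve. all: by end_near. Qed.

(** [Phi] and integration against the measure with distribution function [G] are bracketed by the
    same [G], so they agree. Tightness prevents mass from escaping to infinity. *)
Theorem functional_representation : exists mu : probability R R,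
  forall g, bounded_continuous g -> Rintegral mu setT g = Phi g.
Proof.
have [mu muG] := exists_probability_cdf G_nd G_rc G_Ny G_y.
exists mu => g bg; apply: (bracketed_functional_unique G_tail) => //.
  have -> : G = fun a => fine (mu `]-oo, a]%classic) by apply/funext => a; rewrite muG.
  exact: rintegral_bracketed.
by split => // a b ab; rewrite G_le_ramp// ramp_le_G.
Qed.

End RieszRepresentation.

Lemma rintegrable_monotone_limit {d} {T : measurableType d} {R : realType}
    (mu : {measure set T -> \bar R}) (f_ : nat -> T -> R) f (M : R) :
  (forall n, rintegrable mu (f_ n)) -> (forall n x, 0 <= f_ n x) ->
  (forall n x, f_ n x <= f_ n.+1 x) ->
  (forall x, f_ n x @[n --> \oo] --> f x) ->
  (forall n, Rintegral mu setT (f_ n) <= M) ->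
  rintegrable mu f.
Proof.
move=> fi f0 fS fl fM.
have nd x m n : (m <= n)%N -> f_ m x <= f_ n x.
  by move=> mn; apply: (homo_leq (@lexx _ _) le_trans (fun k => fS k x)).
have mE n : measurable_fun setT (fun x => (f_ n x)%:E).
  exact/measurable_EFinP/rintegrable_measurable/fi.
have ndE x : setT x -> {homo (fun n => (f_ n x)%:E) : m n / (m <= n)%N >-> (m <= n)%E}.
  by move=> _ m n mn; rewrite lee_fin nd.
have limE x : limn (fun n => (f_ n x)%:E) = (f x)%:E.
  by apply/cvg_lim => //; apply: cvg_EFin; [exact: nearW|exact: fl].
have mf : measurable_fun setT f.
  apply: (measurable_fun_cvg (fun n => rintegrable_measurable (fi n))) => x _.
  exact: fl.
apply/integrableP; split; first exact/measurable_EFinP.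
have f0' x : 0 <= f x.
  have := fl x; move=> /cvg_lim <- //; apply: limr_ge; last exact: nearW.
  by apply/cvg_ex; exists (f x).
under eq_integral do rewrite /= ger0_norm//.
have lim := @cvg_monotone_convergence _ _ _ mu _ measurableT _ mE
  (fun n x _ => f0 n x) ndE.
rewrite (@le_lt_trans _ _ M%:E) ?ltry//.
have -> : (\int[mu]_x (f x)%:E = \int[mu]_x limn (fun n => (f_ n x)%:E))%E.
  by apply: eq_integral => x _; rewrite limE.
move/cvg_lim : lim => <- //; apply: lime_le.
  apply: ereal_nondecreasing_is_cvgn => m n mn.
  by apply: ge0_le_integral => // x _; rewrite lee_fin ?f0 ?nd.
apply: nearW => n; have fin := integrable_fin_num measurableT (fi n).
by rewrite -[X in (X <= _)%E](fineK fin) lee_fin fM.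
Qed.

(** * The limit law from convergent moment generating functions *)

Section LimitLaw.
Context {d : measure_display} {T : measurableType d} {R : realType}.
Context {I : Type} {F : set_system I} {FF : ProperFilter F}.
Variables (P : I -> probability T R) (Y : I -> T -> R).
Hypothesis mY : forall i, measurable_fun setT (Y i).
Variable M : R -> R.
Hypothesis rintegrable_exp : \forall i \near F, forall th,
  rintegrable (P i) (fun w => expR (th * Y i w)).
Hypothesis mgf_cvg : forall th,
  mean_of P Y (fun x => expR (th * x)) i @[i --> F] --> M th.

Let continuous_expR_scale (th : R) : continuous (fun x => expR (th * x)).
Proof.
apply: continuous_comp_real; last exact: continuous_expR.
by move=> x; apply: cvgM; [exact: cvg_cst|exact: cvg_id].
Qed.

Let mgf_bounded (K : R) : exists B : R, \forall i \near F,
  rintegrable (P i) (fun w => expweight K (Y i w)) /\ mean_of P Y (expweight K) i <= B.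
Proof.
exists (M K + M (- K) + 2).
have /cvgrPdist_le /(_ _ ltr01) h1 := @mgf_cvg K.
have /cvgrPdist_le /(_ _ ltr01) h2 := @mgf_cvg (- K).
near=> i.
have e1 : `|M K - mean_of P Y (fun x => expR (K * x)) i| <= 1 by near: i.
have e2 : `|M (- K) - mean_of P Y (fun x => expR (- K * x)) i| <= 1 by near: i.
have ie : forall th, rintegrable (P i) (fun w => expR (th * Y i w)) by near: i.
have i1 := ie K; have i2 := ie (- K).
split; first exact: rintegrableD.
rewrite /mean_of /expweight RintegralD//.
by move: e1 e2; rewrite !ler_norml /mean_of => /andP[? ?] /andP[? ?]; lra.
Unshelve. all: by end_near. Qed.

Lemma converges_bounded_continuous_of_mgf (g : R -> R) : bounded_continuous g ->
  converges (F := F) P Y g.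
Proof.
apply: converges_bounded_continuous => //.
apply: converges_pow_of_exp => // th; split.
- exact: continuous_measurable_fun (@continuous_expR_scale th).
- by near=> i; have ie : forall th, rintegrable (P i) (fun w => expR (th * Y i w));
    [near: i|exact: ie].
- by exists (M th); exact: mgf_cvg.
Unshelve. all: by end_near. Qed.

Let Lam (g : R -> R) : R := lim (mean_of P Y g i @[i --> F]).

Let Lam_cvg g : bounded_continuous g -> mean_of P Y g i @[i --> F] --> Lam g.
Proof.
move=> bg; have [_ _ [l hl]] := converges_bounded_continuous_of_mgf bg.
by rewrite /Lam (cvg_lim _ hl).
Qed.

Let rintegrable_bc g i : bounded_continuous g ->
  rintegrable (P i) (fun w => g (Y i w)).
Proof.
move=> [cg [B gB]]; apply: (@rintegrable_bounded _ _ _ _ _ B) => //.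
exact: measurable_comp_continuous.
Qed.

Let LamD f g : bounded_continuous f -> bounded_continuous g ->
  Lam (fun x => f x + g x) = Lam f + Lam g.
Proof.
move=> bf bg; apply/cvg_lim => //.
rewrite [X in X @ _](_ : _ = fun i => mean_of P Y f i + mean_of P Y g i).
  by apply: cvgD; exact: Lam_cvg.
by apply/funext => i; rewrite /mean_of RintegralD//; exact: rintegrable_bc.
Qed.

Let LamZ k g : bounded_continuous g -> Lam (fun x => k * g x) = k * Lam g.
Proof.
move=> bg; apply/cvg_lim => //.
rewrite [X in X @ _](_ : _ = fun i => k * mean_of P Y g i).
  by apply: cvgM; [exact: cvg_cst|exact: Lam_cvg].
apply/funext => i; have ig := rintegrable_bc i bg.
by rewrite /mean_of (RintegralZl k measurableT ig).
Qed.

Let Lam_le_near f (l : R) (h : R -> R) : bounded_continuous f ->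
  mean_of P Y h i @[i --> F] --> l ->
  (\forall i \near F, rintegrable (P i) (fun w => h (Y i w))) ->
  (forall x, f x <= h x) -> Lam f <= l.
Proof.
move=> bf hl hi fh; rewrite -subr_ge0.
apply: (cvgr_to_ge (cvgB hl (Lam_cvg bf))).
near=> i; rewrite subr_ge0; apply: rintegral_le => //; first exact: rintegrable_bc.
by near: i.
Unshelve. all: by end_near. Qed.

Let Lam_le f g : bounded_continuous f -> bounded_continuous g ->
  (forall x, f x <= g x) -> Lam f <= Lam g.
Proof.
move=> bf bg; apply: Lam_le_near => //; first exact: Lam_cvg.
by apply: nearW => i; exact: rintegrable_bc.
Qed.

Let Lam1 : Lam (fun=> 1) = 1.
Proof.
apply/cvg_lim => //; rewrite [X in X @ _](_ : _ = fun=> 1); first exact: cvg_cst.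
by apply/funext => i; rewrite /mean_of rintegral_cst.
Qed.

Let Lam_exp_tail (f : R -> R) (k th : R) : 0 <= k -> bounded_continuous f ->
  (forall x, f x <= k * expR (th * x)) -> Lam f <= k * M th.
Proof.
move=> k0 bf fh; apply: (@Lam_le_near _ _ (fun x => k * expR (th * x))) => //.
  apply: cvg_trans (cvgM (cvg_cst k) (@mgf_cvg th)); apply: near_eq_cvg.
  near=> i; have ie : forall th, rintegrable (P i) (fun w => expR (th * Y i w)) by near: i.
  by rewrite /mean_of (RintegralZl k measurableT (ie th)).
near=> i; have ie : forall th, rintegrable (P i) (fun w => expR (th * Y i w)) by near: i.
exact: rintegrableZ.
Unshelve. all: by end_near. Qed.

Let M_ge0 th : 0 <= M th.
Proof.
apply: (cvgr_to_ge (@mgf_cvg th)); apply: nearW => i.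
by apply: Rintegral_ge0 => // w _; exact: expR_ge0.
Qed.

(** Chernoff's bound: each tail ramp lies below [expR (1 - A)] times [expR x] or [expR (- x)], and
    [A] solves [expR (1 - A) = e / B]. *)
Let Lam_tight (e : R) : 0 < e -> exists A : R,
  Lam (ramp (- A) (- A + 1)) <= e /\ 1 - e <= Lam (ramp (A - 1) A).
Proof.
move=> e0; pose B := M 1 + M (- 1) + 1.
have B0 : 0 < B by rewrite /B ltr_wpDl// addr_ge0.
have eB : 0 < e / B by rewrite divr_gt0.
exists (1 - ln (e / B)); set A := 1 - _.
have kE : expR (1 - A) = e / B by rewrite /A opprB addrC subrK lnK.
have k0 : 0 <= expR (1 - A) := expR_ge0 _.
have bound m : 0 <= m -> m <= B -> expR (1 - A) * m <= e.
  by move=> m0 mB; rewrite kE mulrAC ler_pdivrMr// ler_pM2l.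
have b1 : expR (1 - A) * M (- 1) <= e.
  by apply: bound => //; rewrite /B; have := M_ge0 1; lra.
have b2 : expR (1 - A) * M 1 <= e.
  by apply: bound => //; rewrite /B; have := M_ge0 (- 1); lra.
split.
  apply: le_trans b1; apply: Lam_exp_tail => //.
    exact: bounded_continuous_ramp.
  move=> x; rewrite -expRD; have [xA|Ax] := leP (- A + 1) x.
    by rewrite ramp_right ?expR_ge0// ltrDl.
  apply: (le_trans (ramp_le1 _ _ _)); rewrite -[X in X <= _]expR0 ler_expR; lra.
rewrite lerBlDr -lerBlDl; apply: le_trans b2.
have br := bounded_continuous_ramp (A - 1) A.
have -> : 1 - Lam (ramp (A - 1) A) = Lam (fun x => 1 + (-1) * ramp (A - 1) A x).
  rewrite LamD; [|exact: bounded_continuous_cst|exact: bounded_continuousZ].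
  by rewrite LamZ// Lam1 mulN1r.
apply: Lam_exp_tail => //.
  by apply: bounded_continuousD; [exact: bounded_continuous_cst|exact: bounded_continuousZ].
move=> x; rewrite -expRD; have [xA|Ax] := leP x (A - 1).
  by rewrite ramp_left ?mulr1 ?subrr ?expR_ge0// gtrBl.
apply: (@le_trans _ _ 1); first by have := ramp_ge0 (A - 1) A x; lra.
rewrite -[X in X <= _]expR0 ler_expR; lra.
Qed.

(** Exponentials are unbounded, so they are truncated at [n + 1]. The part cut off is at most
    [expR (2 * th * x) / (n + 1)], whose mean is controlled by [M (th + th)]: convergence at the
    doubled exponent supplies the uniform integrability. *)
Theorem limit_law_of_mgf : exists mu : probability R R,
  (forall g, bounded_continuous g ->
     mean_of P Y g i @[i --> F] --> Rintegral mu setT g) /\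
  (forall th, rintegrable mu (fun x => expR (th * x)) /\
     Rintegral mu setT (fun x => expR (th * x)) = M th).
Proof.
have [mu muL] := functional_representation LamD LamZ Lam_le Lam1 Lam_tight.
exists mu; split; first by move=> g bg; rewrite muL//; exact: Lam_cvg.
move=> th; pose h (n : nat) x : R := Num.min (expR (th * x)) n.+1%:R.
have h0 n x : 0 <= h n x by rewrite le_min expR_ge0 ler0n.
have hle n x : h n x <= expR (th * x) by rewrite ge_min lexx.
have hS n x : h n x <= h n.+1 x.
  by rewrite le_min hle ge_min ler_nat leqnSn orbT.
have bh n : bounded_continuous (h n).
  split.
    move=> x; apply: (@continuous_min _ _ (fun x => expR (th * x)) (cst n.+1%:R)).
      exact: continuous_expR_scale.
    exact: cvg_cst.
  by exists n.+1%:R => x; rewrite ger0_norm// ge_min lexx orbT.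
have hcvg x : h n x @[n --> \oo] --> expR (th * x).
  apply: cvg_near_cst; exists (Num.truncn (expR (th * x))) => // n /= tn.
  rewrite /h; apply/min_idPl; apply: (@le_trans _ _ (Num.truncn (expR (th * x))).+1%:R).
    by rewrite ltW// truncnS_gt.
  by rewrite ler_nat.
have hM n : Rintegral mu setT (h n) <= M th.
  rewrite muL//; rewrite -[leRHS]mul1r; apply: Lam_exp_tail => // x.
  by rewrite mul1r.
have ih n : rintegrable mu (h n).
  have [ch [B hB]] := bh n; apply: (@rintegrable_bounded _ _ _ _ _ B) => //.
  exact: continuous_measurable_fun.
have iexp : rintegrable mu (fun x => expR (th * x)).
  exact: (rintegrable_monotone_limit ih h0 hS hcvg hM).
split => //.
have [_ lim1] : rintegrable mu (fun x => expR (th * x)) /\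
    Rintegral mu setT (h n) @[n --> \oo] --> Rintegral mu setT (fun x => expR (th * x)).
  apply: rintegral_cvg iexp hcvg => [n|n x].
    exact: rintegrable_measurable.
  by rewrite ger0_norm.
apply: (cvg_unique _ lim1) => //.
apply/cvgrPdist_le => e e0; near=> n.
have n0 : 0 < n.+1%:R :> R by rewrite ltr0n.
have ne : M (th + th) / e <= n.+1%:R.
  apply: (@le_trans _ _ n%:R); last by rewrite ler_nat.
  near: n; exact: nbhs_infty_ger.
rewrite ger0_norm ?subr_ge0// muL//.
have bound : M th <= Lam (h n) + n.+1%:R^-1 * M (th + th).
  rewrite -subr_ge0.
  have l2 : n.+1%:R^-1 * mean_of P Y (fun x => expR ((th + th) * x)) i @[i --> F] -->
      n.+1%:R^-1 * M (th + th) by apply: cvgM; [exact: cvg_cst|exact: mgf_cvg].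
  apply: (cvgr_to_ge (cvgB (cvgD (Lam_cvg (bh n)) l2) (@mgf_cvg th))).
  near=> i; have ie : forall t, rintegrable (P i) (fun w => expR (t * Y i w)) by near: i.
  have i1 := ie th; have i2 := ie (th + th); have i3 := rintegrable_bc i (bh n).
  have i4 := rintegrableZ n.+1%:R^-1 i2.
  rewrite subr_ge0; apply: (@le_trans _ _ (Rintegral (P i) setT (fun w =>
      h n (Y i w) + n.+1%:R^-1 * expR ((th + th) * Y i w)))); last first.
    by rewrite RintegralD// (RintegralZl _ measurableT i2).
  apply: rintegral_le => //; first exact: rintegrableD.
  move=> w; rewrite /h; set y := Y i w.
  have [le|/ltW gt] := leP (expR (th * y)) n.+1%:R.
    by rewrite lerDl mulr_ge0 ?invr_ge0 ?ler0n ?expR_ge0.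
  rewrite mulrDl expRD mulrCA; apply: ler_wpDl => //.
  by rewrite ler_peMr ?expR_ge0// ler_pdivlMl// mulr1.
have : n.+1%:R^-1 * M (th + th) <= e.
  by rewrite ler_pdivrMl// mulrC -ler_pdivrMl// mulrC.
by move=> h5; rewrite lerBlDl; apply: le_trans bound _; rewrite lerD2l.
Unshelve. all: by end_near. Qed.

End LimitLaw.

(** * Determinacy by moments *)

Section MeasureDeterminedByBoundedContinuous.
Variable R : realType.
Implicit Types mu nu : probability R R.

Lemma probability_eq_of_cdf mu nu :
  (forall a, mu `]-oo, a]%classic = nu `]-oo, a]%classic) ->
  forall A, measurable A -> mu A = nu A.
Proof.
move=> E A mA.
have Eoc a b : mu `]a, b]%classic = nu `]a, b]%classic.
  have [ab|ba] := leP a b; last by rewrite set_itv_ge ?measure0// bnd_simp -leNgt ltW.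
  have -> : `]a, b]%classic = `]-oo, b]%classic `\` `]-oo, a]%classic :> set R.
    by rewrite -[RHS]setCK setCD setCitvl setUC -[LHS]setCK setCitv.
  have sub : `]-oo, a]%classic `<=` (`]-oo, b]%classic : set R) by exact: subset_itvl.
  have diff (m : probability R R) : m (`]-oo, b]%classic `\` `]-oo, a]%classic) =
      (m `]-oo, b]%classic - m `]-oo, a]%classic)%E.
    rewrite measureD ?setIidr//; try exact: measurable_itv.
    rewrite (@le_lt_trans _ _ 1%E) ?ltry// probability_le1//; exact: measurable_itv.
  by rewrite !diff !E.
apply: (measure_unique (@ocitv R) (fun n : nat => `]- n%:R, n%:R]%classic)) => //.
- exact: ocitvI.
- by move=> n; exact: is_ocitv.
- rewrite -subTset => x _; exists (Num.truncn `|x|).+1 => //=.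
  have := truncnS_gt `|x|; rewrite ltr_norml in_itv/= => /andP[-> /ltW ->] //.
- by move=> _ [[a b] _ <-]; exact: Eoc.
- by move=> n; rewrite (le_lt_trans (probability_le1 mu _))// ltry.
Qed.

Lemma rintegral_ramp_cvg mu a :
  Rintegral mu setT (ramp a (a + n.+1%:R^-1)) @[n --> \oo] -->
  fine (mu `]-oo, a]%classic).
Proof.
have mI : measurable (`]-oo, a]%classic : set R) by exact: measurable_itv.
rewrite -rintegral_indic//.
have i1 : rintegrable mu (fun=> 1 : R) by exact: rintegrable_cst.
apply: (@rintegral_cvg _ _ _ _ _ _ _ _ _ i1 _).2.
- by move=> n; apply: continuous_measurable_fun; exact: continuous_ramp.
- by move=> n x; rewrite ger0_norm ?ramp_ge0// ramp_le1.
move=> x; rewrite indicE; have [xa|ax] := leP x a.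
  rewrite mem_set//=; apply: cvg_near_cst; apply: nearW => n.
  by rewrite ramp_left// ltrDl.
rewrite memNset/=; last by rewrite in_itv/= leNgt ax.
apply: cvg_near_cst; have xa : 0 < x - a by rewrite subr_gt0.
near=> n; rewrite ramp_right//; first by rewrite ltrDl.
rewrite -lerBrDl invf_ple ?posrE//.
apply: (@le_trans _ _ n%:R); last by rewrite ler_nat.
by near: n; exact: nbhs_infty_ger.
Unshelve. all: by end_near. Qed.

Lemma probability_eq_of_bounded_continuous mu nu :
  (forall g, bounded_continuous g -> Rintegral mu setT g = Rintegral nu setT g) ->
  forall A, measurable A -> mu A = nu A.
Proof.
move=> E; apply: probability_eq_of_cdf => a.
have fin (m : probability R R) : m `]-oo, a]%classic \is a fin_num.
  by apply: fin_num_measure; exact: measurable_itv.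
suff e : fine (mu `]-oo, a]%classic) = fine (nu `]-oo, a]%classic).
  by rewrite -(fineK (fin mu)) -(fineK (fin nu)) e.
have lim := @rintegral_ramp_cvg mu a.
apply: (cvg_unique _ lim) => //.
rewrite [X in X @ _](_ : _ = fun n => Rintegral nu setT (ramp a (a + n.+1%:R^-1))).
  exact: rintegral_ramp_cvg.
by apply/funext => n; apply: E; exact: bounded_continuous_ramp.
Qed.

End MeasureDeterminedByBoundedContinuous.

Section MomentDeterminacy.
Variable R : realType.
Implicit Types mu nu : probability R R.

Lemma rintegrable_pow_of_exp mu : (forall th, rintegrable mu (fun x => expR (th * x))) ->
  forall k, rintegrable mu (fun x => x ^+ k).
Proof.
move=> ie k; have iw : rintegrable mu (expweight 1) by apply: rintegrableD; exact: ie.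
apply: (rintegrable_le _ _ (rintegrableZ k`!%:R iw)); first exact: exprn_measurable.
move=> x; rewrite normrX (le_trans (power_le_expR k (normr_ge0 x)))//.
rewrite ler_wpM2l ?ler0n//.
by have := expR_norm_le_expweight 1 x; rewrite mul1r.
Qed.

(** The odd terms cancel and the even ones are nonnegative, so these polynomials increase to
    [expweight K], and their integrals depend on the moments alone. *)
Definition cosh_partial K n (x : R) : R :=
  \sum_(i < n) ((K * x) ^+ i + (- K * x) ^+ i) / i`!%:R.

Lemma cosh_partial_term_ge0 K i (x : R) :
  0 <= ((K * x) ^+ i + (- K * x) ^+ i) / i`!%:R.
Proof.
rewrite divr_ge0 ?ler0n// mulNr exprNn -signr_odd.
have [oi|ei] := boolP (odd i); first by rewrite expr1 mulN1r subrr.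
by rewrite expr0 mul1r -mulr2n mulrn_wge0// exprn_even_ge0.
Qed.

Lemma cosh_partial_cvg K x : cosh_partial K n x @[n --> \oo] --> expweight K x.
Proof.
have h y : series (exp_coeff y) n @[n --> \oo] --> expR y.
  exact: is_cvg_series_exp_coeff.
rewrite [X in X @ _](_ : _ = fun n => series (exp_coeff (K * x)) n +
    series (exp_coeff (- K * x)) n); first by apply: cvgD; exact: h.
apply/funext => n; rewrite /cosh_partial /series /= !big_mkord -big_split /=.
by apply: eq_bigr => i _; rewrite mulrDl.
Qed.

Lemma cosh_partial_le K n x : cosh_partial K n x <= expweight K x.
Proof.
have cv := @cosh_partial_cvg K x.
rewrite -(cvg_lim (@norm_hausdorff _ _) cv).
apply: (@nondecreasing_cvgn_le _ (cosh_partial K ^~ x)); last exact: cvgP cv.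
apply/nondecreasing_seqP => m.
by rewrite /cosh_partial big_ord_recr /= lerDl cosh_partial_term_ge0.
Qed.

Lemma cosh_partialE K n : cosh_partial K n =
  fun x => \sum_(i < n) ((K ^+ i + (- K) ^+ i) / i`!%:R) * x ^+ i.
Proof.
by apply/funext => x; apply: eq_bigr => i _; rewrite !exprMn -mulrDl mulrAC.
Qed.

Lemma rintegrable_cosh_partial mu K n : (forall k, rintegrable mu (fun x => x ^+ k)) ->
  rintegrable mu (cosh_partial K n).
Proof.
by move=> ip; rewrite cosh_partialE; apply: rintegrable_sum => i; exact: rintegrableZ.
Qed.

Lemma rintegral_cosh_partial mu K n : (forall k, rintegrable mu (fun x => x ^+ k)) ->
  Rintegral mu setT (cosh_partial K n) = \sum_(i < n)
    ((K ^+ i + (- K) ^+ i) / i`!%:R) * Rintegral mu setT (fun x => x ^+ i).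
Proof.
move=> ip; rewrite cosh_partialE rintegral_sum => [|i]; last exact: rintegrableZ.
by apply: eq_bigr => i _; have ii := ip i; rewrite (RintegralZl _ measurableT ii).
Qed.

(** Equality of moments bounds the integrals of [cosh_partial K n] under [nu] by an exponential
    integral under [mu]. By monotone limits [nu] then integrates the weights too, and the passage
    from moments to bounded continuous functions applies to both laws. *)
Theorem moment_determinate_of_exp mu :
  (forall th, rintegrable mu (fun x => expR (th * x))) -> moment_determinate mu.
Proof.
move=> ie; have ip := rintegrable_pow_of_exp ie.
split=> [k|nu iq' mE]; first exact: ip.
have iq k : rintegrable nu (fun x => x ^+ k) by exact: iq'.
have E k : Rintegral nu setT (fun x => x ^+ k) = Rintegral mu setT (fun x => x ^+ k).
  by rewrite /Rintegral mE.
have iw K : rintegrable mu (expweight K) by apply: rintegrableD; exact: ie.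
have cpS K n x : cosh_partial K n x <= cosh_partial K n.+1 x.
  by rewrite /cosh_partial big_ord_recr /= lerDl cosh_partial_term_ge0.
have cp0 K n x : 0 <= cosh_partial K n x.
  by apply: sumr_ge0 => i _; exact: cosh_partial_term_ge0.
have cpM K n : Rintegral nu setT (cosh_partial K n) <= Rintegral mu setT (expweight K).
  rewrite rintegral_cosh_partial//.
  rewrite (eq_bigr (fun i : 'I_n => ((K ^+ i + (- K) ^+ i) / i`!%:R) *
    Rintegral mu setT (fun x => x ^+ i))) => [|i _]; last by rewrite E.
  rewrite -rintegral_cosh_partial//; apply: rintegral_le => //.
    exact: rintegrable_cosh_partial.
  by move=> x; exact: cosh_partial_le.
have jw K : rintegrable nu (expweight K).
  apply: (rintegrable_monotone_limit _ (cp0 K) (cpS K) (@cosh_partial_cvg K) (cpM K)).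
  by move=> n; exact: rintegrable_cosh_partial.
(* Along the trivial filter on [bool], a family of means converges only if its
   two members are equal. *)
pose P (b : bool) := if b then mu else nu.
have FF : ProperFilter (globally [set: bool]) by apply: (@globally_properfilter _ _ true).
have nearb (Q : bool -> Prop) : Q true -> Q false -> \forall b \near globally [set: bool], Q b.
  by move=> ? ? [].
have mid : forall b : bool, measurable_fun setT (fun x : R => x) by [].
have conv g : bounded_continuous g ->
    converges (F := globally [set: bool]) P (fun _ : bool => id) g.
  apply: converges_bounded_continuous => //.
    move=> K; exists (Num.max (Rintegral mu setT (expweight K))
      (Rintegral nu setT (expweight K))).
    by apply: nearb; split=> //; rewrite /mean_of le_max lexx ?orbT.
  move=> j; split; first exact: exprn_measurable.
    by apply: nearb; [exact: ip|exact: iq].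
  exists (Rintegral mu setT (fun x => x ^+ j)); apply: cvg_near_cst.
  by apply: nearb; rewrite /mean_of //= E.
move=> A mA; apply/esym; apply: probability_eq_of_bounded_continuous => // g bg.
have [_ _ [l hl]] := conv _ bg.
have eq_l b : mean_of P (fun _ : bool => id) g b = l.
  apply/esym/eqP; rewrite -subr_eq0 -normr_le0; apply/ler_addgt0Pr => e e0.
  by rewrite add0r; have /cvgrPdist_le/(_ _ e0) := hl; apply.
exact: (etrans (eq_l true) (esym (eq_l false))).
Qed.

End MomentDeterminacy.

(** * Non-Gaussianity *)

Section GaussianMgf.
Variable R : realType.

(* Multiplying the density of scale [s] by this weight gives, up to a constant,
   the density of scale [2 * s]; the weight dominates every exponential. *)
Let weight (m s x : R) := expR (3 / 8 * ((x - m) / s) ^+ 2).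

Let measurable_weight m s : measurable_fun setT (weight m s).
Proof.
apply: continuous_measurable_fun.
apply: continuous_comp_real; last exact: continuous_expR.
move=> x; apply: cvgM; first exact: cvg_cst.
by apply: cvgM; (apply: cvgM; last exact: cvg_cst);
  apply: cvgB; [exact: cvg_id|exact: cvg_cst|exact: cvg_id|exact: cvg_cst].
Qed.

(** The exponents add up because [3 / 8 - 1 / 2 = - 1 / 8], the coefficient for the doubled
    scale. *)
Let weight_pdf m s x : s != 0 ->
  weight m s x * normal_pdf m s x =
  normal_peak s / normal_peak (2 * s) * normal_pdf m (2 * s) x.
Proof.
move=> s0; have s20 : 2 * s != 0 by rewrite mulf_neq0.
rewrite !normal_pdfE// mulrCA -[RHS]mulrA [_^-1 * (_ * _)]mulKf ?gt_eqF ?normal_peak_gt0//.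
congr (_ * _); rewrite /weight /normal_fun -expRD; congr expR.
by field.
Qed.

(** The change of variables goes through the Radon-Nikodym derivative, which agrees almost
    everywhere with [normal_pdf] because the two have the same integrals over measurable sets. *)
Let integral_weight m s : s != 0 ->
  (\int[normal_prob m s]_x (weight m s x)%:E =
   (normal_peak s / normal_peak (2 * s))%:E)%E.
Proof.
move=> s0; have dom := normal_prob_dominates m s.
have mw : measurable_fun setT (EFin \o weight m s : measurableTypeR R -> \bar R).
  by apply/measurable_EFinP; exact: measurable_weight.
have mp t : measurable_fun setT (EFin \o normal_pdf m t : measurableTypeR R -> \bar R).
  by apply/measurable_EFinP; exact: measurable_normal_pdf.
pose g := Radon_Nikodym_SigmaFinite.f (normal_prob m s) (@lebesgue_measure R).
have ig := Radon_Nikodym_SigmaFinite.f_integrable dom.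
have mg : measurable_fun setT g by exact: measurable_int ig.
have gE : ae_eq (@lebesgue_measure R) setT g (EFin \o normal_pdf m s).
  apply: integral_ae_eq => // E _ mE.
  by rewrite -Radon_Nikodym_SigmaFinite.f_integral.
rewrite -(Radon_Nikodym_SigmaFinite.change_of_variables dom)//; last first.
  by move=> x; rewrite lee_fin expR_ge0.
transitivity (\int[@lebesgue_measure R]_x
    ((weight m s x)%:E * (normal_pdf m s x)%:E))%E.
  apply: ae_eq_integral => //.
  - exact: (emeasurable_funM mw mg).
  - exact: (emeasurable_funM mw (mp s)).
  - exact: ae_eqe_mul2l.
under eq_integral do rewrite -EFinM weight_pdf// EFinM.
rewrite ge0_integralZl//.
- by rewrite integral_normal_pdf mule1.
- exact: mp.
- by move=> x _; rewrite lee_fin normal_pdf_ge0.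
- by rewrite lee_fin divr_ge0 ?normal_peak_ge0.
Qed.

Variable mu : probability R R.

(** With [v = (x - m) / s], completing the square gives [s * th * v <= s ^ 2 * th ^ 2 + v ^ 2 / 4],
    and the weight absorbs [v ^ 2 / 4]. The exact exponent is smaller, but only its quadratic growth
    in [th] matters. *)
Let nondegenerate_mgf_le m s : s != 0 ->
  (forall A, measurable A -> mu A = normal_prob m s A) ->
  exists2 C, 0 <= C & forall th,
    Rintegral mu setT (fun x => expR (th * x)) <= C * expR (m * th + s ^+ 2 * th ^+ 2).
Proof.
move=> s0 muE.
pose idR : measurableTypeR R -> R := idfun.
have mid : measurable_fun setT idR by move=> _ A mA; rewrite setTI.
pose X : {mfun measurableTypeR R >-> R} := mfun_Sub (mem_set mid).
have wE : (\int[mu]_x (weight m s x)%:E =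
    (normal_peak s / normal_peak (2 * s))%:E)%E.
  rewrite -(@integral_weight m s s0).
  transitivity (\int[pushforward (normal_prob m s) X]_x (weight m s x)%:E)%E.
    by apply: eq_measure_integral => A mA _; exact: muE.
  rewrite ge0_integral_pushforward//.
  - by apply/measurable_EFinP; exact: measurable_weight.
  - by move=> x _; rewrite lee_fin expR_ge0.
have iw : rintegrable mu (weight m s).
  apply/integrableP; split; first by apply/measurable_EFinP; exact: measurable_weight.
  under eq_integral do rewrite /= ger0_norm ?expR_ge0//.
  by rewrite wE ltry.
exists (Rintegral mu setT (weight m s)).
  by apply: Rintegral_ge0 => // x _; exact: expR_ge0.
move=> th; rewrite mulrC -(RintegralZl _ measurableT iw).
have bound x : expR (th * x) <= expR (m * th + s ^+ 2 * th ^+ 2) * weight m s x.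
  rewrite -expRD ler_expR; set v := (x - m) / s.
  have -> : x = m + s * v by rewrite /v mulrC divfK// subrKC.
  have := sqr_ge0 (s * th - v / 2); have := sqr_ge0 v; rewrite !expr2; nra.
have ib := rintegrableZ (expR (m * th + s ^+ 2 * th ^+ 2)) iw.
apply: rintegral_le => //; apply: rintegrable_le ib.
  apply: continuous_measurable_fun; apply: continuous_comp_real; last exact: continuous_expR.
  by move=> x; apply: cvgM; [exact: cvg_cst|exact: cvg_id].
by move=> x; rewrite ger0_norm ?expR_ge0.
Qed.

Lemma gaussian_mgf_le : gaussian mu -> exists m s C, 0 <= C /\ forall th,
  Rintegral mu setT (fun x => expR (th * x)) <= C * expR (m * th + s ^+ 2 * th ^+ 2).
Proof.
move=> [m [s muE]]; exists m, s; have [s0|s0] := eqVneq s 0; last first.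
  have [A mA|C C0 HC] := @nondegenerate_mgf_le m s s0; last by exists C.
  by rewrite muE// (negbTE s0).
exists 1; split => // th; rewrite mul1r s0 expr0n mul0r addr0 /Rintegral.
have mexp : measurable_fun setT (fun x => (expR (th * x))%:E : \bar R).
  apply/measurable_EFinP; apply: continuous_measurable_fun.
  apply: continuous_comp_real; last exact: continuous_expR.
  by move=> x; apply: cvgM; [exact: cvg_cst|exact: cvg_id].
rewrite (@eq_measure_integral _ _ _ setT (dirac m) mu); last first.
  by move=> A mA _; have := muE A mA; rewrite s0 eqxx.
by rewrite integral_dirac// diracT mul1e mulrC.
Qed.

Lemma gaussian_mgf_sym_not_quartic (k : R) : 0 < k -> gaussian mu ->
  ~ (forall th, expR (k * th ^+ 4) <= Rintegral mu setT (fun x => expR (th * x)) *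
       Rintegral mu setT (fun x => expR (- th * x))).
Proof.
move=> k0 /gaussian_mgf_le[m [s [C [C0 HC]]]] H.
pose D := 2 * s ^+ 2; have D0 : 0 <= D by rewrite mulr_ge0 ?sqr_ge0.
have bound th : expR (k * th ^+ 4) <= C ^+ 2 * expR (D * th ^+ 2).
  apply: le_trans (H th) _.
  have -> : C ^+ 2 * expR (D * th ^+ 2) = (C * expR (m * th + s ^+ 2 * th ^+ 2)) *
      (C * expR (m * - th + s ^+ 2 * (- th) ^+ 2)).
    rewrite [RHS]mulrACA -expRD expr2; congr (_ * expR _); rewrite /D; ring.
  by apply: ler_pM; [exact: Rintegral_ge0|exact: Rintegral_ge0|exact: HC|exact: HC].
(* [t] stands for [th ^ 2]. As [t >= 1] and [k * t - D >= C ^ 2 + 1], the exponential of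
   [k * t ^ 2 - D * t] exceeds [C ^ 2]. *)
pose t := (D + C ^+ 2 + 1) / k + 1.
have C20 : 0 <= C ^+ 2 := sqr_ge0 C.
have t1 : 1 <= t by rewrite /t lerDr divr_ge0 ?(ltW k0)//; lra.
have kt : k * t = D + C ^+ 2 + 1 + k by rewrite /t mulrDr mulr1 mulrC divfK// gt_eqF.
have := bound (Num.sqrt t).
rewrite (_ : Num.sqrt t ^+ 4 = t * t); last first.
  by rewrite (exprM _ 2 2) sqr_sqrtr ?expr2//; lra.
rewrite sqr_sqrtr; last by lra.
rewrite -ler_pdivrMr ?expR_gt0// -expRN -expRD => h.
have h1 := expR_ge1Dx (k * (t * t) - D * t).
have : C ^+ 2 + 1 <= k * (t * t) - D * t.
  rewrite mulrA kt -mulrBl; nra.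
by lra.
Qed.

End GaussianMgf.

(** * Quartic lower bound for the Gaussian kernel *)

Section GaussianKernel.
Variable R : realType.
Local Notation mu := (@lebesgue_measure R).

Lemma rintegral_ge_unit_interval (g : R -> R) (a k : R) : rintegrable mu g ->
  (forall y, 0 <= g y) -> 0 <= k -> (forall y, a <= y <= a + 1 -> k <= g y) ->
  k <= Rintegral mu setT g.
Proof.
move=> ig g0 k0 kg.
pose A : set R := `[a, a + 1]%classic.
have mA : measurable A by exact: measurable_itv.
have mg : measurable_fun setT (EFin \o g).
  exact: measurable_int ig.
rewrite -lee_fin /Rintegral fineK; last exact: integrable_fin_num.
have muA : mu A = 1%E.
  have -> : mu A = ((a + 1)%:E - a%:E)%E.
    by have := lebesgue_measure_itv `[a, a + 1]%R; rewrite /= lte_fin ltrDl ltr01.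
  by rewrite -EFinB addrAC subrr add0r.
have -> : (k%:E = \int[mu]_(x in A) k%:E)%E 
  by rewrite integral_cst// [X in (_ * X)%E](_ : _ = 1%E) ?mule1.
apply: (@le_trans _ _ (\int[mu]_(x in A) (g x)%:E)%E).
  by apply: ge0_le_integral => //; exact: measurable_funTS mg.
by apply: ge0_subset_integral => // x _; rewrite lee_fin.
Qed.

Let f (x : R) := expR (- x ^+ 2).

(** The second hypothesis says that [y + u] is markedly farther from the origin than [y]. Then
    [expR (- y ^ 2) >= expR (- 4)], and [1 - expR (- a) >= 1 - 1 / (1 + a)] is used with
    [a >= 2 * |u|]. *)
Lemma increment_gauss_ge (u y : R) : y ^+ 2 <= 4 -> 2 * `|u| <= 2 * y * u + u ^+ 2 ->
  expR (- 4) * (2 * `|u| / (1 + 2 * `|u|)) <= - increment f u y.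
Proof.
move=> y4 hu; have u0 : 0 < 1 + 2 * `|u| by rewrite ltr_pwDl// mulr_ge0.
have -> : - increment f u y = expR (- y ^+ 2) * (1 - expR (- (2 * y * u + u ^+ 2))).
  rewrite /increment /f mulrBr mulr1 -expRD opprB; congr (_ - expR _); ring.
apply: ler_pM.
- exact: expR_ge0.
- by rewrite divr_ge0 ?(ltW u0)// mulr_ge0.
- by rewrite ler_expR lerN2.
rewrite expRN; have h := expR_ge1Dx (2 * y * u + u ^+ 2).
have -> : 2 * `|u| / (1 + 2 * `|u|) = 1 - (1 + 2 * `|u|)^-1.
  by field; rewrite gt_eqF.
rewrite lerD2l lerN2 lef_pV2 ?posrE ?expR_gt0//.
by apply: le_trans h; rewrite lerD2l.
Qed.

(** The ratio is at least [2 / 3 * |u|] for [|u| <= 1] and at least [2 / 3] beyond. The constant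
    [9 / 2] comes from the second range, where [1 - cos u <= 2]. *)
Lemma onemcos_le_ratio (u : R) :
  1 - cos u <= 9 / 2 * (2 * `|u| / (1 + 2 * `|u|)) ^+ 2.
Proof.
have u0 : 0 < 1 + 2 * `|u| by rewrite ltr_pwDl// mulr_ge0.
have un := normr_ge0 u; set q := 2 * `|u| / (1 + 2 * `|u|).
have [u1|/ltW u1] := leP `|u| 1.
  have h : 2 / 3 * `|u| <= q.
    rewrite /q ler_pdivlMr//; nra.
  apply: (le_trans (onemcos_le u)); rewrite -[u ^+ 2]real_normK ?num_real//.
  have : (2 / 3 * `|u|) ^+ 2 <= q ^+ 2.
    by rewrite ler_sqr ?nnegrE ?divr_ge0 ?mulr_ge0 ?(ltW u0)//; nra.
  by rewrite exprMn; have := sqr_ge0 `|u|; lra.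
have h : 2 / 3 <= q by rewrite /q ler_pdivlMr//; nra.
have : (2 / 3) ^+ 2 <= q ^+ 2 by rewrite ler_sqr ?nnegrE ?divr_ge0 ?mulr_ge0 ?(ltW u0).
by have := cos_geN1 u; lra.
Qed.

Lemma expweight_ge_quartic (v : R) : v ^+ 4 / 12 + 2 <= expweight 1 v.
Proof.
have := cosh_partial_le 1 5 v; rewrite /cosh_partial !big_ord_recl big_ord0 /=.
rewrite /bump /= !mul1r !mulN1r; apply: le_trans.
rewrite !addn0 !add1n !factS fact0 [leRHS](_ : _ = v ^+ 4 / 12 + 2 + v ^+ 2).
  by rewrite lerDl sqr_ge0.
by field.
Qed.

Variables (df : R -> R) (C : R).
Hypothesis fC : smooth_decay f df C.

(** Adding the two signs of [th] gives the integrand [2 * cosh v - 2 >= v ^ 4 / 12] with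
    [v = th * increment f u y]. On a suitable unit interval of [y] the increment is at least
    [expR (- 4) * q] in absolute value, and [1 - cos u <= 9 / 2 * q ^ 2]; hence
    [243 = 12 * (9 / 2) ^ 2]. *)
Lemma mean_expinc_gauss_ge (th u : R) :
  expR (- 4) ^+ 4 / 243 * th ^+ 4 * (1 - cos u) ^+ 2 <=
  mean_expinc f th u + mean_expinc f (- th) u.
Proof.
have i1 := rintegrable_expinc fC th u; have i2 := rintegrable_expinc fC (- th) u.
have u0 : 0 < 1 + 2 * `|u| by rewrite ltr_pwDl// mulr_ge0.
pose q := 2 * `|u| / (1 + 2 * `|u|).
have q0 : 0 <= q by rewrite divr_ge0 ?(ltW u0)// mulr_ge0.
have sym y : expinc f th u y + expinc f (- th) u y =
    expweight 1 (th * increment f u y) - 2.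
  by rewrite /expinc /expweight mul1r mulN1r mulNr; ring.
have sym_ge y : (th * increment f u y) ^+ 4 / 12 <=
    expinc f th u y + expinc f (- th) u y.
  by rewrite sym lerBrDr expweight_ge_quartic.
have th4 : 0 <= th ^+ 4 by rewrite exprn_even_ge0.
have e4 : 0 <= expR (- 4) ^+ 4 :> R by rewrite exprn_ge0 ?expR_ge0.
rewrite /mean_expinc -RintegralD//.
(* On [a, a + 1], [y] has the sign of [u] and 1 <= |y| <= 2. *)
pose a : R := if 0 <= u then 1 else -2.
apply: (@rintegral_ge_unit_interval _ a).
- exact: rintegrableD.
- by move=> y; apply: le_trans (sym_ge y); rewrite divr_ge0 ?exprn_even_ge0.
- by rewrite mulr_ge0 ?sqr_ge0// mulr_ge0// divr_ge0.
move=> y /andP[ay ya]; apply: le_trans (sym_ge y).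
have inc : expR (- 4) * q <= - increment f u y.
  apply: increment_gauss_ge; move: ay ya; rewrite /a; case: (leP 0 u) => uu ay ya.
  - nra.
  - nra.
  - by rewrite ger0_norm//; nra.
  - by rewrite ltr0_norm//; nra.
have inc4 : (expR (- 4) * q) ^+ 4 <= increment f u y ^+ 4.
  rewrite -[leRHS](_ : (- increment f u y) ^+ 4 = _); last by ring.
  by rewrite lerXn2r// nnegrE ?mulr_ge0 ?expR_ge0// (le_trans _ inc)// mulr_ge0// expR_ge0.
have cosq : (1 - cos u) ^+ 2 <= (9 / 2 * q ^+ 2) ^+ 2.
  rewrite ler_sqr ?nnegrE ?onemcos_ge0 ?mulr_ge0 ?sqr_ge0 ?divr_ge0//.
  exact: onemcos_le_ratio.
apply: (@le_trans _ _ (expR (- 4) ^+ 4 / 243 * th ^+ 4 * (9 / 2 * q ^+ 2) ^+ 2)).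
  by rewrite ler_wpM2l// mulr_ge0// divr_ge0.
have -> : expR (- 4) ^+ 4 / 243 * th ^+ 4 * (9 / 2 * q ^+ 2) ^+ 2 =
    th ^+ 4 / 12 * (expR (- 4) * q) ^+ 4 by field.
rewrite [in leRHS]exprMn [leLHS]mulrAC; apply: ler_wpM2r; first by rewrite invr_ge0.
exact: ler_wpM2l.
Qed.

End GaussianKernel.

Section QuarticGrowth.
Context {d : measure_display} {T : measurableType d} {R : realType}.
Variables (P : probability T R) (X : T -> R) (c : R).
Hypothesis mX : measurable_fun setT X.
Hypothesis cre : (fun t => (1 - charfun_re P X t) / `|t|) @ 0^' --> c.

Let onemcos_sqr (u : R) : R := (1 - cos u) ^+ 2.

Let rintegrable_onemcos (t r : R) : rintegrable P (fun w => 1 - cos (t * (X w / r))).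
Proof.
apply: (@rintegrable_bounded _ _ _ _ _ 2).
  apply: (measurable_comp_continuous (g := fun x => 1 - cos (t * (x / r)))) => //.
  move=> x; apply: cvgB; first exact: cvg_cst.
  apply: continuous_comp; last exact: continuous_cos.
  by apply: cvgM; [exact: cvg_cst|apply: cvgM; [exact: cvg_id|exact: cvg_cst]].
move=> w; rewrite ger0_norm ?onemcos_ge0//.
by have := cos_geN1 (t * (X w / r)); lra.
Qed.

(** The square equals [2 * (1 - cos u) - (1 - cos (2 * u)) / 2], so its limit is a combination of
    two known cosine limits. *)
Lemma scaled_onemcos_sqr_cvg : scaled_mean P X onemcos_sqr r @[r --> +oo] -->
  c / (2 * pi).
Proof.
have -> : c / (2 * pi) = 2 * (c * `|1| / (2 * pi)) - 2^-1 * (c * `|2| / (2 * pi)).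
  rewrite normr1 normr_nat mulr1; have := pi_gt0 R; move: pi => p p0.
  by field; rewrite gt_eqF.
rewrite [X in X @ _](_ : _ = fun r =>
    2 * (r * Rintegral P setT (fun w => 1 - cos (1 * (X w / r)))) -
    2^-1 * (r * Rintegral P setT (fun w => 1 - cos (2 * (X w / r))))).
  by apply: cvgB; apply: cvgM; [exact: cvg_cst|exact: scaled_cos_cvg
    |exact: cvg_cst|exact: scaled_cos_cvg].
apply/funext => r; rewrite /scaled_mean.
have i1 := rintegrable_onemcos 1 r; have i2 := rintegrable_onemcos 2 r.
have E : (fun w => onemcos_sqr (X w / r)) = (fun w =>
    2 * (1 - cos (1 * (X w / r))) - 2^-1 * (1 - cos (2 * (X w / r)))).
  apply/funext => w; rewrite /onemcos_sqr mul1r; set u := X w / r.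
  have -> : 2 * u = u *+ 2 by rewrite mulr_natl.
  by rewrite cos_mulr2n -mulr_natl; field.
have j1 := rintegrableZ 2 i1; have j2 := rintegrableZ 2^-1 i2.
rewrite E (RintegralB measurableT j1 j2) (RintegralZl 2 measurableT i1).
by rewrite (RintegralZl 2^-1 measurableT i2); ring.
Qed.

Lemma limit_ge_onemcos_sqr (g h : R -> R) (l m k : R) :
  bounded_continuous g -> bounded_continuous h ->
  (forall u, k * (1 - cos u) ^+ 2 <= g u + h u) ->
  scaled_mean P X g r @[r --> +oo] --> l ->
  scaled_mean P X h r @[r --> +oo] --> m -> k * (c / (2 * pi)) <= l + m.
Proof.
move=> bg bh gh gl hm; rewrite -subr_ge0.
have lim : scaled_mean P X g r + scaled_mean P X h r - k * scaled_mean P X onemcos_sqr r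
    @[r --> +oo] --> l + m - k * (c / (2 * pi)).
  apply: cvgB; first exact: cvgD.
  by apply: cvgM; [exact: cvg_cst|exact: scaled_onemcos_sqr_cvg].
apply: (cvgr_to_ge lim); near=> r.
have r0 : 0 < r by near: r; apply: nbhs_pinfty_gt; rewrite num_real.
have bs : bounded_continuous onemcos_sqr.
  split.
    move=> x; apply: (@continuous_comp _ _ _ (fun x => 1 - cos x) (fun x => x ^+ 2)).
      by apply: cvgB; [exact: cvg_cst|exact: continuous_cos].
    exact: exprn_continuous.
  exists 4 => x; rewrite ger0_norm ?sqr_ge0// (_ : 4 = 2 ^+ 2); last by ring.
  by rewrite ler_sqr ?nnegrE ?onemcos_ge0//; have := cos_geN1 x; lra.
rewrite subr_ge0 -scaled_meanD// -scaled_meanZ//.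
apply: ler_wpM2l; first exact: ltW.
apply: rintegral_le => [||w]; last exact: gh.
- exact: (@rintegrable_scaled _ _ _ P X mX _ r (bounded_continuousZ k bs)).
- exact: (@rintegrable_scaled _ _ _ P X mX _ r (bounded_continuousD bg bh)).
Unshelve. all: by end_near. Qed.

End QuarticGrowth.

Section ConvergenceInDistribution.
Context {d : measure_display} {T : measurableType d} {R : realType}.

Lemma cvg_in_distribution_of_rintegral (P : probability T R) (Y : R -> T -> R)
    (mu : probability R R) : (forall r, measurable_fun setT (Y r)) ->
  (forall g, bounded_continuous g ->
    Rintegral P setT (fun w => g (Y r w)) @[r --> +oo] --> Rintegral mu setT g) ->
  cvg_in_distribution P Y mu.
Proof.
move=> mY H g cg [M gM].
have ig (r : R) : rintegrable P (fun w => g (Y r w)).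
  by apply: rintegrable_bounded (fun w => gM _); exact: measurable_comp_continuous.
have im : rintegrable mu g.
  by apply: rintegrable_bounded gM; exact: continuous_measurable_fun.
rewrite -(fineK (integrable_fin_num measurableT im)).
rewrite [X in X @ _](_ : _ = fun r => (Rintegral P setT (fun w => g (Y r w)))%:E).
  by apply: cvg_EFin; [exact: nearW|apply: H; split => //; exists M].
by apply/funext => r; rewrite fineK//; exact: integrable_fin_num (ig r).
Qed.

End ConvergenceInDistribution.

(** For the complex-valued characteristic function, the asymptotic relation with [c * |t|] amounts
    to the two real limits assumed. Limits in distribution being unique, the last clause does
    concern the limit law. *)
Theorem theorem4p1 (R : realType) (d : measure_display) (T : measurableType d)
  (P : probability T R) (f : R -> R) (xi : int -> T -> R) :
  schwartz f ->
  (forall x, measurable_fun setT (xi x)) ->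
  mutually_independent P xi ->
  identically_distributed P xi ->
  (exists c : R, 0 < c /\
     ((fun t => (1 - charfun_re P (xi 0) t) / `|t|) @ 0^' --> c) /\
     ((fun t => charfun_im P (xi 0) t / `|t|) @ 0^' --> 0)) ->
  exists mu : probability R R,
    cvg_in_distribution P
      (fun r w => Tstat f xi r w - r * Rintegral lebesgue_measure setT f) mu /\
    moment_determinate mu /\
    ((f = fun x => expR (- x ^+ 2)) -> ~ gaussian mu).
Proof.
move=> fS mxi ind iid [c [c0 [cre cim]]].
have [df [C fC]] := schwartz_smooth_decay fS.
have /choice[psi Hpsi] : forall th, exists psi : R,
    scaled_mean P (xi 0) (mean_expinc f th) r @[r --> +oo] --> psi /\
    Rintegral P setT (fun w => expR (th * (Tstat f xi r w -
      r * Rintegral lebesgue_measure setT f))) @[r --> +oo] --> expR psi.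
  move=> th; have [psi h1 h2] := centered_mgf_cvg mxi ind iid cre cim fC th.
  by exists psi.
pose Y (r : R) w := Tstat f xi r w - r * Rintegral lebesgue_measure setT f.
have mY r : measurable_fun setT (Y r).
  by apply: measurable_funB => //; exact: measurable_Tstat fC r.
have iY : \forall r \near +oo, forall th, rintegrable P (fun w => expR (th * Y r w)).
  near=> r => th.
  have r1 : 1 <= r by near: r; apply: nbhs_pinfty_ge; rewrite num_real.
  have [iT _] := exp_Tstat_cvg mxi ind iid fC th r1.
  rewrite [X in rintegrable _ X](_ : _ = fun w =>
    expR (- (th * (r * Rintegral lebesgue_measure setT f))) * expR (th * Tstat f xi r w)).
    exact: rintegrableZ.
  by apply/funext => w; rewrite -expRD /Y mulrBr addrC.
have [mu [mu_cvg mu_exp]] := limit_law_of_mgf (P := fun _ : R => P) mY iY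
  (fun th => (Hpsi th).2).
exists mu; split; first exact: cvg_in_distribution_of_rintegral.
split; first by apply: moment_determinate_of_exp => th; have [] := mu_exp th.
move=> fE; move: fC Hpsi; rewrite fE => fC Hpsi mu_gauss.
(* The constant of [mean_expinc_gauss_ge] times the scaled limit of [(1 - cos u) ^ 2]; it is
   positive because [c] is. *)
have k0 : 0 < expR (- 4) ^+ 4 / 243 * (c / (2 * pi)) :> R.
  by rewrite mulr_gt0 ?divr_gt0 ?exprn_gt0 ?expR_gt0 ?mulr_gt0 ?pi_gt0.
apply: (gaussian_mgf_sym_not_quartic k0 mu_gauss) => th.
rewrite (mu_exp th).2 (mu_exp (- th)).2 -expRD ler_expR.
have bm t : bounded_continuous (mean_expinc (fun x : R => expR (- x ^+ 2)) t).
  split; first by move=> u; exact: (@continuous_mean_expinc _ _ _ _ fC t u).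
  have [K K0 HK] := mean_expinc_trunc2 fC t; exists K => u.
  by apply: (le_trans (HK u)); rewrite ler_piMr// trunc2_le1.
have := limit_ge_onemcos_sqr (mxi 0) cre (bm th) (bm (- th))
  (mean_expinc_gauss_ge fC th) (Hpsi th).1 (Hpsi (- th)).1.
by apply: le_trans; rewrite mulrAC.
Unshelve. all: by end_near. Qed.
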